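(* Let $M\subset\mathbb{R}^N$ be a compact $C^2$ submanifold of dimension $m$ and $\mathcal{P}\subset M$ a finite set meeting every connected component of $M$. Let $\mathcal{A}$ be a simplicial complex (of Euclidean simplices) whose vertex set is identified with $\mathcal{P}$ by a bijection such that the resulting piecewise linear map $\iota\colon|\mathcal{A}|\to\mathbb{R}^N$ restricts to an embedding on $|\mathrm{st}(p)|$ for every vertex $p$. Suppose: (a) for each $p\in\mathcal{P}$, the orthogonal projection $\pi_{T_pM}$ restricted to $\iota(|\mathrm{st}(p)|)$ is an embedding and $p$ lies in the interior of $\pi_{T_pM}(\iota(|\mathrm{st}(p)|))$ (within the $m$-flat $T_pM$); (b) there are constants $0<t_0\le1$, $0<\mu_0\le1$, $\epsilon_0>0$ with $\epsilon_0\le\mu_0^{1/2}t_0^2/18$ such that every simplex $\sigma\in\iota(\mathcal{A})$ of positive dimension and every vertex $p$ of $\sigma$ satisfy $t(\sigma)\ge t_0$ and $\mu_0\epsilon_0\,\mathrm{lfs}(p)\le L(\sigma)\le\epsilon_0\,\mathrm{lfs}(p)$; (c) for any vertices $p,q\in\mathcal{P}$ with $q\in B(p,\mathrm{lfs}(p)/15)\cap M$: $\pi_{T_pM}(q)\in\pi_{T_pM}(\iota(|\mathrm{st}(p)|))$ if and only if $q$ is a vertex of $\mathrm{st}(p)$. Then: (1) $\iota$ is an embedding, so $\mathcal{A}$ may be identified with $\iota(\mathcal{A})$; (2) the closest-point projection $\pi_M|_{|\mathcal{A}|}\colon|\mathcal{A}|\to M$ is a homeomorphism; (3) for every $x\in\sigma\in\mathcal{A}$,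 with $\check x=\pi_M(x)$, $$d_M(x)=\|\check x-x\|\le\tfrac73\epsilon_0^2\,\mathrm{lfs}(\check x),\qquad \sin\angle(\sigma,T_{\check x}M)\le\frac{13\epsilon_0}{4t_0}.$$
   Context: $\mathrm{st}(p)$ is the subcomplex of simplices containing the vertex $p$ together with their faces. The medial axis of $M$ is the set of points of $\mathbb{R}^N$ with more than one closest point on $M$; $U_M$ is the complement of its closure; $\pi_M\colon U_M\to M$ is the closest-point projection; $d_M(x)=\mathrm{dist}(x,M)$. The local feature size $\mathrm{lfs}(y)$ of $y\in M$ is the distance from $y$ to the medial axis. $T_pM$ is viewed as an affine $m$-flat through $p$ in $\mathbb{R}^N$, and $\pi_{T_pM}$ is orthogonal projection onto it. For a $j$-simplex, $L$ is the longest edge length, $a$ the smallest altitude, $t=a/(jL)$. $\angle(\sigma,T)$ is the angle between the linear subspace parallel to the affine hull of $\sigma$ and that parallel to $T$, where for subspaces $\angle(K,L)=\sup_{u\in K\setminus0}\angle(u,\pi_L(u))$. *)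

(* Defs.v *)
From HB Require Import structures.
From mathcomp Require Import all_boot all_order all_algebra.
From mathcomp Require Import all_classical all_reals all_analysis.
Set Implicit Arguments. Unset Strict Implicit. Unset Printing Implicit Defensive.
Import Order.TTheory GRing.Theory Num.Theory.
Import numFieldNormedType.Exports.
Local Open Scope classical_set_scope.
Local Open Scope ring_scope.

Section Defs.
Variable R : realType.

Definition dotp (k : nat) (u w : 'rV[R]_k) : R := \sum_i u 0 i * w 0 i.
Definition enorm (k : nat) (u : 'rV[R]_k) : R := Num.sqrt (dotp u u).
Definition euc_dist (k : nat) (x y : 'rV[R]_k) : R := enorm (x - y).

Definition cont_on (k l : nat) (A : set 'rV[R]_k) (f : 'rV[R]_k -> 'rV[R]_l) :=
  forall x, A x -> forall e : R, 0 < e -> exists2 d : R, 0 < d &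
    forall y, A y -> euc_dist x y < d -> euc_dist (f x) (f y) < e.

Definition embedding_on (k l : nat) (A : set 'rV[R]_k) (f : 'rV[R]_k -> 'rV[R]_l) :=
  [/\ {in A &, injective f}, cont_on A f &
      forall x, A x -> forall e : R, 0 < e -> exists2 d : R, 0 < d &
        forall y, A y -> euc_dist (f x) (f y) < d -> euc_dist x y < e].

Definition homeo_onto (k l : nat) (A : set 'rV[R]_k) (B : set 'rV[R]_l)
  (f : 'rV[R]_k -> 'rV[R]_l) := embedding_on A f /\ f @` A = B.

(* image of a set (as a named function, to apply it to a point) *)
Definition img (k l : nat) (f : 'rV[R]_k -> 'rV[R]_l) (S : set 'rV[R]_k) : set 'rV[R]_l :=
  f @` S.

Definition rel_interior_pt (k : nat) (T S : set 'rV[R]_k) (p : 'rV[R]_k) :=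
  exists2 r : R, 0 < r & forall y, T y -> euc_dist y p < r -> S y.

Definition closest (k : nat) (S : set 'rV[R]_k) (x y : 'rV[R]_k) :=
  S y /\ forall z, S z -> euc_dist x y <= euc_dist x z.

(* closest-point projection onto S (meaningful where the closest point is unique) *)
Definition cproj (k : nat) (S : set 'rV[R]_k) (x : 'rV[R]_k) : 'rV[R]_k :=
  xget x (closest S x).

Definition distS (k : nat) (S : set 'rV[R]_k) (x : 'rV[R]_k) : R :=
  inf [set euc_dist x y | y in S].

Definition medial_axis (k : nat) (S : set 'rV[R]_k) : set 'rV[R]_k :=
  [set x | exists y z, [/\ y <> z, closest S x y & closest S x z]].

Definition UM (k : nat) (S : set 'rV[R]_k) : set 'rV[R]_k :=
  ~` closure (medial_axis S).

(* local feature size: distance to the medial axis (+oo if it is empty) *)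
Definition lfs (k : nat) (S : set 'rV[R]_k) (y : 'rV[R]_k) : \bar R :=
  ereal_inf [set (euc_dist y z)%:E | z in medial_axis S].

Definition unitv (m : nat) (i : 'I_m) : 'rV[R]_m := delta_mx 0 i.

Definition C2_on (m N : nat) (W : set 'rV[R]_m) (phi : 'rV[R]_m -> 'rV[R]_N) :=
  forall u, W u -> forall i j : 'I_m,
    [/\ derivable phi u (unitv i),
        derivable ('D_(unitv i) phi) u (unitv j),
        {for u, continuous ('D_(unitv i) phi)} &
        {for u, continuous ('D_(unitv j) ('D_(unitv i) phi))}].

Definition C2_submanifold (N m : nat) (M : set 'rV[R]_N) :=
  forall p, M p -> exists (W : set 'rV[R]_m) (U : set 'rV[R]_N)
                         (phi : 'rV[R]_m -> 'rV[R]_N),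
    [/\ open W, open U, U p & C2_on W phi] /\
    [/\ (forall u, W u -> \rank (\matrix_(i < m) 'D_(unitv i) phi u) = m) &
        homeo_onto W (M `&` U) phi].

Definition tangent_vectors (N : nat) (M : set 'rV[R]_N) (p : 'rV[R]_N) : set 'rV[R]_N :=
  [set w | exists (g : R -> 'rV[R]_N) (d : R), [/\ 0 < d,
       (forall s : R, `|s| < d -> M (g s)), g 0 = p,
       derivable g 0 1 & 'D_1 g 0 = w]].

Definition tangent_flat (N : nat) (M : set 'rV[R]_N) (p : 'rV[R]_N) : set 'rV[R]_N :=
  [set p + w | w in tangent_vectors M p].

Definition vangle (k : nat) (u w : 'rV[R]_k) : R :=
  if (u == 0) || (w == 0) then pi / 2
  else acos (dotp u w / (enorm u * enorm w)).

Definition sangle (k : nat) (K L : set 'rV[R]_k) : R :=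
  sup [set vangle u (cproj L u) | u in K `\ 0].

Section Complex.
Variables (n N : nat) (v : 'I_n -> 'rV[R]_N).

Definition simplicial_complex (A : {set {set 'I_n}}) :=
  [/\ (forall s, s \in A -> 0 < #|s|)%N, (forall i, [set i]%SET \in A) &
      forall s t : {set 'I_n}, s \in A -> t \subset s -> (0 < #|t|)%N -> t \in A].

(* barycentric points of the standard realization |A| in R^n *)
Definition supp (l : 'rV[R]_n) : {set 'I_n} := [set i | l 0 i != 0]%SET.
Definition bary (l : 'rV[R]_n) := (forall i, 0 <= l 0 i) /\ \sum_i l 0 i = 1.

Definition realization (A : {set {set 'I_n}}) : set 'rV[R]_n :=
  [set l | bary l /\ supp l \in A].
Definition face_pts (s : {set 'I_n}) : set 'rV[R]_n :=
  [set l | bary l /\ supp l \subset s].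
Definition star_pts (A : {set {set 'I_n}}) (p : 'I_n) : set 'rV[R]_n :=
  [set l | bary l /\ exists2 s, s \in A & (p \in s) && (supp l \subset s)].
Definition star_vertex (A : {set {set 'I_n}}) (p q : 'I_n) :=
  exists2 s, s \in A & (p \in s) && (q \in s).

Definition pl_map (l : 'rV[R]_n) : 'rV[R]_N := \sum_i l 0 i *: v i.

Definition Ledge (s : {set 'I_n}) : R :=
  \big[Num.max/0]_(i in s) \big[Num.max/0]_(j in s) euc_dist (v i) (v j).
Definition aff_hull (s : {set 'I_n}) : set 'rV[R]_N :=
  [set \sum_(k in s) c k *: v k | c in [set c : 'I_n -> R | \sum_(k in s) c k = 1]].
Definition altitude (s : {set 'I_n}) (i : 'I_n) : R :=
  distS (aff_hull (s :\ i)) (v i).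
Definition amin (s : {set 'I_n}) : R := inf [set altitude s i | i in [set i | i \in s]].
Definition thick (s : {set 'I_n}) : R := amin s / ((#|s|.-1)%:R * Ledge s).
Definition dir_space (s : {set 'I_n}) : set 'rV[R]_N :=
  [set \sum_(k in s) c k *: v k | c in [set c : 'I_n -> R | \sum_(k in s) c k = 0]].
End Complex.
End Defs.

(* Main.v *)
Require Import Defs.
From HB Require Import structures.
From mathcomp Require Import all_boot all_order all_algebra.
From mathcomp Require Import all_classical all_reals all_analysis.
From mathcomp Require Import ring lra.
Import Order.TTheory GRing.Theory Num.Theory.
Import numFieldNormedType.Exports.
Local Open Scope classical_set_scope.
Local Open Scope ring_scope.

(** Federer's inequality <n, y - w> <= |n| |y - w|^2 / (2 lfs w), for y in M and n
normal at w, bounds the distance from the vertices of a simplex to the tangent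
flats at its vertices and at the closest points c of its points, and Whitney's
angle bound then makes the simplex almost parallel to both.  So the star of p is,
locally, a Lipschitz graph of small slope over T_p and over the nearby T_y.  Since
x projects to y as soon as x - y is normal at y and |x - y| < lfs y, the map
H := (closest-point projection) o iota is locally injective and open, and hence
surjective.  The set of points with at least two preimages under H is open and
closed; it contains no vertex because of the sanity condition (c) and because H
moves points tangentially by O(eps0^3) only, whereas the star of p has size of
order eps0.  Hence H is injective, and everything else follows by compactness. *)

Set Implicit Arguments. Unset Strict Implicit. Unset Printing Implicit Defensive.

(** * Euclidean geometry of row vectors *)

(** The local feature size may be infinite, so every vertex gets a real radius [rr p] with
    [0 < rr p <= lfs], and all estimates are made with it. An edge at [p] makes the feature size
    finite and positive through the two length bounds; a vertex without edges has zero tangent space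
    by (a), hence is isolated in M, and its distance to the rest of M supplies a radius. Federer's
    inequality comes straight from the definition of the medial axis: a chart yields some small
    tangent ball, which is then inflated. The image of a star is not convex, but its projection to
    T_p is open near points with positive [p]-coordinate. Bounds that hold on single simplices are
    therefore integrated over straight segments of T_p and lifted back. At a vertex the tangential
    displacement is at most [49/18 eps0^3 rr / t0], and it has to stay below
    [9/10 t0 mu0 eps0 rr l_p], where [l_p] is the largest barycentric coordinate. Thickness bounds
    the dimension by [1 / t0], whence [l_p >= t0^2 / 2]; the factor [mu0^(1/2) t0^2] in the
    smallness condition pays for this comparison. *)

Section Euclid.
Variable R : realType.
Implicit Types (k l : nat).

Lemma dotpE k (u w : 'rV[R]_k) : dotp u w = (u *m w^T) 0 0.
Proof. by rewrite /dotp mxE; apply: eq_bigr => i _; rewrite mxE. Qed.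

Lemma dotpC k (u w : 'rV[R]_k) : dotp u w = dotp w u.
Proof. by apply: eq_bigr => i _; rewrite mulrC. Qed.

Lemma dotpDl k (u1 u2 w : 'rV[R]_k) : dotp (u1 + u2) w = dotp u1 w + dotp u2 w.
Proof. by rewrite !dotpE mulmxDl mxE. Qed.

Lemma dotpZl k a (u w : 'rV[R]_k) : dotp (a *: u) w = a * dotp u w.
Proof. by rewrite !dotpE -scalemxAl mxE. Qed.

Lemma dotpNl k (u w : 'rV[R]_k) : dotp (- u) w = - dotp u w.
Proof. by rewrite !dotpE mulNmx mxE. Qed.

Lemma dotp0l k (w : 'rV[R]_k) : dotp 0 w = 0.
Proof. by rewrite dotpE mul0mx mxE. Qed.

Lemma dotpDr k (u1 u2 w : 'rV[R]_k) : dotp w (u1 + u2) = dotp w u1 + dotp w u2.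
Proof. by rewrite dotpC dotpDl !(dotpC w). Qed.

Lemma dotpZr k a (u w : 'rV[R]_k) : dotp u (a *: w) = a * dotp u w.
Proof. by rewrite dotpC dotpZl dotpC. Qed.

Lemma dotpNr k (u w : 'rV[R]_k) : dotp u (- w) = - dotp u w.
Proof. by rewrite dotpC dotpNl dotpC. Qed.

Lemma dotpBr k (u1 u2 w : 'rV[R]_k) : dotp w (u1 - u2) = dotp w u1 - dotp w u2.
Proof. by rewrite dotpDr dotpNr. Qed.

Lemma dotp0r k (w : 'rV[R]_k) : dotp w 0 = 0.
Proof. by rewrite dotpC dotp0l. Qed.

Lemma dotp_sumr k (I : Type) (r : seq I) (Q : pred I) (F : I -> 'rV[R]_k) w :
  dotp w (\sum_(i <- r | Q i) F i) = \sum_(i <- r | Q i) dotp w (F i).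
Proof.
by elim/big_rec2: _ => [|i x y _ <-]; rewrite ?dotp0r // dotpDr.
Qed.

Lemma dotp_mulmx k l (u : 'rV[R]_k) (B : 'M[R]_(k, l)) w :
  dotp (u *m B) w = dotp u (w *m B^T).
Proof. by rewrite !dotpE trmx_mul trmxK mulmxA. Qed.

Lemma dotp_ge0 k (u : 'rV[R]_k) : 0 <= dotp u u.
Proof. by apply: sumr_ge0 => i _; rewrite -expr2 sqr_ge0. Qed.

Lemma enorm_ge0 k (u : 'rV[R]_k) : 0 <= enorm u.
Proof. exact: sqrtr_ge0. Qed.
#[local] Hint Resolve enorm_ge0 : core.

Lemma enorm_sqr k (u : 'rV[R]_k) : enorm u ^+ 2 = dotp u u.
Proof. by rewrite sqr_sqrtr // dotp_ge0. Qed.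

Lemma dotp_eq0 k (u : 'rV[R]_k) : (dotp u u == 0) = (u == 0).
Proof.
apply/eqP/eqP => [h|->]; last by rewrite dotp0l.
apply/rowP => i; rewrite mxE.
have h0 j : true -> 0 <= u 0 j * u 0 j by rewrite -expr2 sqr_ge0.
by apply/eqP; rewrite -sqrf_eq0 expr2 (psumr_eq0P h0 h).
Qed.

Lemma enorm_eq0 k (u : 'rV[R]_k) : (enorm u == 0) = (u == 0).
Proof. by rewrite -sqrf_eq0 enorm_sqr dotp_eq0. Qed.

Lemma enorm0 k : enorm (0 : 'rV[R]_k) = 0.
Proof. by apply/eqP; rewrite enorm_eq0. Qed.

Lemma enorm_gt0 k (u : 'rV[R]_k) : (0 < enorm u) = (u != 0).
Proof. by rewrite lt_def enorm_eq0 enorm_ge0 andbT. Qed.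

Lemma enormZ k a (u : 'rV[R]_k) : enorm (a *: u) = `|a| * enorm u.
Proof.
apply/eqP; rewrite -(@eqrXn2 _ 2) ?mulr_ge0 // exprMn !enorm_sqr dotpZl dotpZr.
by rewrite mulrA -expr2 real_normK ?num_real.
Qed.

Lemma enormN k (u : 'rV[R]_k) : enorm (- u) = enorm u.
Proof. by rewrite -scaleN1r enormZ normrN1 mul1r. Qed.

Lemma enormBC k (u w : 'rV[R]_k) : enorm (u - w) = enorm (w - u).
Proof. by rewrite -opprB enormN. Qed.

Lemma enormD_sqr k (u w : 'rV[R]_k) :
  enorm (u + w) ^+ 2 = enorm u ^+ 2 + 2 * dotp u w + enorm w ^+ 2.
Proof. by rewrite !enorm_sqr dotpDl !dotpDr (dotpC w u); ring. Qed.

Lemma enormB_sqr k (u w : 'rV[R]_k) :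
  enorm (u - w) ^+ 2 = enorm u ^+ 2 - 2 * dotp u w + enorm w ^+ 2.
Proof. by rewrite enormD_sqr enormN dotpNr; ring. Qed.

Lemma ler_dotp k (u w : 'rV[R]_k) : dotp u w <= enorm u * enorm w.
Proof.
have [->|u0] := eqVneq u 0; first by rewrite dotp0l enorm0 mul0r.
have [->|w0] := eqVneq w 0; first by rewrite dotp0r enorm0 mulr0.
have := sqr_ge0 (enorm (enorm w *: u - enorm u *: w)).
rewrite enormB_sqr !enormZ !ger0_norm // dotpZl dotpZr.
move: u0 w0; rewrite -!enorm_gt0 => u0 w0.
move: (enorm u) (enorm w) (dotp u w) u0 w0 => a b d a0 b0 h.
have ab : 0 < a * b by rewrite mulr_gt0.
by rewrite -(ler_pM2l ab); lra.
Qed.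

Lemma ler_norm_dotp k (u w : 'rV[R]_k) : `|dotp u w| <= enorm u * enorm w.
Proof.
rewrite ler_norml ler_dotp andbT lerNl -dotpNl.
by rewrite (le_trans (ler_dotp _ _)) // enormN.
Qed.

Lemma ler_enormD k (u w : 'rV[R]_k) : enorm (u + w) <= enorm u + enorm w.
Proof.
rewrite -(@ler_pXn2r _ 2) ?nnegrE ?addr_ge0 // enormD_sqr.
have := ler_dotp u w; lra.
Qed.

Lemma ler_enormB k (u w : 'rV[R]_k) : enorm (u - w) <= enorm u + enorm w.
Proof. by rewrite -(enormN w) ler_enormD. Qed.

Lemma ler_enorm_tri k (x y z : 'rV[R]_k) :
  enorm (x - z) <= enorm (x - y) + enorm (y - z).
Proof. by rewrite (le_trans _ (ler_enormD _ _)) // addrA subrK. Qed.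

Lemma ler_dist_enorm k (x y : 'rV[R]_k) : `|enorm x - enorm y| <= enorm (x - y).
Proof.
have h (a b : 'rV[R]_k) : enorm a - enorm b <= enorm (a - b).
  by rewrite lerBlDr (le_trans _ (ler_enormD _ _)) // subrK.
by rewrite ler_norml h andbT lerNl opprB enormBC h.
Qed.

Lemma ler_enorm_sum k (I : Type) (r : seq I) (Q : pred I) (F : I -> 'rV[R]_k) :
  enorm (\sum_(i <- r | Q i) F i) <= \sum_(i <- r | Q i) enorm (F i).
Proof.
elim/big_rec2: _ => [|i x y _ h]; first by rewrite enorm0.
by rewrite (le_trans (ler_enormD _ _)) // lerD2l.
Qed.

Lemma ler_norm_enorm k (u : 'rV[R]_k) : `|u| <= enorm u.
Proof.
rewrite [X in X <= _]/Num.norm/= mx_normrE; apply/bigmax_leP; split=> //=.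
move=> [i j] _ /=; rewrite ord1 -(@ler_pXn2r _ 2) ?nnegrE // enorm_sqr.
rewrite real_normK ?num_real // /dotp (bigD1 j) //= expr2 lerDl.
by apply: sumr_ge0 => h _; rewrite -expr2 sqr_ge0.
Qed.

Lemma ler_coord_enorm k (u : 'rV[R]_k) i : `|u 0 i| <= enorm u.
Proof.
rewrite -(@ler_pXn2r _ 2) ?nnegrE // enorm_sqr.
rewrite real_normK ?num_real // /dotp (bigD1 i) //= expr2 lerDl.
by apply: sumr_ge0 => h _; rewrite -expr2 sqr_ge0.
Qed.

Lemma ler_enorm_coords k (u : 'rV[R]_k) : enorm u <= \sum_i `|u 0 i|.
Proof.
rewrite {1}(row_sum_delta u) (le_trans (ler_enorm_sum _ _ _)) //.
apply: ler_sum => i _; rewrite enormZ ler_piMr //.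
rewrite -(@ler_pXn2r _ 2) ?nnegrE // enorm_sqr /dotp (bigD1 i) //= big1.
  by rewrite !mxE !eqxx mulr1 addr0 expr1n.
by move=> j ji; rewrite !mxE (negbTE ji) andbF mulr0.
Qed.

Lemma ler_enorm_norm k (u : 'rV[R]_k) : enorm u <= k%:R * `|u|.
Proof.
rewrite (le_trans (ler_enorm_coords u)) //.
have -> : k%:R * `|u| = \sum_(i < k) `|u|.
  by rewrite sumr_const card_ord mulr_natl.
apply: ler_sum => i _; rewrite [X in _ <= X]/Num.norm/= mx_normrE.
by apply: (le_bigmax _ (fun ij => `|u ij.1 ij.2|) (0, i)).
Qed.

(** The topology on matrices is that of the sup norm, so neighbourhoods are rewritten with Euclidean
    balls. The [+ 1] in the proof keeps the divisor positive in dimension 0. *)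
Lemma nbhs_enormP k (x : 'rV[R]_k) (B : set 'rV[R]_k) :
  nbhs x B <-> exists2 d : R, 0 < d & forall y, enorm (x - y) < d -> B y.
Proof.
split=> [/nbhs_normP[d /= d0 h]|[d d0 h]].
  exists d => // y xy; apply: h => /=.
  exact: le_lt_trans (ler_norm_enorm _) xy.
apply/(@nbhs_normP R 'rV[R]_k); exists (d / (k%:R + 1)) => /=.
  by rewrite divr_gt0 // ltr_wpDl.
move=> y /= xy; apply: h; rewrite (le_lt_trans (ler_enorm_norm _)) //.
have k1 : 0 < k%:R + 1 :> R by rewrite ltr_wpDl.
move: xy; rewrite ltr_pdivlMr // => xy; apply: le_lt_trans xy.
by rewrite mulrC ler_wpM2l // lerDl.
Qed.

Lemma enorm_le_mulmx k l (B : 'M[R]_(k, l)) :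
  exists2 C : R, 0 < C & forall x : 'rV[R]_k, enorm (x *m B) <= C * enorm x.
Proof.
exists (1 + \sum_i enorm (row i B)).
  by rewrite ltr_wpDr // sumr_ge0.
move=> x; rewrite mulmx_sum_row (le_trans (ler_enorm_sum _ _ _)) //.
rewrite mulrDl mul1r mulr_suml -[X in X <= _]add0r lerD //.
by apply: ler_sum => i _; rewrite enormZ mulrC ler_wpM2l // ler_coord_enorm.
Qed.

Definition rcont_on k (D : set 'rV[R]_k) (h : 'rV[R]_k -> R) :=
  forall x, D x -> forall e : R, 0 < e -> exists2 d : R, 0 < d &
    forall y, D y -> euc_dist x y < d -> `|h x - h y| < e.

Lemma compact_argmin k (K : set 'rV[R]_k) h :
  K !=set0 -> compact K -> rcont_on K h ->
  exists2 c, K c & forall t, K t -> h c <= h t.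
Proof.
move=> K0 cK ch.
have [|c Kc hc] := EVT_min_rV (f := h) K0 cK.
  apply/subspace_continuousP => x Kx; apply/cvgrPdist_lt => e e0.
  have [d d0 hd] := ch x Kx e e0.
  rewrite /prop_near1 /within /=; apply/nbhs_enormP; exists d => // y xy Ky.
  exact: hd.
exists c; first by rewrite inE in Kc.
by move=> t Kt; apply: hc; rewrite inE.
Qed.

(** Both hypotheses are relative to [C] and stated with radii; [gen] turns each into the trace on
    [C] of a union of balls, the form in which connectedness is defined. *)
Lemma connected_clopen k (C : set 'rV[R]_k) (Q : set 'rV[R]_k) x y :
  connected C ->
  (forall z, C z -> Q z -> exists2 d : R, 0 < d &
     forall z', C z' -> euc_dist z z' < d -> Q z') ->
  (forall z, C z -> ~ Q z -> exists2 d : R, 0 < d &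
     forall z', C z' -> euc_dist z z' < d -> ~ Q z') ->
  C x -> C y -> Q x -> Q y.
Proof.
move=> cC op cl Cx Cy Qx.
have gen (P : set 'rV[R]_k) : (forall z, C z -> P z -> exists2 d : R, 0 < d &
     forall z', C z' -> euc_dist z z' < d -> P z') ->
     exists2 V, open V & C `&` P = C `&` V.
  move=> hP; pose V := [set z | exists2 w, C w /\ P w & exists2 d : R, 0 < d &
    (forall z', C z' -> euc_dist w z' < d -> P z') /\ euc_dist w z < d].
  exists V.
    rewrite openE => z [w [Cw Pw] [d d0 [hd wz]]].
    apply/nbhs_enormP; exists (d - euc_dist w z); first by rewrite subr_gt0.
    move=> y' zy; exists w => //; exists d => //; split=> //.
    rewrite (le_lt_trans (ler_enorm_tri _ z _)) //.
    by move: zy; rewrite ltrBrDl.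
  apply/seteqP; split=> z [Cz hz]; split=> //.
    have [d d0 hd] := hP z Cz hz; exists z => //; exists d => //; split=> //.
    by rewrite /euc_dist subrr enorm0.
  by case: hz => w [Cw Pw] [d d0 [hd wz]]; exact: hd.
have : C `&` Q = C.
  apply: cC; first by exists x.
    by have [V oV h] := gen Q op; exists V.
  have [V oV h] := gen (~` Q) cl; exists (~` V); first by rewrite closedC.
  apply/seteqP; split=> z [Cz hz]; split=> //.
    move=> Vz; have : (C `&` V) z by [].
    by rewrite -h => -[].
  apply: contrapT => nQ; apply: hz.
  by have : (C `&` ~` Q) z by []; rewrite h => -[].
by move=> h; have : C y by []; rewrite -h => -[].
Qed.

(** Continuous induction on the unit interval. [E] need not be an initial segment: the supremum of
    its part in the interval lies in [E] by the left-limit clause, and the other clause would exceed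
    it if it were below 1. *)
Lemma real_induction (E : set R) : E 0 ->
  (forall s, E s -> 0 <= s < 1 ->
     exists2 d : R, 0 < d & forall s', s < s' < s + d -> s' <= 1 -> E s') ->
  (forall s, 0 < s <= 1 ->
     (forall d, 0 < d -> exists2 s', s - d < s' < s & 0 <= s' /\ E s') -> E s) ->
  E 1.
Proof.
move=> E0 op cl; pose F := [set s | 0 <= s <= 1 /\ E s].
have F0 : F 0 by rewrite /F/= lexx ler01.
have hF : has_sup F by split; [exists 0|exists 1 => s [/andP[]]].
have s0 : 0 <= sup F by apply: ub_le_sup => //; case: hF.
have s1 : sup F <= 1 by apply: ge_sup; [exists 0|move=> s [/andP[]]].
have Es : E (sup F).
  have [->//|sn0] := eqVneq (sup F) 0.
  apply: contrapT => nE; apply: (nE); apply: cl.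
    by rewrite lt_def sn0 s0.
  move=> d d0; have [s' Fs' hs'] := sup_adherent d0 hF.
  exists s'; last by case: Fs' => /andP[].
  rewrite hs' lt_neqAle ub_le_sup ?andbT //; last by case: hF.
  by apply/negP => /eqP e; apply: nE; rewrite -e; case: Fs'.
have [e|sn1] := eqVneq (sup F) 1; first by rewrite -e.
have lt1 : sup F < 1 by rewrite lt_neqAle sn1.
have [|d d0 hd] := op _ Es; first by rewrite s0.
pose s' := Num.min (sup F + d / 2) 1.
have ss' : sup F < s' by rewrite /s' lt_min lt1 andbT ltrDl divr_gt0.
have Fs' : F s'.
  have s'1 : s' <= 1 by rewrite /s' ge_min lexx orbT.
  split; first by rewrite (le_trans s0 (ltW ss')).
  apply: hd => //; rewrite ss' /=.
  by rewrite (@le_lt_trans _ _ (sup F + d / 2)) ?ge_min ?lexx // ltrD2l ltr_pdivrMr // ltr_pMr // ltr1n.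
have : s' <= sup F by apply: ub_le_sup => //; case: hF.
by rewrite leNgt ss'.
Qed.

(** The radius [d] varies with [s] without a uniform lower bound, so the estimate is propagated by
    continuous induction instead of a subdivision. *)
Lemma local_lipschitz_segment k (h : R -> 'rV[R]_k) (kappa : R) :
  0 <= kappa ->
  (forall s, 0 <= s <= 1 -> exists2 d : R, 0 < d & forall s', 0 <= s' <= 1 ->
     `|s - s'| < d -> enorm (h s - h s') <= kappa * `|s - s'|) ->
  enorm (h 1 - h 0) <= kappa.
Proof.
move=> k0 hh; rewrite -[kappa]mulr1.
apply: (real_induction (E := [set s | enorm (h s - h 0) <= kappa * s])).
- by rewrite /= subrr enorm0 mulr0.
- move=> s /= Es /andP[s0 s1]; have [|d d0 hd] := hh s; first by rewrite s0 ltW.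
  exists d => // s' /andP[ss' s'd] s'1.
  have := hd s' _ _; rewrite s'1 (le_trans s0 (ltW ss')) => /(_ isT).
  rewrite distrC gtr0_norm ?subr_gt0 // ltrBlDl => /(_ s'd) hb.
  by rewrite (le_trans (ler_enorm_tri _ (h s) _)) // enormBC; lra.
- move=> s /= /andP[s0 s1] cl; have [|d d0 hd] := hh s; first by rewrite ltW.
  have [s' /andP[ds' s's] [s'0 Es']] := cl d d0.
  have := hd s' _ _; rewrite s'0 (le_trans (ltW s's) s1) => /(_ isT).
  rewrite gtr0_norm ?subr_gt0 // ltrBlDl -ltrBlDr => /(_ ds') hb.
  by rewrite (le_trans (ler_enorm_tri _ (h s') _)) //; lra.
Qed.

End Euclid.

(** * Compactness, closest points and orthogonal projectors *)

Section Proj.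
Variable R : realType.
Implicit Types (k l N : nat).

Lemma euc_distxx k (x : 'rV[R]_k) : euc_dist x x = 0.
Proof. by rewrite /euc_dist subrr enorm0. Qed.

Lemma euc_distC k (x y : 'rV[R]_k) : euc_dist x y = euc_dist y x.
Proof. exact: enormBC. Qed.

Lemma euc_dist_eq0 k (x y : 'rV[R]_k) : (euc_dist x y == 0) = (x == y).
Proof. by rewrite enorm_eq0 subr_eq0. Qed.

Lemma cont_on_sub k l (A B : set 'rV[R]_k) (f : 'rV[R]_k -> 'rV[R]_l) :
  A `<=` B -> cont_on B f -> cont_on A f.
Proof.
move=> AB cf x Ax e e0; have [d d0 h] := cf x (AB _ Ax) e e0.
by exists d => // y /AB; exact: h.
Qed.

Lemma cont_on_rcont k l (A : set 'rV[R]_k) (f : 'rV[R]_k -> 'rV[R]_l) y :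
  cont_on A f -> rcont_on A (fun x => euc_dist (f x) y).
Proof.
move=> cf x Ax e e0; have [d d0 h] := cf x Ax e e0; exists d => // z Az xz.
rewrite (le_lt_trans (ler_dist_enorm _ _)) //.
by rewrite opprB addrA subrK; exact: h.
Qed.

Lemma rcont_dist k (A : set 'rV[R]_k) y : rcont_on A (fun x => euc_dist x y).
Proof.
move=> x Ax e e0; exists e => // z Az xz.
rewrite (le_lt_trans (ler_dist_enorm _ _)) //.
by rewrite opprB addrA subrK.
Qed.

Lemma compact_sublevel k (K : set 'rV[R]_k) h (r : R) :
  compact K -> rcont_on K h -> compact (K `&` [set z | h z <= r]).
Proof.
move=> cK ch; apply: (subclosed_compact _ cK) => [|z []//].
have clK : closed K by apply: compact_closed => //; exact: norm_hausdorff.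
rewrite -[X in closed X]setCK; apply: open_closedC; rewrite openE => z hz.
have [Kz|nKz] := pselect (K z); last first.
  have : nbhs z (~` K) by apply: open_nbhs_nbhs; split=> //; exact: closed_openC.
  by apply: filterS => y nKy [].
have rz : 0 < h z - r.
  by rewrite subr_gt0 ltNge; apply/negP => le; apply: hz.
have [d d0 hd] := ch z Kz _ rz; apply/nbhs_enormP; exists d => // y zy [Ky /= hy].
have := le_lt_trans (ler_norm _) (hd y Ky zy).
by rewrite ltrD2l ltrN2 ltNge hy.
Qed.

(** By compactness the distance from [y] to the values taken far from [x] has a positive minimum.
    Besides continuity of inverses, this yields closedness of the set of double points of the
    projection. *)
Lemma compact_far_gap k l (K : set 'rV[R]_k) (f : 'rV[R]_k -> 'rV[R]_l) x y
    (e : R) :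
  compact K -> cont_on K f ->
  (forall z, K z -> e <= euc_dist x z -> f z <> y) ->
  exists2 d : R, 0 < d & forall z, K z -> euc_dist y (f z) < d -> euc_dist x z < e.
Proof.
move=> cK cf inj; pose F := K `&` [set z | e <= euc_dist x z].
have [[z0 Fz0]|F0] := pselect (F !=set0); last first.
  exists 1 => // z Kz _; rewrite ltNge; apply/negP => ez; apply: F0; exists z.
  by split.
have cF : compact F.
  apply: compact_closedI => //.
  rewrite -[X in closed X]setCK; apply: open_closedC; rewrite openE => z /= /negP.
  rewrite -ltNge => ze; apply/nbhs_enormP; exists (e - euc_dist x z).
    by rewrite subr_gt0.
  move=> w zw /=; apply/negP; rewrite -ltNge.
  by rewrite (le_lt_trans (ler_enorm_tri _ z _)) // -ltrBrDl.
have [||c [Kc ec] hc] := compact_argmin (h := fun z => euc_dist (f z) y) _ cF.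
- by exists z0.
- by apply: cont_on_rcont; apply: cont_on_sub cf => z [].
exists (euc_dist (f c) y).
  by rewrite lt_def euc_dist_eq0 enorm_ge0 andbT; apply/eqP; exact: inj.
move=> z Kz yz; rewrite ltNge; apply/negP => ez.
by have := hc z (conj Kz ez); rewrite leNgt euc_distC yz.
Qed.

Lemma compact_embedding k l (K : set 'rV[R]_k) (f : 'rV[R]_k -> 'rV[R]_l) :
  compact K -> cont_on K f -> (forall x y, K x -> K y -> f x = f y -> x = y) ->
  embedding_on K f.
Proof.
move=> cK cf inj; split=> //.
  by move=> x y; rewrite !inE; exact: inj.
move=> x Kx e e0.
have [|d d0 h] := @compact_far_gap _ _ K f x (f x) e cK cf.
  move=> z Kz ez fzx; move: ez; rewrite (inj z x Kz Kx fzx) euc_distxx.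
  by rewrite leNgt e0.
by exists d.
Qed.

Lemma compact_closest k (M : set 'rV[R]_k) x :
  compact M -> M !=set0 -> exists y, closest M x y.
Proof.
move=> cM M0.
have [c Mc hc] := compact_argmin M0 cM (@rcont_dist _ M x).
by exists c; split=> // z Mz; rewrite !(euc_distC x); exact: hc.
Qed.

(** Uniqueness at [z] leaves a positive gap between [q] and the points of [M] far from [q]; moving
    [z] by less than half of it cannot reverse the comparison, since the triangle inequality is used
    twice. *)
Lemma closest_continuity k (M : set 'rV[R]_k) z q (e : R) :
  compact M -> closest M z q -> (forall q', closest M z q' -> q' = q) -> 0 < e ->
  exists2 d : R, 0 < d & forall z' q', euc_dist z z' < d -> closest M z' q' ->
    euc_dist q q' < e.
Proof.
move=> cM [Mq hq] uq e0; pose F := M `&` [set w | e <= euc_dist q w].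
have [[z0 Fz0]|F0] := pselect (F !=set0); last first.
  exists 1 => // z' q' _ [Mq' _]; rewrite ltNge; apply/negP => h.
  by apply: F0; exists q'.
have cF : compact F.
  apply: compact_closedI => //.
  rewrite -[X in closed X]setCK; apply: open_closedC; rewrite openE => w /= /negP.
  rewrite -ltNge => ze; apply/nbhs_enormP; exists (e - euc_dist q w).
    by rewrite subr_gt0.
  move=> w' zw /=; apply/negP; rewrite -ltNge.
  by rewrite (le_lt_trans (ler_enorm_tri _ w _)) // -ltrBrDl.
have [|c [Mc ec] hc] := compact_argmin _ cF (@rcont_dist _ F z).
  by exists z0.
have lt : euc_dist z q < euc_dist z c.
  rewrite lt_neqAle hq // andbT; apply/negP => /eqP eqd.
  have : c = q by apply: uq; split=> // w Mw; rewrite -eqd; exact: hq.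
  by move=> cq; move: ec; rewrite /= cq euc_distxx leNgt e0.
exists ((euc_dist z c - euc_dist z q) / 2); first by rewrite divr_gt0 ?subr_gt0.
move=> z' q' zz' [Mq' hq']; rewrite ltNge; apply/negP => eq'.
have := hc q' (conj Mq' eq'); rewrite !(euc_distC _ z) leNgt => /negP; apply.
have h1 : euc_dist z q' <= euc_dist z z' + euc_dist z' q' by exact: ler_enorm_tri.
have h2 := hq' q Mq.
have h3 : euc_dist z' q <= euc_dist z' z + euc_dist z q by exact: ler_enorm_tri.
move: zz' h1 h2 h3; rewrite (euc_distC z' z); lra.
Qed.

(** Subspaces are encoded by their orthogonal projectors acting on rows from the right: [u *m P = u]
    means that [u] lies in the subspace, [u *m P = 0] that it is normal to it. *)
Definition orth_proj N (P : 'M[R]_N) := P^T = P /\ P *m P = P.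

Section OneProj.
Variables (N : nat) (P : 'M[R]_N).
Hypothesis oP : orth_proj P.
Implicit Types u w : 'rV[R]_N.

Lemma proj_idem u : u *m P *m P = u *m P.
Proof. by rewrite -mulmxA oP.2. Qed.

Lemma proj_adj u w : dotp (u *m P) w = dotp u (w *m P).
Proof. by rewrite dotp_mulmx oP.1. Qed.

Lemma proj_orth u w : dotp (u *m P) (w - w *m P) = 0.
Proof. by rewrite proj_adj mulmxBl proj_idem subrr dotp0r. Qed.

Lemma proj_pyth u : enorm u ^+ 2 = enorm (u *m P) ^+ 2 + enorm (u - u *m P) ^+ 2.
Proof.
have := enormD_sqr (u *m P) (u - u *m P).
by rewrite proj_orth mulr0 addr0 addrC subrK.
Qed.

Lemma ler_enorm_proj u : enorm (u *m P) <= enorm u.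
Proof.
by rewrite -(@ler_pXn2r _ 2) ?nnegrE ?enorm_ge0 // (proj_pyth u) lerDl sqr_ge0.
Qed.

Lemma ler_enorm_coproj u : enorm (u - u *m P) <= enorm u.
Proof.
by rewrite -(@ler_pXn2r _ 2) ?nnegrE ?enorm_ge0 // (proj_pyth u) lerDr sqr_ge0.
Qed.

Lemma coproj_orth u w : w *m P = 0 -> dotp w (u *m P) = 0.
Proof. by move=> w0; rewrite -proj_adj w0 dotp0l. Qed.

Lemma closest_flat p x y :
  closest [set p + w | w in [set w | w *m P = w]] x y <-> y = p + (x - p) *m P.
Proof.
have key w : w *m P = w -> euc_dist x (p + w) ^+ 2 =
    enorm ((x - p) - (x - p) *m P) ^+ 2 + enorm ((x - p) *m P - w) ^+ 2.
  move=> wP; rewrite /euc_dist (proj_pyth (x - (p + w))) [LHS]addrC.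
  by congr (_ + _); congr (_ ^+ 2); congr enorm; rewrite ?mulmxBl ?mulmxDl ?wP;
    apply/rowP => i; rewrite !mxE; ring.
split.
  case=> -[w /= wP <-] h; congr (_ + _).
  have /h : [set p + w | w in [set w | w *m P = w]] (p + (x - p) *m P).
    by exists ((x - p) *m P) => //=; rewrite proj_idem.
  rewrite -(@ler_pXn2r _ 2) ?nnegrE ?enorm_ge0 // !key ?proj_idem // lerD2l.
  rewrite subrr enorm0 expr0n /= => h'; apply/eqP; rewrite eq_sym.
  by rewrite -subr_eq0 -enorm_eq0 -sqrf_eq0 eq_le h' sqr_ge0.
move=> ->; split; first by exists ((x - p) *m P) => //=; rewrite proj_idem.
move=> z [w /= wP <-]; rewrite -(@ler_pXn2r _ 2) ?nnegrE ?enorm_ge0 //.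
by rewrite !key ?proj_idem // subrr enorm0 expr0n /= addr0 lerDl sqr_ge0.
Qed.

Lemma cproj_flat p x :
  cproj [set p + w | w in [set w | w *m P = w]] x = p + (x - p) *m P.
Proof.
rewrite /cproj; case: xgetP => [y _ /closest_flat //|h].
by have := h (p + (x - p) *m P); rewrite closest_flat => /(_ erefl).
Qed.

Lemma cproj_linear x : cproj [set w | w *m P = w] x = x *m P.
Proof.
have := cproj_flat 0 x; rewrite subr0 add0r => <-; congr (cproj _ x).
apply/seteqP; split=> [w /= wP|w [z /= zP <-]]; last by rewrite /= add0r.
by exists w => //=; rewrite add0r.
Qed.

End OneProj.

(** Rank count: the range of [P] misses the kernel of [Q], so [P *m Q] keeps the rank and has the
    range of [Q]. It serves for two tangent spaces at a small angle. *)
Lemma proj_onto N (P Q : 'M[R]_N) :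
  orth_proj Q -> \rank P = \rank Q -> P *m P = P ->
  (forall t : 'rV_N, t *m P = t -> t *m Q = 0 -> t = 0) ->
  forall e : 'rV_N, e *m Q = e -> exists2 t : 'rV_N, t *m P = t & t *m Q = e.
Proof.
move=> oQ rk PP inj e eQ.
have cap0 : (P :&: kermx Q)%MS = 0.
  apply/eqP; rewrite -submx0; apply/row_subP => i.
  set r := row i _.
  have : (r <= P :&: kermx Q)%MS by exact: row_sub.
  rewrite sub_capmx => /andP[/submxP[a ra] /sub_kermxP rQ].
  by rewrite (inj r) ?sub0mx //  ra -mulmxA PP.
have rkPQ : \rank (P *m Q) = \rank Q.
  by have := mxrank_mul_ker P Q; rewrite cap0 mxrank0 addn0 rk.
have sub : (Q <= P *m Q)%MS.
  by rewrite -(geq_leqif (mxrank_leqif_sup (submxMl P Q))) rkPQ.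
have : (e <= P *m Q)%MS by rewrite -eQ (submx_trans _ sub) // submxMl.
case/submxP => a ea; exists (a *m P); first by rewrite -mulmxA PP.
by rewrite -mulmxA.
Qed.

(** Full rank makes the Gram matrix [J *m J^T] invertible, and [J^T (J J^T)^-1 J] is the projector
    onto the row space. The rows will be the partials of a chart. *)
Lemma exists_row_proj m N (J : 'M[R]_(m, N)) : \rank J = m ->
  exists P : 'M[R]_N, [/\ orth_proj P, \rank P = m,
    forall u : 'rV_N, u *m P = u <-> exists a : 'rV_m, u = a *m J &
    forall u : 'rV_N, u *m P = 0 <-> u *m J^T = 0].
Proof.
move=> rJ; have fJ : row_free J by rewrite /row_free rJ.
have uG : J *m J^T \in unitmx.
  rewrite -row_free_unit -kermx_eq0 -submx0; apply/row_subP => i.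
  set r := row i _; have : (r <= kermx (J *m J^T))%MS by exact: row_sub.
  move/sub_kermxP => h.
  have : dotp (r *m J) (r *m J) = 0.
    by rewrite dotp_mulmx -mulmxA h dotp0r.
  move/eqP; rewrite dotp_eq0 => /eqP rJ0.
  suff -> : r = 0 by rewrite sub0mx.
  by apply: (row_free_inj fJ); rewrite rJ0 mul0mx.
pose G := invmx (J *m J^T); pose P := J^T *m G *m J.
have GT : G^T = G by rewrite /G trmx_inv trmx_mul trmxK.
have JP : J *m P = J by rewrite /P !mulmxA mulmxV // mul1mx.
exists P; split.
- split; first by rewrite /P !trmx_mul trmxK GT mulmxA.
  by rewrite {1}/P -mulmxA JP.
- apply/eqP; rewrite eqn_leq; apply/andP; split.
    by rewrite /P (leq_trans (mxrankM_maxr _ _)) // rJ.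
  by rewrite -[X in (X <= _)%N]rJ -{1}JP mxrankM_maxr.
- move=> u; split=> [<-|[a ->]]; last by rewrite -mulmxA JP.
  by exists (u *m (J^T *m G)); rewrite /P !mulmxA.
- move=> u; split=> [h|h]; last by rewrite /P !mulmxA h !mul0mx.
  have : u *m P *m J^T = 0 by rewrite h mul0mx.
  rewrite /P -!mulmxA.
  by rewrite mulVmx // mulmx1.
Qed.

End Proj.

(** * Charts and tangent spaces *)

Section Calculus.
Variable R : realType.
Implicit Types (k l m N : nat).

Lemma derive_curveP k (g : R -> 'rV[R]_k) (w : 'rV[R]_k) :
  (derivable g 0 1 /\ 'D_1 g 0 = w) <->
  (forall e : R, 0 < e -> exists2 d : R, 0 < d &
     forall s, `|s| < d -> enorm (g s - g 0 - s *: w) <= e * `|s|).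
Proof.
have key : ((fun h : R => h^-1 *: ((g \o shift 0) (h *: (1 : R)) - g 0)) @ 0^' --> w) <->
  (forall e : R, 0 < e -> exists2 d : R, 0 < d &
     forall s, `|s| < d -> enorm (g s - g 0 - s *: w) <= e * `|s|).
  split.
    move=> /cvgrPdist_lt h e e0.
    have k1 : 0 < k%:R + 1 :> R by rewrite ltr_wpDl.
    have := h (e / (k%:R + 1)) (divr_gt0 e0 k1).
    rewrite /prop_near1 /dnbhs /within /= => /nbhs_normP[d /= d0 hd].
    exists d => // s sd; have [->|s0] := eqVneq s 0.
      by rewrite scale0r subrr subr0 enorm0 normr0 mulr0.
    have := hd s; rewrite /= sub0r normrN => /(_ sd s0).
    rewrite addr0 [s *: _]mulr1 => hh.
    have -> : g s - g 0 - s *: w = (- s) *: (w - s^-1 *: (g s - g 0)).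
      by rewrite scalerBr !scaleNr scalerKV // opprK addrC.
    rewrite enormZ normrN mulrC ler_wpM2r //.
    rewrite (le_trans (ler_enorm_norm _)) //.
    move: hh; rewrite ltr_pdivlMr // => hh; apply: le_trans (ltW hh).
    by rewrite mulrC ler_wpM2l // lerDl.
  move=> h; apply/cvgrPdist_lt => e e0.
  have [d d0 hd] := h (e / 2) (divr_gt0 e0 (ltr0n _ 2)).
  rewrite /prop_near1 /dnbhs /within /=; apply/nbhs_normP; exists d => // s /=.
  rewrite sub0r normrN => sd s0.
  rewrite addr0 [s *: _]mulr1.
  have -> : w - s^-1 *: (g s - g 0) = (- s^-1) *: (g s - g 0 - s *: w).
    by rewrite [RHS]scalerBr !scaleNr scalerA mulVf // scale1r opprK addrC.
  rewrite (le_lt_trans (ler_norm_enorm _)) // enormZ normrN normfV.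
  rewrite ltr_pdivrMl ?normr_gt0 //.
  rewrite (le_lt_trans (hd s sd)) // mulrC ltr_pM2l ?normr_gt0 //.
  by rewrite ltr_pdivrMr // ltr_pMr // ltr1n.
split.
  by case=> dg dw; apply/key; rewrite -dw; exact: dg.
move=> /key h; split; first by apply/cvg_ex; exists w.
by rewrite /derive; apply/cvg_lim.
Qed.

Lemma mvt_dev (g dg : R -> R) (a b c C : R) :
  (forall x, `|x - a| <= `|b - a| -> is_derive x (1 : R) g (dg x) /\ `|dg x - c| <= C) ->
  `|g b - g a - c * (b - a)| <= C * `|b - a|.
Proof.
have main (x y : R) : x <= y ->
    (forall z, x <= z <= y -> is_derive z (1 : R) g (dg z) /\ `|dg z - c| <= C) ->
    `|g y - g x - c * (y - x)| <= C * `|y - x|.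
  move=> xy h; have [||z zxy ->] := @MVT_segment R g dg x y xy.
  - by move=> z /itvP zi; apply: (h z _).1; rewrite !zi.
  - apply: derivable_within_continuous => z /itvP zi.
    by have [|hd _] := h z; [rewrite !zi|exact: ex_derive].
  rewrite -mulrBl normrM ler_wpM2r //; apply: (h z _).2.
  by rewrite !(itvP zxy).
move=> h; have [ab|/ltW ba] := leP a b.
  apply: main => // z /andP[az zb]; apply: h.
  by rewrite !ger0_norm ?subr_ge0 // lerD2r.
have -> : g b - g a - c * (b - a) = - (g a - g b - c * (a - b)) by ring.
rewrite normrN [`|b - a|]distrC; apply: main => // z /andP[bz za]; apply: h.
by rewrite !ler0_norm ?subr_le0 // lerN2 lerD2r.
Qed.

Lemma is_derive_line k (h : 'rV[R]_k -> R) (p e : 'rV[R]_k) s :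
  derivable h (p + s *: e) e ->
  is_derive s (1 : R) (fun t : R => h (p + t *: e)) ('D_e h (p + s *: e)).
Proof.
move=> dh; have eqf : (fun t : R => t^-1 *: (((fun t => h (p + t *: e)) \o shift s) (t *: (1 : R)) - h (p + s *: e)))
    = (fun t : R => t^-1 *: ((h \o shift (p + s *: e)) (t *: e) - h (p + s *: e))).
  apply/funext => t /=; congr (_ *: (h _ - _)).
  by rewrite [t *: _]mulr1 scalerDl addrCA.
by apply: DeriveDef; rewrite /derivable /derive /= eqf.
Qed.

(* Moves from [u0] to [u] one coordinate at a time and applies the mean value
   theorem to each leg. *)
Lemma partials_dev m (h : 'rV[R]_m -> R) (u0 u : 'rV[R]_m) (c : 'I_m -> R) C :
  (forall w : 'rV[R]_m, (forall j, `|w 0 j - u0 0 j| <= `|u 0 j - u0 0 j|) ->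
     forall i, derivable h w (unitv R i) /\ `|'D_(unitv R i) h w - c i| <= C) ->
  `|h u - h u0 - \sum_i c i * (u 0 i - u0 0 i)| <= C * \sum_i `|u 0 i - u0 0 i|.
Proof.
move=> H.
pose p n := \row_(i < m) (if (i < n)%N then u 0 i else u0 0 i) : 'rV[R]_m.
have p0 : p 0%N = u0 by apply/rowP => i; rewrite mxE.
have pm : p m = u by apply/rowP => i; rewrite mxE ltn_ord.
have step n (nm : (n <= m)%N) :
  `|h (p n) - h u0 - \sum_(i < m | (i < n)%N) c i * (u 0 i - u0 0 i)| <=
  C * \sum_(i < m | (i < n)%N) `|u 0 i - u0 0 i|.
  elim: n nm => [|n IH] nm.
    by rewrite p0 subrr !big_pred0 // subr0 normr0 mulr0.
  pose i0 := Ordinal nm.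
  have split (F : 'I_m -> R) : \sum_(i < m | (i < n.+1)%N) F i =
      F i0 + \sum_(i < m | (i < n)%N) F i.
    rewrite (bigD1 i0) //=; congr (_ + _); apply: eq_bigl => i.
    rewrite ltnS leq_eqVlt -val_eqE /=; case: eqP => /= [->|]; last by rewrite andbT.
    by rewrite ltnn.
  rewrite !split.
  have pS t : p n + t *: unitv R i0 = \row_i (if i == i0 then u0 0 i + t else p n 0 i).
    apply/rowP => i; rewrite !mxE eqxx /=; case: eqP => [->|_].
      by rewrite ltnn mulr1.
    by rewrite mulr0 addr0.
  have pS1 : p n.+1 = p n + (u 0 i0 - u0 0 i0) *: unitv R i0.
    rewrite pS; apply/rowP => i; rewrite !mxE; case: eqP => [->|ne].
      by rewrite /= ltnSn addrC subrK.
    rewrite ltnS leq_eqVlt; case: eqP => //= e; case: ne; exact: val_inj.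
  have pS0 : p n = p n + 0 *: unitv R i0 by rewrite scale0r addr0.
  have := @mvt_dev (fun t => h (p n + t *: unitv R i0))
    (fun t => 'D_(unitv R i0) h (p n + t *: unitv R i0)) 0 (u 0 i0 - u0 0 i0) (c i0) C.
  rewrite -pS1 -pS0 subr0 => D.
  have {}D := D _; have D' : `|h (p n.+1) - h (p n) - c i0 * (u 0 i0 - u0 0 i0)| <=
      C * `|u 0 i0 - u0 0 i0|.
    apply: D => x; rewrite subr0 => xle.
    have [|dh hC] := H (p n + x *: unitv R i0) _ i0; last first.
      split; [exact: (@is_derive_line _ h (p n) (unitv R i0) x dh) | exact: hC].
    move=> j; rewrite pS !mxE; case: eqP => [->|_].
      by rewrite addrC addKr.
    by case: ifP => // _; rewrite subrr normr0.
  have := IH (ltnW nm).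
  set S := \sum_(i < m | _) _; set S' := \sum_(i < m | _) `|_| => IHn.
  have e4 (x y z a b : R) : x - z - (a + b) = (x - y - a) + (y - z - b) by ring.
  rewrite (e4 _ (h (p n))).
  by rewrite (le_trans (ler_normD _ _)) // [X in _ <= X]mulrDr lerD.
have := step m (leqnn m); rewrite pm.
by under eq_bigl do rewrite ltn_ord; under [in X in _ <= X -> _]eq_bigl do rewrite ltn_ord.
Qed.

End Calculus.

(** * One chart: Taylor bound, tangent and normal vectors *)

Section Chart.
Variable R : realType.

Lemma ler_enorm_coordwise k (a b : 'rV[R]_k) :
  (forall j, `|a 0 j| <= `|b 0 j|) -> enorm a <= enorm b.
Proof.
move=> h; rewrite -(@ler_pXn2r _ 2) ?nnegrE ?enorm_ge0 // !enorm_sqr.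
apply: ler_sum => i _; rewrite -!expr2 -[leLHS]real_normK ?num_real //.
by rewrite -[leRHS]real_normK ?num_real // lerXn2r ?nnegrE.
Qed.

Lemma ler_enorm_addB k (a b : 'rV[R]_k) : enorm a <= enorm b + enorm (b - a).
Proof.
by rewrite enormBC -lerBlDl (le_trans (ler_norm _)) // ler_dist_enorm.
Qed.

Lemma fin2_bound k l (x : 'I_k -> 'I_l -> R) :
  exists2 B : R, 0 < B & forall i j, x i j <= B.
Proof.
exists (1 + \sum_i \sum_j `|x i j|).
  by rewrite ltr_wpDr //; apply: sumr_ge0 => i _; apply: sumr_ge0.
move=> i j; rewrite (bigD1 i) //= (bigD1 j) //= (le_trans (ler_norm _)) //.
rewrite addrCA -addrA lerDl !addr_ge0 //; apply: sumr_ge0 => // i' _.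
exact: sumr_ge0.
Qed.

Lemma ler_sum_coords k (u : 'rV[R]_k) : \sum_i `|u 0 i| <= k%:R * enorm u.
Proof.
have -> : k%:R * enorm u = \sum_(i < k) enorm u.
  by rewrite sumr_const card_ord mulr_natl.
by apply: ler_sum => i _; exact: ler_coord_enorm.
Qed.

Lemma ler_enorm_coordb k (u : 'rV[R]_k) b : (forall i, `|u 0 i| <= b) ->
  enorm u <= k%:R * b.
Proof.
move=> h; rewrite (le_trans (ler_enorm_coords u)) //.
have -> : k%:R * b = \sum_(i < k) b by rewrite sumr_const card_ord mulr_natl.
by apply: ler_sum => i _.
Qed.

Variables (N m : nat) (M : set 'rV[R]_N) (W : set 'rV[R]_m) (U : set 'rV[R]_N).
Variable phi : 'rV[R]_m -> 'rV[R]_N.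
Hypotheses (oW : open W) (oU : open U) (C2phi : C2_on W phi).
Hypothesis rkphi : forall u, W u -> \rank (\matrix_(i < m) 'D_(unitv R i) phi u) = m.
Hypothesis hom : homeo_onto W (M `&` U) phi.

Local Notation J u := (\matrix_(i < m) 'D_(unitv R i) phi u).

(** Continuity bounds the second partials near [u0]; [partials_dev] is then applied to each entry
    with reference slopes 0. *)
Lemma chart_partials_lipschitz u0 : W u0 -> exists d K : R, [/\ 0 < d, 0 < K &
  forall u, enorm (u - u0) < d -> W u /\ forall i,
    enorm ('D_(unitv R i) phi u - 'D_(unitv R i) phi u0) <= K * enorm (u - u0)].
Proof.
move=> Wu0; pose F i j := 'D_(unitv R j) ('D_(unitv R i) phi).
have [B B0 hB] := @fin2_bound m m (fun i j => enorm (F i j u0) + 1).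
have nB : \forall w \near u0, forall i j, enorm (F i j w) <= B.
  have FF := nbhs_filter u0.
  apply: (@filter_forall _ _ (fun i w => forall j, enorm (F i j w) <= B) _ FF) => i.
  apply: (@filter_forall _ _ (fun j w => enorm (F i j w) <= B) _ FF) => j.
  have [_ _ _ cF] := C2phi Wu0 i j.
  have h : nbhs (F i j u0) [set v | enorm (F i j u0 - v) < 1].
    by apply/nbhs_enormP; exists 1.
  have := cF _ h; rewrite /nbhs /=; apply: filterS => w /= hw.
  have : enorm (F i j w) <= enorm (F i j u0) + 1.
    exact: le_trans (ler_enorm_addB _ (F i j u0)) (lerD (lexx _) (ltW hw)).
  by move=> h1; apply: le_trans h1 (hB i j).
have nW : \forall w \near u0, W w by apply: open_nbhs_nbhs; split.
have /nbhs_enormP[d d0 hd] : nbhs u0 [set w | W w /\ forall i j, enorm (F i j w) <= B].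
  by apply: filterS2 nW nB => w; split.
exists d, (N%:R * (B * m%:R) + 1); split=> //.
  by rewrite ltr_wpDl // !mulr_ge0 // ltW.
move=> u ud'; have ud : enorm (u0 - u) < d by rewrite enormBC.
split; first by have [] := hd _ ud.
move=> i; set v := 'D_(unitv R i) phi u - 'D_(unitv R i) phi u0.
have bk k : `|v 0 k| <= B * (m%:R * enorm (u - u0)).
  have := @partials_dev R m (fun w => 'D_(unitv R i) phi w 0 k) u0 u (fun=> 0) B.
  have -> : v 0 k = 'D_(unitv R i) phi u 0 k - 'D_(unitv R i) phi u0 0 k.
    by rewrite !mxE.
  rewrite [X in `|_ - X|]big1 ?subr0; last by move=> ? _; rewrite mul0r.
  move=> h; apply: le_trans (h _) _.
    move=> w hw j.
    have wd : enorm (u0 - w) < d.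
      apply: le_lt_trans ud; rewrite enormBC (enormBC u0 u).
      by apply: ler_enorm_coordwise => j'; rewrite !mxE.
    have [Ww hBw] := hd w wd.
    have [_ dd _ _] := C2phi Ww i j; split.
      by have /derivable_mxP := dd; apply.
    rewrite subr0; have := derive_mx dd => /(congr1 (fun A : 'rV_N => A 0 k)).
    rewrite mxE => <-; exact: le_trans (ler_coord_enorm _ _) (hBw i j).
  rewrite ler_wpM2l ?(ltW B0) //.
  have -> : \sum_i0 `|u 0 i0 - u0 0 i0| = \sum_i0 `|(u - u0) 0 i0|.
    by apply: eq_bigr => j _; rewrite !mxE.
  exact: ler_sum_coords.
apply: le_trans (ler_enorm_coordb bk) _.
by rewrite [leRHS]mulrDl mul1r !mulrA lerDl enorm_ge0.
Qed.

(** Here the reference slopes are the first partials at [u0], from which the nearby ones deviate by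
    at most [K |u - u0|]; the remainder is therefore quadratic. *)
Lemma chart_taylor u0 : W u0 -> exists d K : R, [/\ 0 < d, 0 < K &
  forall u, enorm (u - u0) < d -> W u /\
    enorm (phi u - phi u0 - (u - u0) *m J u0) <= K * enorm (u - u0) ^+ 2].
Proof.
move=> Wu0; have [d [K [d0 K0 hd]]] := chart_partials_lipschitz Wu0.
exists d, (N%:R * (K * m%:R) + 1); split=> //.
  by rewrite ltr_wpDl // !mulr_ge0 // ltW.
move=> u ud; split; first by have [] := hd _ ud.
set v := _ - _ *m _.
have bk k : `|v 0 k| <= K * enorm (u - u0) * (m%:R * enorm (u - u0)).
  have := @partials_dev R m (fun w => phi w 0 k) u0 u
     (fun i => 'D_(unitv R i) phi u0 0 k) (K * enorm (u - u0)).
  have -> : v 0 k = phi u 0 k - phi u0 0 k -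
      \sum_i 'D_(unitv R i) phi u0 0 k * (u 0 i - u0 0 i).
    by rewrite /v !mxE; congr (_ - _); apply: eq_bigr => i _; rewrite !mxE mulrC.
  move=> h; apply: le_trans (h _) _.
    move=> w hw j.
    have wu : enorm (w - u0) <= enorm (u - u0).
      by apply: ler_enorm_coordwise => j'; rewrite !mxE.
    have [Ww hB] := hd w (le_lt_trans wu ud).
    have [dd _ _ _] := C2phi Ww j j; split.
      by have /derivable_mxP := dd; apply.
    have := derive_mx dd => /(congr1 (fun A : 'rV_N => A 0 k)); rewrite mxE => <-.
    have := ler_coord_enorm ('D_(unitv R j) phi w - 'D_(unitv R j) phi u0) k.
    rewrite !mxE => /le_trans; apply; apply: le_trans (hB j) _.
    by rewrite ler_wpM2l // ltW.
  rewrite ler_wpM2l ?mulr_ge0 ?enorm_ge0 ?(ltW K0) //.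
  have -> : \sum_i0 `|u 0 i0 - u0 0 i0| = \sum_i0 `|(u - u0) 0 i0|.
    by apply: eq_bigr => j _; rewrite !mxE.
  exact: ler_sum_coords.
rewrite (le_trans (ler_enorm_coordb bk)) // expr2.
have := mulr_ge0 (enorm_ge0 (u - u0)) (enorm_ge0 (u - u0)); lra.
Qed.

(* A first, non-quantitative tangent ball: its radius [tau] comes from the C^2
   bound of the chart. *)
Lemma chart_normal_bound u0 : W u0 -> exists2 tau : R, 0 < tau &
  forall y n, M y -> n *m (J u0)^T = 0 ->
    2 * tau * dotp n (y - phi u0) <= enorm n * enorm (y - phi u0) ^+ 2.
Proof.
move=> Wu0; have [d [K [d0 K0 hd]]] := chart_taylor Wu0.
have [P [oP _ hP _]] := exists_row_proj (rkphi Wu0).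
have /row_freeP[B JB] : row_free (J u0) by rewrite /row_free rkphi.
have [C C0 hC] := enorm_le_mulmx B.
(* Below [1 / (2 C K)] the quadratic Taylor error is absorbed by the linear term, which leaves
   [|u - u0| <= 2 C |y - phi u0|]. *)
pose r := Num.min d (2 * C * K)^-1.
have r0 : 0 < r by rewrite lt_min d0 invr_gt0 !mulr_gt0.
have [[inj cphi iphi] img] := hom.
have [r1 r10 hr1] := iphi u0 Wu0 r r0.
have Mw : (M `&` U) (phi u0) by rewrite -img; exists u0.
have [r2 r20 hr2] : exists2 d : R, 0 < d & forall y, enorm (phi u0 - y) < d -> U y.
  by apply/nbhs_enormP; apply: open_nbhs_nbhs; split=> //; case: Mw.
pose t1 := Num.min r1 r2 / 2.
have m0 : 0 < Num.min r1 r2 by rewrite lt_min r10.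
pose K2 := 8 * K * C ^+ 2.
have K20 : 0 < K2 by rewrite !mulr_gt0 // exprn_gt0.
(* [t1] serves the points of [M] outside the chart ball, by Cauchy-Schwarz alone; [1 / K2] serves
   those inside, where only the Taylor remainder has a normal part. *)
pose tau := Num.min t1 K2^-1.
have t0 : 0 < tau by rewrite lt_min invr_gt0 K20 divr_gt0.
exists tau => // y n My nJ.
set D := dotp _ _; set e := enorm (y - phi u0).
have e0 : 0 <= e by exact: enorm_ge0.
have n0 := enorm_ge0 n.
have [far|near] := leP (Num.min r1 r2) e.
  have h1 : D <= enorm n * e by exact: ler_dotp.
  have h2 : 2 * tau <= Num.min r1 r2.
    by rewrite mulrC -ler_pdivlMr // ge_min lexx.
  have h3 : 2 * tau * D <= 2 * tau * (enorm n * e).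
    by rewrite ler_pM2l // mulr_gt0.
  apply: le_trans h3 _; rewrite mulrC -mulrA ler_wpM2l // expr2 ler_wpM2l //.
  exact: le_trans h2 far.
have [n1 n2] : e < r1 /\ e < r2 by move: near; rewrite lt_min => /andP[].
have : (M `&` U) y by split=> //; apply: hr2; rewrite enormBC.
rewrite -img => -[u Wu uy].
have ur : enorm (u - u0) < r.
  rewrite enormBC; apply: hr1 => //.
  by rewrite uy euc_distC.
have [ud uK] : enorm (u - u0) < d /\ enorm (u - u0) < (2 * C * K)^-1.
  by move: ur; rewrite lt_min => /andP[].
have [_] := hd u ud; rewrite uy; set x := u - u0; set rho := y - phi u0 - _ => hrho.
have x0 := enorm_ge0 x.
have eq1 : y - phi u0 = x *m J u0 + rho by rewrite /rho [RHS]addrC subrK.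
have xJ : enorm (x *m J u0) <= e + K * enorm x ^+ 2.
  have -> : x *m J u0 = (y - phi u0) - rho by rewrite eq1 addrK.
  by rewrite (le_trans (ler_enormB _ _)) // lerD2l.
have xC : enorm x <= C * (e + K * enorm x ^+ 2).
  have := hC (x *m J u0); rewrite -mulmxA JB mulmx1 => /le_trans; apply.
  by rewrite ler_wpM2l // ltW.
have xe : enorm x <= 2 * C * e.
  have : C * K * enorm x ^+ 2 <= enorm x / 2.
    have : enorm x * (2 * C * K) <= 1.
      by rewrite -ler_pdivlMr ?mul1r ?mulr_gt0 // ltW.
    move=> h; rewrite expr2; nra.
  move: xC; rewrite mulrDr mulrA; lra.
have Drho : D <= enorm n * (K * enorm x ^+ 2).
  rewrite /D eq1 dotpDr.
  have -> : dotp n (x *m J u0) = 0.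
    by rewrite dotpC dotp_mulmx nJ dotp0r.
  rewrite add0r (le_trans (ler_dotp _ _)) // ler_wpM2l //.
have x2 : enorm x ^+ 2 <= 4 * C ^+ 2 * e ^+ 2.
  have -> : 4 * C ^+ 2 * e ^+ 2 = (2 * C * e) ^+ 2 by ring.
  by rewrite lerXn2r ?nnegrE // !mulr_ge0 // ltW.
have D2 : D <= enorm n * (K2 / 2 * e ^+ 2).
  apply: le_trans Drho _; rewrite ler_wpM2l // /K2.
  have := ler_wpM2l (ltW K0) x2; lra.
have tK : tau * K2 <= 1 by rewrite -ler_pdivlMr // mul1r ge_min lexx orbT.
have : 2 * tau * D <= 2 * tau * (enorm n * (K2 / 2 * e ^+ 2)).
  by rewrite ler_pM2l // mulr_gt0.
move/le_trans; apply.
have -> : 2 * tau * (enorm n * (K2 / 2 * e ^+ 2)) = (tau * K2) * (enorm n * e ^+ 2).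
  by field.
by rewrite ler_piMl // mulr_ge0 // sqr_ge0.
Qed.

Lemma chart_in u0 : W u0 -> M (phi u0).
Proof.
move=> Wu0; have : (M `&` U) (phi u0) by have [_ <-] := hom; exists u0.
by case.
Qed.

(** A curve in [M] is not pulled back through [phi], whose inverse is only known to be continuous.
    Instead, a normal part [n] of its velocity would make [dotp n (g s - p)] grow like [s |n|^2],
    while [chart_normal_bound] allows only order [s^2]. Conversely, straight lines in the chart have
    the prescribed velocities. *)
Lemma chart_tangent u0 : W u0 ->
  tangent_vectors M (phi u0) = [set w | exists a : 'rV[R]_m, w = a *m J u0].
Proof.
move=> Wu0; have [P [oP _ hP hP0]] := exists_row_proj (rkphi Wu0).
have [d [K [d0 K0 hd]]] := chart_taylor Wu0.
apply/seteqP; split=> [w [g [dg [dg0 Mg g0 deg1 deg2]]]|w [a ->]].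
  apply/hP; apply/eqP; rewrite eq_sym -subr_eq0 -enorm_eq0.
  set n := w - w *m P.
  have nJ : n *m (J u0)^T = 0.
    by apply/hP0; rewrite mulmxBl proj_idem // subrr.
  have [tau t0 ht] := chart_normal_bound Wu0.
  have nw : dotp n w = enorm n ^+ 2.
    rewrite enorm_sqr {3}/n dotpBr dotpC -[X in _ = _ - X]dotpC.
    by rewrite [X in _ - X](_ : _ = 0) ?subr0 // /n dotpC dotpC proj_orth.
  have [//|n0] := eqVneq (enorm n) 0.
  have np : 0 < enorm n by rewrite lt_def n0 enorm_ge0.
  have := (derive_curveP g w).1 (conj deg1 deg2).
  move=> /(_ (enorm n / 2)); rewrite divr_gt0 // => /(_ isT)[d1 d10 hd1].
  pose c := (enorm w + enorm n) ^+ 2.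
  have c0 : 0 <= c by rewrite sqr_ge0.
  pose s := Num.min (Num.min dg d1) (tau * enorm n / (c + 1)) / 2.
  have c1 : 0 < c + 1 by rewrite ltr_wpDl.
  have mn : 0 < Num.min (Num.min dg d1) (tau * enorm n / (c + 1)).
    by rewrite !lt_min dg0 d10 /= !mulr_gt0 // invr_gt0.
  have s0 : 0 < s by rewrite divr_gt0.
  have s2 : s < Num.min (Num.min dg d1) (tau * enorm n / (c + 1)).
    by rewrite /s ltr_pdivrMr // ltr_pMr // ltr1n.
  move: s2; rewrite !lt_min => /andP[/andP[sdg sd1] sc].
  have := hd1 s; rewrite g0 gtr0_norm // => /(_ sd1).
  set rho := g s - _ - _ => hrho.
  have Mgs : M (g s) by apply: Mg; rewrite gtr0_norm.
  have := ht (g s) n Mgs nJ.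
  have -> : g s - phi u0 = s *: w + rho by rewrite /rho [RHS]addrC subrK.
  rewrite dotpDr dotpZr nw => h.
  have h1 : `|dotp n rho| <= enorm n * (enorm n / 2 * s).
    by rewrite (le_trans (ler_norm_dotp _ _)) // ler_wpM2l // ltW.
  have h2 : enorm (s *: w + rho) <= s * (enorm w + enorm n).
    rewrite (le_trans (ler_enormD _ _)) // enormZ gtr0_norm //.
    by move: hrho; nra.
  have h3 : enorm (s *: w + rho) ^+ 2 <= s ^+ 2 * c.
    by rewrite /c -exprMn lerXn2r ?nnegrE ?enorm_ge0 // mulr_ge0 ?addr_ge0 ?enorm_ge0 // ltW.
  have h4 : tau * (enorm n ^+ 2 * s) <= enorm n * (s ^+ 2 * c).
    apply: le_trans (le_trans h (ler_wpM2l (ltW np) h3)).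
    rewrite -mulrA [X in _ <= X]mulrCA ler_pM2l //.
    move: h1; rewrite ler_norml => /andP[h1 _]; lra.
  have h5 : tau * enorm n <= s * c.
    have p : 0 < enorm n * s by rewrite mulr_gt0.
    rewrite -(ler_pM2l p); lra.
  move: sc; rewrite ltr_pdivlMr // => sc.
  by exfalso; lra.
exists (fun s => phi (u0 + s *: a)), (d / (enorm a + 1)).
have a1 : 0 < enorm a + 1 by rewrite ltr_wpDl ?enorm_ge0.
have eu (s : R) : u0 + s *: a - u0 = s *: a by rewrite addrC addKr.
have small s : `|s| < d / (enorm a + 1) -> enorm (u0 + s *: a - u0) < d.
  rewrite eu enormZ ltr_pdivlMr // => h; apply: le_lt_trans h.
  by rewrite ler_wpM2l // lerDl.
have : derivable (fun s : R => phi (u0 + s *: a)) 0 1 /\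
    'D_1 (fun s : R => phi (u0 + s *: a)) 0 = a *m J u0.
  apply/derive_curveP => e e0.
  pose C := K * enorm a ^+ 2 + 1.
  have C0 : 0 < C by rewrite ltr_wpDl // mulr_ge0 ?sqr_ge0 // ltW.
  exists (Num.min (d / (enorm a + 1)) (e / C)); first by rewrite lt_min !divr_gt0.
  move=> s; rewrite lt_min => /andP[sd se].
  have [_] := hd _ (small s sd).
  rewrite eu -scalemxAl scale0r addr0 => /le_trans; apply.
  rewrite enormZ exprMn mulrCA expr2 -mulrA mulrC ler_wpM2r //.
  move: se; rewrite ltr_pdivlMr // => se; apply: le_trans (ltW se).
  by rewrite ler_wpM2l // /C lerDl.
case=> h1 h2; split=> //.
- by rewrite divr_gt0.
- by move=> s sd; apply: chart_in; have [] := hd _ (small s sd).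
- by rewrite scale0r addr0.
Qed.

(** First variation: a nonzero [a] would be a parameter direction in which the distance to [x]
    decreases to first order. *)
Lemma chart_closest_normal u0 x : W u0 -> closest M x (phi u0) ->
  (x - phi u0) *m (J u0)^T = 0.
Proof.
move=> Wu0 [_ hx]; set n := x - phi u0.
have [d [K [d0 K0 hd]]] := chart_taylor Wu0.
pose a := n *m (J u0)^T; apply/eqP; apply: contrapT => /negP a0'.
have a0 : 0 < enorm a by rewrite enorm_gt0.
have na : dotp n (a *m J u0) = enorm a ^+ 2.
  by rewrite dotpC dotp_mulmx enorm_sqr.
(* [b] collects the terms of order [s^2]; for [s < |a|^2 / b] the first-order gain [2 s |a|^2]
   outweighs them. *)
pose b := enorm n * K * enorm a ^+ 2 + (enorm (a *m J u0) + K * enorm a ^+ 2) ^+ 2 + 1.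
have K' := ltW K0.
have n0 := enorm_ge0 n.
have b0 : 0 < b.
  by rewrite ltr_wpDl // addr_ge0 ?sqr_ge0 // !mulr_ge0 ?enorm_ge0.
pose s := Num.min (Num.min (d / enorm a) 1) (enorm a ^+ 2 / b) / 2.
have mn : 0 < Num.min (Num.min (d / enorm a) 1) (enorm a ^+ 2 / b).
  by rewrite !lt_min ltr01 !divr_gt0 // exprn_gt0.
have s0 : 0 < s by rewrite divr_gt0.
have : s < Num.min (Num.min (d / enorm a) 1) (enorm a ^+ 2 / b).
  by rewrite /s ltr_pdivrMr // ltr_pMr // ltr1n.
rewrite !lt_min => /andP[/andP[sd s1] sb].
have eu : u0 + s *: a - u0 = s *: a by rewrite addrC addKr.
have [] := hd (u0 + s *: a).
  by rewrite eu enormZ gtr0_norm // -ltr_pdivlMr.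
rewrite eu -scalemxAl; set y := phi _ => Wy.
set rho := y - _ - _ => hrho.
have yE : y - phi u0 = s *: (a *m J u0) + rho by rewrite /rho [RHS]addrC subrK.
have := hx y (chart_in Wy).
rewrite -(@ler_pXn2r _ 2) ?nnegrE ?enorm_ge0 // /euc_dist -/n.
have -> : x - y = n - (y - phi u0) by rewrite /n opprB addrA subrK.
rewrite (enormB_sqr n (y - phi u0)) yE dotpDr dotpZr na => h.
have r1 : enorm rho <= K * enorm a ^+ 2 * s ^+ 2.
  by apply: le_trans hrho _; rewrite enormZ gtr0_norm // exprMn; lra.
have Ka : 0 <= K * enorm a ^+ 2 by rewrite mulr_ge0 // sqr_ge0.
have r2 : enorm rho <= K * enorm a ^+ 2 * s.
  apply: le_trans r1 _; rewrite ler_wpM2l // expr2 ler_piMl //; exact: ltW.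
have h1 : `|dotp n rho| <= enorm n * (K * enorm a ^+ 2 * s ^+ 2).
  by rewrite (le_trans (ler_norm_dotp _ _)) // ler_wpM2l.
have h2 : enorm (s *: (a *m J u0) + rho) <= s * (enorm (a *m J u0) + K * enorm a ^+ 2).
  by rewrite (le_trans (ler_enormD _ _)) // enormZ gtr0_norm //; lra.
have h3 : enorm (s *: (a *m J u0) + rho) ^+ 2 <=
    s ^+ 2 * (enorm (a *m J u0) + K * enorm a ^+ 2) ^+ 2.
  by rewrite -exprMn lerXn2r ?nnegrE ?enorm_ge0 // mulr_ge0 ?addr_ge0 ?enorm_ge0 // ltW.
move: h1; rewrite ler_norml => /andP[h1 _].
have h4 : 2 * s * enorm a ^+ 2 <= 2 * s ^+ 2 * b.
  rewrite /b; move: (sqr_ge0 s) h h1 h3 (sqr_ge0 (enorm (s *: (a *m J u0) + rho))).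
  have := mulr_ge0 (sqr_ge0 s) (sqr_ge0 (enorm (a *m J u0) + K * enorm a ^+ 2)).
  lra.
move: sb; rewrite ltr_pdivlMr // => sb.
have := ltr_pM2l s0 (s * b) (enorm a ^+ 2); rewrite sb => h5.
move: h4; nra.
Qed.

(** Write the tangent vector as [a *m J u]. As [n] kills [a *m J u0], only a multiple of
    [|u - u0| |a|] remains, and full rank bounds [|a|] by [2 C] times the length of the vector. *)
Lemma chart_tangent_continuity u0 n : W u0 -> n *m (J u0)^T = 0 ->
  forall e : R, 0 < e -> exists2 d : R, 0 < d & forall y, M y ->
    euc_dist (phi u0) y < d -> forall t, tangent_vectors M y t ->
    `|dotp n t| <= e * enorm t.
Proof.
move=> Wu0 nJ e e0.
have [d [K [d0 K0 hd]]] := chart_partials_lipschitz Wu0.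
have /row_freeP[B JB] : row_free (J u0) by rewrite /row_free rkphi.
have [C C0 hC] := enorm_le_mulmx B.
have [[inj cphi iphi] img] := hom.
have Mw : (M `&` U) (phi u0) by rewrite -img; exists u0.
have [r2 r20 hr2] : exists2 d : R, 0 < d & forall y, enorm (phi u0 - y) < d -> U y.
  by apply/nbhs_enormP; apply: open_nbhs_nbhs; split=> //; case: Mw.
pose mK := m%:R * K + 1.
have mK0 : 0 < mK by rewrite ltr_wpDl // mulr_ge0 // ltW.
pose r := Num.min d (Num.min (2 * C * mK)^-1 (e / (2 * C * mK * (enorm n + 1)))).
have n1 : 0 < enorm n + 1 by rewrite ltr_wpDl // enorm_ge0.
have r0 : 0 < r by rewrite !lt_min d0 invr_gt0 divr_gt0 // !mulr_gt0.
have [r1 r10 hr1] := iphi u0 Wu0 r r0.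
exists (Num.min r1 r2); first by rewrite lt_min r10.
move=> y My; rewrite lt_min => /andP[y1 y2] t.
have : (M `&` U) y by split=> //; apply: hr2.
rewrite -img => -[u Wu uy]; rewrite -uy chart_tangent // => -[a ->].
have : enorm (u - u0) < r by rewrite enormBC; apply: hr1 => //; rewrite uy.
rewrite !lt_min => /and3P[ud u1 u2].
have [_ hD] := hd u ud.
have DJ : enorm (a *m J u - a *m J u0) <= mK * enorm (u - u0) * enorm a.
  rewrite -mulmxBr mulmx_sum_row (le_trans (ler_enorm_sum _ _ _)) //.
  have -> : mK * enorm (u - u0) * enorm a =
      \sum_(i < m) (enorm a * (K * enorm (u - u0))) + enorm (u - u0) * enorm a.
    by rewrite sumr_const card_ord -mulr_natl /mK; ring.
  rewrite -[leLHS]addr0 lerD ?mulr_ge0 ?enorm_ge0 //.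
  apply: ler_sum => i _; rewrite enormZ ler_pM ?enorm_ge0 ?ler_coord_enorm //.
  by rewrite linearB /= !rowK; exact: hD.
have a0 := enorm_ge0 a; have u00 := enorm_ge0 (u - u0).
have aC : enorm a <= C * (enorm (a *m J u) + mK * enorm (u - u0) * enorm a).
  have := hC (a *m J u0); rewrite -mulmxA JB mulmx1 => /le_trans; apply.
  rewrite ler_wpM2l ?(ltW C0) //.
  have -> : a *m J u0 = a *m J u - (a *m J u - a *m J u0) by rewrite subKr.
  by rewrite (le_trans (ler_enormB _ _)) // lerD2l.
have a2 : enorm a <= 2 * C * enorm (a *m J u).
  have : enorm (u - u0) * (2 * C * mK) <= 1.
    by rewrite -ler_pdivlMr ?mul1r ?mulr_gt0 // ltW.
  move: aC; nra.
have -> : dotp n (a *m J u) = dotp n (a *m J u - a *m J u0).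
  by rewrite dotpBr [X in _ = _ - X]dotpC dotp_mulmx nJ dotp0r subr0.
rewrite (le_trans (ler_norm_dotp _ _)) //.
apply: le_trans (ler_wpM2l (enorm_ge0 n) DJ) _.
have u3 : enorm (u - u0) * (2 * C * mK * (enorm n + 1)) <= e.
  by rewrite -ler_pdivlMr ?mulr_gt0 // ltW.
have t0 := enorm_ge0 (a *m J u).
apply: (@le_trans _ _ (enorm n * (mK * enorm (u - u0) * (2 * C * enorm (a *m J u))))).
  by rewrite !ler_wpM2l ?mulr_ge0 ?enorm_ge0 // ltW.
apply: (@le_trans _ _ ((enorm (u - u0) * (2 * C * mK * (enorm n + 1))) * enorm (a *m J u))).
  have : 0 <= mK * enorm (u - u0) * (2 * C * enorm (a *m J u)).
    by rewrite !mulr_ge0 // ltW.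
  lra.
by rewrite ler_wpM2r.
Qed.

End Chart.

(** * Medial axis and Federer's inequality *)

Section Reach.
Variables (R : realType) (N : nat).
Implicit Types (M : set 'rV[R]_N) (w x y z n : 'rV[R]_N).

(** Real lower bounds [rho] stand in for the feature size, which is infinite when the medial axis is
    empty. *)
Lemma lfs_geP M w (rho : R) :
  (rho%:E <= lfs M w)%E <-> forall z, medial_axis M z -> rho <= euc_dist w z.
Proof.
split=> [h z Mz|h]; last first.
  by apply: le_ereal_inf_tmp => _ [z Mz <-]; rewrite lee_fin; exact: h.
by rewrite -lee_fin (le_trans h) //; apply: ereal_inf_lbound; exists z.
Qed.

Lemma lfs_ge_dist M w y (rho : R) :
  (rho%:E <= lfs M w)%E -> ((rho - euc_dist w y)%:E <= lfs M y)%E.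
Proof.
move=> /lfs_geP h; apply/lfs_geP => z /h hz.
by rewrite lerBlDl (le_trans hz) // ler_enorm_tri.
Qed.

Lemma not_medial_unique M x y y' :
  ~ medial_axis M x -> closest M x y -> closest M x y' -> y' = y.
Proof.
move=> nm h h'; apply: contrapT => ne; apply: nm.
by exists y', y.
Qed.

Lemma closest_cproj M x : compact M -> M !=set0 -> closest M x (cproj M x).
Proof.
move=> cM M0; rewrite /cproj; case: xgetP => [y _ //|h].
by have [y /h] := compact_closest x cM M0.
Qed.

Lemma closed_ball_compact (c : 'rV[R]_N) (d : R) : compact [set z : 'rV[R]_N | euc_dist z c <= d].
Proof.
apply: bounded_closed_compact.
  exists (enorm c + d); split; first exact: num_real.
  move=> b hb z /= zc; rewrite (le_trans (ler_norm_enorm _)) //.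
  apply: le_trans (ltW hb); rewrite -[z](subrK c) addrC (le_trans (ler_enormD _ _)) //.
  by rewrite lerD2l.
rewrite -[X in closed X]setCK; apply: open_closedC; rewrite openE => z /= /negP.
rewrite -ltNge => ze; apply/nbhs_enormP; exists (euc_dist z c - d).
  by rewrite subr_gt0.
move=> w zw /=; apply/negP; rewrite -ltNge.
have : euc_dist z c <= enorm (z - w) + euc_dist w c by exact: ler_enorm_tri.
by move: zw; rewrite ltrBrDr => zw h; rewrite -(ltrD2l (enorm (z - w))) (lt_le_trans zw).
Qed.

Lemma dist_cproj_lipschitz M x y : compact M -> M !=set0 ->
  euc_dist x (cproj M x) <= euc_dist x y + euc_dist y (cproj M y).
Proof.
move=> cM M0; have [_ h] := closest_cproj x cM M0.
have [My _] := closest_cproj y cM M0.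
by rewrite (le_trans (h _ My)) // ler_enorm_tri.
Qed.

(* Off the medial axis the distance to [M] grows at unit rate in the direction
   pointing away from the closest point. *)
Lemma dist_increase M z q (eta r : R) : compact M -> M !=set0 ->
  closest M z q -> (forall q', closest M z q' -> q' = q) ->
  0 < euc_dist z q -> 0 < eta <= 1 -> 0 < r ->
  exists2 z', euc_dist z z' < r &
    exists s : R, [/\ 0 < s, euc_dist z z' <= s &
      euc_dist z q + s * (1 - eta / 2) <= euc_dist z' (cproj M z')].
Proof.
move=> cM M0 hq uq D0 /andP[eta0 eta1] r0; set D := euc_dist z q in D0 *.
(* If the closest point moves by less than this, [z - q'] keeps a component of at least
   [D (1 - eta / 2)] along [u], which yields the growth rate. *)
have e0 : 0 < D * eta / 2 by rewrite divr_gt0 // mulr_gt0.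
have [d d0 hd] := closest_continuity cM hq uq e0.
pose s := Num.min d r / 2.
have s0 : 0 < s by rewrite divr_gt0 // lt_min d0.
have : s < Num.min d r by rewrite /s ltr_pdivrMr // ltr_pMr ?ltr1n // lt_min d0.
rewrite lt_min => /andP[sd sr].
pose u := D^-1 *: (z - q); pose z' := z + s *: u.
have u1 : enorm u = 1 by rewrite enormZ ger0_norm ?invr_ge0 ?(ltW D0) // mulVf // gt_eqF.
have zz' : euc_dist z z' = s.
  by rewrite /euc_dist /z' opprD addrA subrr sub0r enormN enormZ u1 mulr1 gtr0_norm.
exists z'; first by rewrite zz'.
exists s; split=> //; first by rewrite zz'.
have hq' := closest_cproj z' cM M0; set q' := cproj M z' in hq' *.
have qq' : euc_dist q q' < D * eta / 2 by apply: (hd z') => //; rewrite zz'.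
have uq' : D - D * eta / 2 <= dotp u (z - q').
  have -> : z - q' = (z - q) + (q - q') by rewrite addrA subrK.
  have -> : dotp u (z - q + (q - q')) = D + dotp u (q - q').
    by rewrite dotpDr {1}/u dotpZl -enorm_sqr expr2 mulrA mulVf ?mul1r // gt_eqF.
  rewrite lerD2l lerNl -dotpNr (le_trans (ler_dotp _ _)) // u1 mul1r enormN.
  exact: ltW.
have Dq' : D <= euc_dist z q' by case: hq => _; apply; case: hq'.
have a0 : 0 <= D + s * (1 - eta / 2).
  rewrite addr_ge0 ?(ltW D0) // mulr_ge0 ?(ltW s0) // subr_ge0 ler_pdivrMr // mul1r.
  by rewrite (le_trans eta1) // ler1n.
rewrite -(@ler_pXn2r _ 2) ?nnegrE ?enorm_ge0 //.
have -> : euc_dist z' q' ^+ 2 = euc_dist z q' ^+ 2 + 2 * (s * dotp u (z - q')) + s ^+ 2.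
  rewrite /euc_dist; have -> : z' - q' = (z - q') + s *: u by rewrite /z' addrAC.
  by rewrite enormD_sqr dotpZr dotpC enormZ u1 mulr1 gtr0_norm.
have D2 : D ^+ 2 <= euc_dist z q' ^+ 2 by rewrite lerXn2r ?nnegrE ?enorm_ge0.
have h1 : s * (D - D * eta / 2) <= s * dotp u (z - q') by rewrite ler_pM2l.
have h2 : (s * (1 - eta / 2)) ^+ 2 <= s ^+ 2.
  have p : 0 <= 1 - eta / 2 by rewrite subr_ge0 ler_pdivrMr // mul1r (le_trans eta1) // ler1n.
  have le : s * (1 - eta / 2) <= s.
    by rewrite ler_piMr ?(ltW s0) // lerBlDr lerDl divr_ge0 // ltW.
  by apply: lerXn2r; rewrite ?nnegrE ?(mulr_ge0 (ltW s0) p) ?(ltW s0).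
rewrite sqrrD; move: h1 h2 D2; rewrite mulr2n; lra.
Qed.

(* A tangent ball avoiding [M] can be inflated until its centre reaches the
   medial axis: maximizing [z |-> d_M(z) - (1 - zeta^2) |z - c|] around the centre
   [c] of a maximal one pushes the maximum to the sphere, straight along [n]. *)
Lemma tangent_ball_extend M w n (tau delta rho : R) : compact M -> M w ->
  enorm n = 1 -> 0 < delta <= tau -> tau + delta < rho ->
  (rho%:E <= lfs M w)%E ->
  (forall y, M y -> tau <= euc_dist (w + tau *: n) y) ->
  forall y, M y -> tau + delta <= euc_dist (w + (tau + delta) *: n) y.
Proof.
have aux1 (a b c d' s e : R) : a + s * (1 - e / 2) <= b ->
    (1 - e) * c <= (1 - e) * (s + d') -> 0 < s * e ->
    (1 - e) * c - b < (1 - e) * d' - a by lra.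
have aux0 (k a b p q : R) : k * a - p - (k * b - q) = k * (a - b) - (p - q) by ring.
have aux2 (e a b : R) : 0 <= e <= 1 -> `|a| <= b -> `|(1 - e) * a| <= b.
  move=> /andP[e0 e1] ab; rewrite normrM ger0_norm; last by rewrite subr_ge0.
  by apply: le_trans ab; rewrite ler_piMl // lerBlDr lerDl.
have aux3 (t d e x : R) : 0 < t -> 0 < d -> d <= t -> 0 < e ->
    (t + (1 - e) * d) ^+ 2 <= d ^+ 2 + 2 * (t * x) + t ^+ 2 ->
    d - 2 * e * d <= x.
  move=> t0 d0 dt e0 h.
  have h1 : e * d ^+ 2 <= e * d * t.
    by rewrite expr2 -!mulrA ler_pM2l // ler_pM2l.
  have h2 := sqr_ge0 (e * d).
  rewrite -(ler_pM2l t0); lra.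
have aux4 (z d x : R) : 0 < d -> d - 2 * z ^+ 2 * d <= x ->
    d ^+ 2 - 2 * (d * x) + d ^+ 2 <= (2 * z * d) ^+ 2.
  by move=> d0 h; have := ler_wpM2l (ltW d0) h; lra.
have aux5 (t d g z e Dz zy zc cy : R) : g = t + d - cy -> 0 < z * d ->
    6 * (z * d) <= g -> t + (1 - e) * d <= Dz -> e * d <= z * d -> Dz <= zy ->
    zy <= zc + cy -> zc <= 2 * z * d -> False by lra.
move=> cM Mw n1 /andP[delta0 dt] tdr /lfs_geP hlfs hG y My.
have M0 : M !=set0 by exists w.
move c1E : (w + (tau + delta) *: n) => c1; rewrite leNgt; apply/negP => lt.
move gE : (tau + delta - euc_dist c1 y) => g.
have g0 : 0 < g by rewrite -gE subr_gt0.
have t0 : 0 < tau by exact: lt_le_trans dt.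
(* [g] is the supposed deficit at [c1]. The final estimate loses at most
   [(2 zeta + zeta^2) delta <= 3 zeta delta], which [6 zeta delta <= g] covers. The rate is
   [eta = zeta^2] because an error [eta] in distance becomes [2 sqrt eta] in position. *)
have [zeta [z0 z1 zg]] : exists z : R, [/\ 0 < z, z <= 1 & 6 * (z * delta) <= g].
  exists (Num.min 1 (g / (6 * delta))).
  rewrite ge_min lexx lt_min ltr01 divr_gt0 ?mulr_gt0 //; split=> //.
  by rewrite mulrCA -ler_pdivlMr ?mulr_gt0 // ge_min lexx orbT.
move etaE : (zeta ^+ 2) => eta.
have eta0 : 0 < eta by rewrite -etaE exprn_gt0.
have eta1 : eta <= 1 by rewrite -etaE exprn_ile1 // ltW.
have e1 : 0 <= 1 - eta by rewrite subr_ge0.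
move c0E : (w + tau *: n) hG => c0 hG.
move DE : (fun z => euc_dist z (cproj M z)) => D.
have DP z : D z = euc_dist z (cproj M z) by rewrite -DE.
have Dlip x x' : D x <= euc_dist x x' + D x' by rewrite !DP; exact: dist_cproj_lipschitz.
pose B := [set z | euc_dist z c0 <= delta].
have ch : rcont_on B (fun z => (1 - eta) * euc_dist z c0 - D z).
  move=> x Bx e e0; exists (e / 2); first by rewrite divr_gt0.
  move=> x' _ xx'.
  have h1 : `|euc_dist x c0 - euc_dist x' c0| <= euc_dist x x'.
    rewrite (le_trans (ler_dist_enorm _ _)) //.
    by rewrite opprB addrA subrK.
  rewrite aux0; apply: le_lt_trans (ler_normB _ _) _.
  have h4 : `|D x - D x'| <= euc_dist x x'.
    rewrite ler_distl lerBlDl [D x' + _]addrC Dlip andbT.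
    by rewrite (euc_distC x x') Dlip.
  have h5 := aux2 eta _ _ _ h1.
  apply: le_lt_trans (lerD (h5 _) h4) _; first by rewrite (ltW eta0).
  by rewrite [e]splitr ltrD.
have Bc0 : B c0 by rewrite /B /= euc_distxx ltW.
have [|z Bz hz] := compact_argmin _ (@closed_ball_compact c0 delta) ch.
  by exists c0.
have Dc0 : tau <= D c0 by rewrite DP; apply: hG; case: (closest_cproj c0 cM M0).
have hz0 : D c0 + (1 - eta) * euc_dist z c0 <= D z.
  by have := hz _ Bc0; rewrite euc_distxx mulr0 sub0r lerBlDl lerBrDr addrC.
have c0w : euc_dist c0 w = tau.
  by rewrite /euc_dist -c0E addrC addKr enormZ n1 mulr1 gtr0_norm.
(* Points of the ball are closer than [rho] to [w], hence off the medial axis. At an interior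
   maximum [D] could still grow at rate [1 - eta / 2], more than the penalty [1 - eta] takes
   back. *)
have zc0 : euc_dist z c0 = delta.
  apply/eqP; rewrite eq_le Bz /= leNgt; apply/negP => zd.
  have nm : ~ medial_axis M z.
    move=> /hlfs; apply/negP; rewrite -ltNge (le_lt_trans _ tdr) //.
    rewrite euc_distC (le_trans (ler_enorm_tri _ c0 _)) // addrC.
    by rewrite -/(euc_dist _ _) -/(euc_dist _ _) c0w lerD2l.
  have hq := closest_cproj z cM M0.
  have uq q' : closest M z q' -> q' = cproj M z by exact: not_medial_unique.
  have Dz0 : 0 < euc_dist z (cproj M z).
    rewrite -DP; apply: lt_le_trans hz0.
    rewrite ltr_wpDr //; last exact: lt_le_trans Dc0.
    by rewrite mulr_ge0 // enorm_ge0.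
  have r0 : 0 < delta - euc_dist z c0 by rewrite subr_gt0.
  have [|z' zz' [s [s0 zs]]] := @dist_increase M z _ eta _ cM M0 hq uq Dz0 _ r0.
    by rewrite eta0.
  rewrite -!DP => hD.
  have tri : euc_dist z' c0 <= euc_dist z z' + euc_dist z c0.
    by rewrite (euc_distC z z') ler_enorm_tri.
  have Bz' : B z' by rewrite /B /= (le_trans tri) // -lerBrDr ltW.
  have := hz _ Bz'; rewrite leNgt => /negP; apply.
  have t2 : (1 - eta) * euc_dist z' c0 <= (1 - eta) * (s + euc_dist z c0).
    by rewrite ler_wpM2l // (le_trans tri) // lerD2r.
  by apply: aux1 hD t2 _; rewrite mulr_gt0.
rewrite zc0 in hz0.
(* [w] itself caps [D z], so a gain of nearly [delta] over [tau] forces [z - c0] to point almost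
   along [n]. *)
have wz : D z <= euc_dist z w.
  by rewrite DP; case: (closest_cproj z cM M0) => _; apply.
have zy : D z <= euc_dist z y.
  by rewrite DP; case: (closest_cproj z cM M0) => _; apply.
have Dz : tau + (1 - eta) * delta <= D z.
  by apply: le_trans hz0; rewrite lerD2r.
move vE : (z - c0) => v.
have v1 : enorm v = delta by rewrite -vE; exact: zc0.
have zwE : euc_dist z w ^+ 2 = delta ^+ 2 + 2 * (tau * dotp n v) + tau ^+ 2.
  rewrite /euc_dist; have -> : z - w = v + tau *: n.
    by rewrite -vE -c0E opprD addrA subrK.
  by rewrite enormD_sqr dotpZr enormZ n1 mulr1 v1 gtr0_norm // dotpC.
have nv : delta - 2 * zeta ^+ 2 * delta <= dotp n v.
  rewrite etaE; apply: (aux3 tau) => //; rewrite -zwE.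
  rewrite lerXn2r ?nnegrE ?enorm_ge0 //.
    by rewrite addr_ge0 ?(ltW t0) // mulr_ge0 // ltW.
  exact: le_trans Dz wz.
have zc1 : euc_dist z c1 <= 2 * zeta * delta.
  rewrite -(@ler_pXn2r _ 2) ?nnegrE ?enorm_ge0 ?mulr_ge0 ?(ltW z0) ?(ltW delta0) //.
  rewrite /euc_dist; have -> : z - c1 = v - delta *: n.
    by rewrite -vE -c0E -c1E scalerDl !opprD !addrA.
  rewrite enormB_sqr dotpZr enormZ n1 mulr1 v1 gtr0_norm // (dotpC v).
  exact: aux4.
apply: (aux5 tau delta g zeta eta (D z) (euc_dist z y) (euc_dist z c1)
  (euc_dist c1 y)) => //.
- by rewrite mulr_gt0.
- by rewrite ler_pM2r // -etaE expr2 ler_piMl // ltW.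
- exact: ler_enorm_tri.
Qed.

(** Federer's inequality with constant [t] says that the ball of radius [t] touching [M] at [w] on
    the side of [n] has no point of [M] in its interior; this is the form that can be inflated. *)
Lemma ball_dotP w n y (t : R) : enorm n = 1 -> 0 <= t ->
  (t <= euc_dist (w + t *: n) y) = (2 * t * dotp n (y - w) <= enorm (y - w) ^+ 2).
Proof.
move=> n1 t0; rewrite -(@ler_pXn2r _ 2) ?nnegrE ?enorm_ge0 //.
rewrite /euc_dist; have -> : w + t *: n - y = t *: n - (y - w).
  by rewrite opprB addrAC [LHS]addrC.
rewrite (enormB_sqr (t *: n)) dotpZl enormZ n1 mulr1 ger0_norm //.
by apply/idP/idP; lra.
Qed.

(** The admissible radii up to [rho] have a greatest one, positive thanks to [tau0]; were it below
    [rho], the ball could be inflated further. *)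
Lemma federer_unit M w n (tau0 rho : R) : compact M -> M w -> enorm n = 1 ->
  0 < tau0 -> (rho%:E <= lfs M w)%E -> 0 <= rho ->
  (forall y, M y -> 2 * tau0 * dotp n (y - w) <= enorm (y - w) ^+ 2) ->
  forall y, M y -> 2 * rho * dotp n (y - w) <= enorm (y - w) ^+ 2.
Proof.
move=> cM Mw n1 t00 hl rho0 start.
pose E := [set t : R | 0 <= t <= rho /\
   forall y, M y -> 2 * t * dotp n (y - w) <= enorm (y - w) ^+ 2].
have E0 : E 0.
  by split=> [|y _]; [rewrite lexx|rewrite mulr0 mul0r sqr_ge0].
have hE : has_sup E by split; [exists 0|exists rho => t [/andP[]]].
set tau := sup E.
have sr : tau <= rho by apply: ge_sup; [exists 0|move=> t [/andP[]]].
have s0 : 0 <= tau by apply: ub_le_sup => //; case: hE.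
have Etau y : M y -> 2 * tau * dotp n (y - w) <= enorm (y - w) ^+ 2.
  move=> My; have [le0|gt0] := leP (dotp n (y - w)) 0.
    by rewrite (@le_trans _ _ 0) ?sqr_ge0 // mulr_ge0_le0 // mulr_ge0.
  have : tau <= enorm (y - w) ^+ 2 / (2 * dotp n (y - w)).
    apply: ge_sup; first by exists 0.
    move=> t [_ ht]; rewrite ler_pdivlMr ?mulr_gt0 //.
    by have := ht y My; lra.
  by rewrite ler_pdivlMr ?mulr_gt0 //; lra.
have [//|taur] := eqVneq tau rho; first by move=> e; rewrite -e.
have tr : tau < rho by rewrite lt_neqAle taur.
have t0 : 0 < tau.
  apply: (@lt_le_trans _ _ (Num.min tau0 rho)).
    by rewrite lt_min t00 (le_lt_trans s0).
  apply: ub_le_sup; first by case: hE.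
  split; first by rewrite ge_min lexx orbT le_min (ltW t00) rho0.
  move=> y My; have [le0|gt0] := leP (dotp n (y - w)) 0.
    rewrite (@le_trans _ _ 0) ?sqr_ge0 // mulr_ge0_le0 // mulr_ge0 //.
    by rewrite le_min (ltW t00) rho0.
  apply: le_trans (start y My); rewrite ler_pM2r // ler_pM2l // ge_min lexx //.
(* The radius is at most doubled, as inflation requires, and only half of the remaining room is
   used. *)
pose delta := Num.min tau ((rho - tau) / 2).
have rt : 0 < rho - tau by rewrite subr_gt0.
have d0 : 0 < delta by rewrite lt_min t0 divr_gt0.
have dt : delta <= tau by rewrite ge_min lexx.
have dr : tau + delta < rho.
  have : delta <= (rho - tau) / 2 by rewrite ge_min lexx orbT.
  lra.
have ext := @tangent_ball_extend M w n tau delta rho cM Mw n1 _ dr hl.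
have Etd : E (tau + delta).
  split; first by rewrite addr_ge0 ?(ltW t0) ?(ltW d0) //= ltW.
  move=> y My; rewrite -ball_dotP ?addr_ge0 ?(ltW t0) ?(ltW d0) //.
  apply: ext => //; first by rewrite d0.
  by move=> y' My'; rewrite ball_dotP // Etau.
have : tau + delta <= tau by apply: ub_le_sup => //; case: hE.
by rewrite gerDl leNgt d0.
Qed.

Lemma federer_normal M w n (tau0 rho : R) : compact M -> M w ->
  0 < tau0 -> (rho%:E <= lfs M w)%E -> 0 <= rho ->
  (forall y, M y -> 2 * tau0 * dotp n (y - w) <= enorm n * enorm (y - w) ^+ 2) ->
  forall y, M y -> 2 * rho * dotp n (y - w) <= enorm n * enorm (y - w) ^+ 2.
Proof.
move=> cM Mw t0 hl r0 start y My.
have [->|n0] := eqVneq n 0; first by rewrite dotp0l enorm0 mulr0 mul0r.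
have np : 0 < enorm n by rewrite enorm_gt0.
pose u := (enorm n)^-1 *: n.
have u1 : enorm u = 1 by rewrite enormZ ger0_norm ?invr_ge0 ?enorm_ge0 // mulVf // gt_eqF.
have nE : n = enorm n *: u by rewrite /u scalerA mulfV ?scale1r // gt_eqF.
have start' y' : M y' -> 2 * tau0 * dotp u (y' - w) <= enorm (y' - w) ^+ 2.
  move=> /start; rewrite {1}nE dotpZl mulrCA; by rewrite ler_pM2l.
have := federer_unit cM Mw u1 t0 hl r0 start' My.
by move=> H; rewrite {1}nE dotpZl mulrCA ler_pM2l.
Qed.

Section Manifold.
Variables (m : nat) (M : set 'rV[R]_N).
Hypothesis mM : C2_submanifold m M.

(** Collects what is used of the C^2 structure; charts do not occur beyond this point. *)
Lemma manifold_tangent w : M w -> exists P : 'M[R]_N,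
  [/\ orth_proj P, \rank P = m, tangent_vectors M w = [set u | u *m P = u] &
   [/\ exists2 tau : R, 0 < tau & forall n y, M y -> n *m P = 0 ->
       2 * tau * dotp n (y - w) <= enorm n * enorm (y - w) ^+ 2,
      forall x, closest M x w -> (x - w) *m P = 0 &
      forall n, n *m P = 0 -> forall e : R, 0 < e -> exists2 d : R, 0 < d &
        forall y, M y -> euc_dist w y < d -> forall t, tangent_vectors M y t ->
        `|dotp n t| <= e * enorm t]].
Proof.
move=> Mw; have [W [U [phi [[oW oU Uw C2] [rk hom]]]]] := mM Mw.
have : (M `&` U) w by [].
have [_ <-] := hom => -[u0 Wu0 wE]; rewrite -wE.
have [P [oP rP hP hP0]] := exists_row_proj (rk _ Wu0).
exists P; split=> //.
  rewrite (chart_tangent oW oU C2 rk hom Wu0); apply/seteqP; split=> u /=.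
    by move=> /hP.
  by move=> /hP.
split.
- have [tau t0 ht] := chart_normal_bound oW oU C2 rk hom Wu0.
  by exists tau => // n y My /hP0 /ht; apply.
- move=> x hx; apply/hP0; exact: (chart_closest_normal oW C2 hom Wu0 hx).
- move=> n /hP0 nJ; exact: (chart_tangent_continuity oW oU C2 rk hom Wu0 nJ).
Qed.

End Manifold.

End Reach.

(** * Thick simplices *)

Section Simplex.
Variables (R : realType) (n N : nat) (v : 'I_n -> 'rV[R]_N).
Implicit Types (s : {set 'I_n}) (l : 'rV[R]_n) (p q i : 'I_n).

Lemma Ledge_ge s i j : i \in s -> j \in s -> euc_dist (v i) (v j) <= Ledge v s.
Proof.
move=> si sj; rewrite /Ledge.
apply: le_trans (@le_bigmax_cond _ R _ 0 i (mem s)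
  (fun i => \big[Num.max/0]_(j in s) euc_dist (v i) (v j)) si).
exact: (@le_bigmax_cond _ R _ 0 j (mem s) (fun j => euc_dist (v i) (v j)) sj).
Qed.

Lemma amin_le s k : k \in s -> amin v s <= altitude v s k.
Proof.
move=> sk; apply: ge_inf; last by exists k.
exists 0 => _ [i _ <-]; rewrite /altitude /distS.
have [[y hy]|h0] := pselect ([set euc_dist (v i) y | y in aff_hull v (s :\ i)] !=set0).
  by apply: lb_le_inf; [exists y|move=> _ [z _ <-]; exact: enorm_ge0].
(* The face opposite to the vertex of a 0-simplex has empty hull, and the infimum of the empty set
   is 0. *)
have -> : [set euc_dist (v i) y | y in aff_hull v (s :\ i)] = set0.
  by apply/seteqP; split=> // z hz; apply: h0; exists z.
by rewrite inf0.
Qed.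

(* A barycentric coordinate function has gradient of norm 1 / altitude. *)
Lemma altitude_coef s (c : 'I_n -> R) k : k \in s -> \sum_(i in s) c i = 0 ->
  amin v s * `|c k| <= enorm (\sum_(i in s) c i *: v i).
Proof.
move=> sk c0; set u := \sum_(i in s) _.
have [->|ck] := eqVneq (c k) 0; first by rewrite normr0 mulr0 enorm_ge0.
rewrite -ler_pdivlMr ?normr_gt0 // (le_trans (amin_le sk)) //.
apply: ge_inf; first by exists 0 => _ [z _ <-]; exact: enorm_ge0.
exists (\sum_(i in s :\ k) (- c i / c k) *: v i).
  exists (fun i => - c i / c k) => //=.
  rewrite -mulr_suml sumrN; have := c0; rewrite (big_setD1 k) //= => /eqP.
  by rewrite addrC addr_eq0 => /eqP ->; rewrite opprK mulfV.
rewrite /euc_dist; have -> : v k - \sum_(i in s :\ k) (- c i / c k) *: v i = (c k)^-1 *: u.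
  rewrite /u [in RHS](big_setD1 k sk) /= scalerDr scalerA mulVf // scale1r; congr (_ + _).
  rewrite scaler_sumr -sumrN; apply: eq_bigr => i _.
  by rewrite scalerA -scaleNr; congr (_ *: _); rewrite mulNr opprK mulrC.
by rewrite enormZ normfV mulrC.
Qed.

Lemma face_coord0 s l i : face_pts s l -> i \notin s -> l 0 i = 0.
Proof.
case=> _ /fintype.subsetP sl si; apply/eqP; apply: contraNT si => li.
by apply: sl; rewrite inE.
Qed.

Lemma face_sum s l : face_pts s l -> \sum_(i in s) l 0 i = 1.
Proof.
case=> -[l0 l1] sl; rewrite -l1 [RHS](bigID (mem s)) /= [X in _ = _ + X]big1 ?addr0 //.
by move=> i /(face_coord0 (conj (conj l0 l1) sl)).
Qed.

Lemma face_pl_map s l : face_pts s l -> pl_map v l = \sum_(i in s) l 0 i *: v i.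
Proof.
case=> bl sl; rewrite /pl_map [LHS](bigID (mem s)) /= [X in _ + X]big1 ?addr0 //.
by move=> i /(face_coord0 (conj bl sl)) ->; rewrite scale0r.
Qed.

Lemma face_pl_map_sub s l w : face_pts s l ->
  pl_map v l - w = \sum_(i in s) l 0 i *: (v i - w).
Proof.
move=> fl; rewrite (face_pl_map fl).
under [RHS]eq_bigr do rewrite scalerBr.
by rewrite sumrB -scaler_suml (face_sum fl) scale1r.
Qed.

Lemma face_dir s l l' : face_pts s l -> face_pts s l' ->
  dir_space v s (pl_map v l - pl_map v l').
Proof.
move=> fl fl'; exists (fun i => l 0 i - l' 0 i) => /=.
  by rewrite sumrB !face_sum // subrr.
rewrite (face_pl_map fl) (face_pl_map fl') -sumrB.
by apply: eq_bigr => i _; rewrite scalerBl.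
Qed.

Lemma face_coord_lipschitz s l l' p : face_pts s l -> face_pts s l' -> p \in s ->
  amin v s * `|l 0 p - l' 0 p| <= enorm (pl_map v l - pl_map v l').
Proof.
move=> fl fl' sp.
have := @altitude_coef s (fun i => l 0 i - l' 0 i) p sp.
rewrite sumrB !face_sum // subrr => /(_ erefl) /le_trans; apply.
rewrite (face_pl_map fl) (face_pl_map fl') -sumrB.
by under eq_bigr do rewrite scalerBl.
Qed.

Lemma vert_bary p : bary (unitv R p).
Proof.
split=> [i|]; first by rewrite !mxE ler0n.
rewrite (bigD1 p) //= big1; first by rewrite !mxE !eqxx addr0.
by move=> i ip; rewrite !mxE (negbTE ip) andbF.
Qed.

Lemma vert_supp p : supp (unitv R p) = [set p]%SET.
Proof.
apply/setP => i; rewrite !inE !mxE eqxx /=.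
by rewrite pnatr_eq0; case: (i == p).
Qed.

Lemma vert_face s p : p \in s -> face_pts s (unitv R p).
Proof. by move=> sp; split; [exact: vert_bary|rewrite vert_supp finset.sub1set]. Qed.

Lemma vert_pl_map p : pl_map v (unitv R p) = v p.
Proof.
have := @face_pl_map [set p]%SET (unitv R p) (vert_face (finset.set11 p)).
by rewrite big_set1 !mxE !eqxx scale1r.
Qed.

Lemma face_norm_le s l w b : face_pts s l ->
  (forall i, i \in s -> enorm (v i - w) <= b) -> enorm (pl_map v l - w) <= b.
Proof.
move=> fl h; rewrite (face_pl_map_sub _ fl) (le_trans (ler_enorm_sum _ _ _)) //.
rewrite -[b]mul1r -(face_sum fl) mulr_suml; apply: ler_sum => i si.
case: fl => -[l0 _] _; rewrite enormZ ger0_norm //.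
by rewrite ler_wpM2l // h.
Qed.

(** * Thickness, dimension and Whitney's angle bound *)

Section Thick.
Variables (s : {set 'I_n}) (t0 : R).
Hypotheses (vinj : injective v) (s2 : (2 <= #|s|)%N) (t00 : 0 < t0)
  (hs : t0 <= thick v s).

Let j : R := (#|s|.-1)%:R.

Let j1 : 1 <= j.
Proof. by rewrite /j ler1n; case: #|s| s2 => [|[]]. Qed.

Lemma Ledge_gt0 : 0 < Ledge v s.
Proof.
have [p [q [sp sq pq]]] : exists p q, [/\ p \in s, q \in s & p != q].
  have /card_gt1P[p [q [sp sq pq]]] := s2; by exists p, q.
apply: lt_le_trans (Ledge_ge sp sq); rewrite /euc_dist enorm_gt0 subr_eq0.
by apply: contraNneq pq => /vinj ->.
Qed.

Lemma amin_ge : t0 * (j * Ledge v s) <= amin v s.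
Proof.
by rewrite -ler_pdivlMr // mulr_gt0 ?Ledge_gt0 // (lt_le_trans _ j1).
Qed.

(** The smallest altitude is at most an edge, and thickness makes it at least [t0 j L]. The
    resulting bound on the dimension will keep the largest barycentric coordinate away from 0. *)
Lemma thick_dim : t0 * j <= 1.
Proof.
have /card_gt1P[p [q [sp sq pq]]] := s2.
have := @altitude_coef s (fun i => (i == p)%:R - (i == q)%:R) p sp.
have sum1 (r : 'I_n) : r \in s -> \sum_(i in s) (i == r)%:R = 1 :> R.
  by move=> sr; rewrite (big_setD1 r) //= eqxx big1 ?addr0 // => i; rewrite !inE => /andP[/negbTE ->].
rewrite sumrB !sum1 // subrr => /(_ erefl).
rewrite eqxx (negbTE pq) subr0 normr1 mulr1.
have sumv (r : 'I_n) : r \in s -> \sum_(i in s) (i == r)%:R *: v i = v r.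
  move=> sr; rewrite (big_setD1 r) //= eqxx scale1r big1 ?addr0 // => i.
  by rewrite !inE => /andP[/negbTE ->]; rewrite scale0r.
under eq_bigr do rewrite scalerBl.
rewrite sumrB !sumv // => h.
have L0 := Ledge_gt0.
rewrite -(ler_pM2r L0) mul1r -mulrA (le_trans amin_ge) // (le_trans h) //.
exact: Ledge_ge.
Qed.

(** Expand [u] over the [j] edges at [p]: each coefficient is at most [|u| / amin], and
    [amin >= t0 j L] cancels the number of terms. [Q] will be the projector onto a normal space. *)
Lemma whitney_angle k (Q : 'M[R]_(N, k)) p b u : p \in s ->
  (forall i, i \in s -> enorm ((v i - v p) *m Q) <= b) -> dir_space v s u ->
  t0 * Ledge v s * enorm (u *m Q) <= b * enorm u.
Proof.
move=> sp hb [c /= c0 <-]; set u' := \sum_(i in s) _.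
have b0 : 0 <= b by rewrite (le_trans _ (hb p sp)) ?enorm_ge0.
have uE : u' = \sum_(i in s :\ p) c i *: (v i - v p).
  have -> : u' = \sum_(i in s) c i *: (v i - v p).
    under [RHS]eq_bigr do rewrite scalerBr.
    by rewrite sumrB -scaler_suml c0 scale0r subr0.
  by rewrite (big_setD1 p) //= subrr scaler0 add0r.
have j0 : 0 < j by rewrite (lt_le_trans _ j1).
rewrite -(ler_pM2l j0).
have -> : j * (t0 * Ledge v s * enorm (u' *m Q)) = t0 * (j * Ledge v s) * enorm (u' *m Q) by ring.
apply: (@le_trans _ _ (amin v s * enorm (u' *m Q))).
  by rewrite ler_wpM2r ?enorm_ge0 // amin_ge.
have a0 : 0 <= amin v s.
  by rewrite (le_trans _ amin_ge) // !mulr_ge0 ?(ltW t00) ?(ltW j0) ?(ltW Ledge_gt0).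
have jE : j * (b * enorm u') = \sum_(i in s :\ p) enorm u' * b.
  rewrite sumr_const -mulr_natl /j (cardsD1 p s) sp add1n /=.
  by rewrite [enorm u' * b]mulrC.
rewrite jE {1}uE mulmx_suml.
apply: (@le_trans _ _ (amin v s * \sum_(i in s :\ p) enorm ((c i *: (v i - v p)) *m Q))).
  by rewrite ler_wpM2l // ler_enorm_sum.
rewrite mulr_sumr; apply: ler_sum => i; rewrite !inE => /andP[_ si].
rewrite -scalemxAl enormZ mulrA; apply: ler_pM; rewrite ?mulr_ge0 ?enorm_ge0 //.
  exact: altitude_coef.
exact: hb.
Qed.

End Thick.

End Simplex.

(** * Stars of vertices *)

Section Barycentric.
Variables (R : realType) (n : nat).
Implicit Types (l : 'rV[R]_n) (s : {set 'I_n}).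

Lemma bary_gt0 l i : bary l -> l 0 i != 0 -> 0 < l 0 i.
Proof. by move=> [l0 _] li; rewrite lt_def li l0. Qed.

Lemma bary_supp_neq0 l : bary l -> (0 < #|supp l|)%N.
Proof.
case=> _ l1; rewrite lt0n cards_eq0; apply/eqP => s0.
move/eqP: l1; rewrite big1 ?(eq_sym 0) ?oner_eq0 // => i _; apply/eqP.
apply: contraT => li; have : i \in supp l by rewrite inE.
by rewrite s0 inE.
Qed.

(** Supports can only grow under small perturbations, so a point and its neighbours in the complex
    lie in common simplices. *)
Lemma supp_nbhs l : exists2 d : R, 0 < d &
  forall l', euc_dist l l' < d -> supp l \subset supp l'.
Proof.
have [B B0 hB] := @fin2_bound R n n (fun i _ => `|l 0 i|^-1).
exists B^-1; first by rewrite invr_gt0.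
move=> l' ll'; apply/fintype.subsetP => i; rewrite !inE => li.
apply: contraTneq ll' => li'; rewrite -leNgt.
apply: le_trans (ler_coord_enorm (l - l') i); rewrite !mxE li' subr0.
by rewrite -[leRHS]invrK lef_pV2 ?posrE ?invr_gt0 ?normr_gt0 // hB.
Qed.

(** Supports may shrink in the limit; stability of [F] under subsets is what makes the set
    closed. *)
Lemma bary_compact (F : {set 'I_n} -> Prop) :
  (forall s t : {set 'I_n}, F t -> s \subset t -> F s) ->
  compact [set l : 'rV[R]_n | bary l /\ F (supp l)].
Proof.
move=> Fdown; apply: bounded_closed_compact.
  exists 1; split; first exact: num_real.
  move=> b b1 l /= [[l0 l1] _]; apply: le_trans (ltW b1).
  rewrite (le_trans (ler_norm_enorm _)) // (le_trans (ler_enorm_coords _)) //.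
  by rewrite -l1; apply: ler_sum => i _; rewrite ger0_norm.
rewrite -[X in closed X]setCK; apply: open_closedC; rewrite openE => l /= hl.
apply/nbhs_enormP.
have [l0|/existsNP[i /negP]] := pselect (forall i, 0 <= l 0 i); last first.
  rewrite -ltNge => li; exists (- l 0 i); first by rewrite oppr_gt0.
  move=> l' ll' [[l0' _] _]; have := l0' i; apply/negP; rewrite -ltNge.
  have := ler_coord_enorm (l' - l) i; rewrite enormBC !mxE => h.
  have := le_lt_trans (ler_norm _) (le_lt_trans h ll'); lra.
have [l1|l1] := eqVneq (\sum_i l 0 i) 1.
  have [d d0 hd] := supp_nbhs l; exists d => // l' /hd ss [_ Fl'].
  by apply: hl; split=> //; exact: Fdown Fl' ss.
exists (`|\sum_i l 0 i - 1| / (n%:R + 1)).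
  by rewrite divr_gt0 ?normr_gt0 ?subr_eq0 // ltr_wpDl.
move=> l' ll' [[_ l1'] _]; move: ll'; apply/negP; rewrite -leNgt.
have -> : \sum_i l 0 i - 1 = \sum_i (l 0 i - l' 0 i) by rewrite sumrB l1'.
rewrite ler_pdivrMr ?ltr_wpDl //.
apply: le_trans (ler_norm_sum _ _ _) _.
have -> : \sum_i `|l 0 i - l' 0 i| = \sum_i `|(l - l') 0 i|.
  by apply: eq_bigr => i _; rewrite !mxE.
by apply: le_trans (ler_sum_coords _) _; rewrite mulrC ler_wpM2l ?enorm_ge0 // lerDl.
Qed.

Lemma dir_spaceZ N (v : 'I_n -> 'rV[R]_N) s a u :
  dir_space v s u -> dir_space v s (a *: u).
Proof.
case=> c /= c0 <-; exists (fun i => a * c i) => /=.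
  by rewrite -mulr_sumr c0 mulr0.
by rewrite scaler_sumr; apply: eq_bigr => i _; rewrite scalerA.
Qed.

Lemma pl_map_lipschitz N (v : 'I_n -> 'rV[R]_N) :
  exists2 C : R, 0 < C & forall l l',
    euc_dist (pl_map v l) (pl_map v l') <= C * euc_dist l l'.
Proof.
have [C C0 h] := enorm_le_mulmx (\matrix_i v i); exists C => // l l'.
have e x : pl_map v x = x *m \matrix_i v i.
  by rewrite mulmx_sum_row; apply: eq_bigr => i _; rewrite rowK.
by rewrite !e /euc_dist -mulmxBl.
Qed.

Lemma pl_map_cont N (v : 'I_n -> 'rV[R]_N) B : cont_on B (pl_map v).
Proof.
move=> l _ e e0; have [C C0 h] := pl_map_lipschitz v.
exists (e / C); first by rewrite divr_gt0.
by move=> l' _; rewrite ltr_pdivlMr // mulrC => /(le_lt_trans (h l l')).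
Qed.

End Barycentric.

(** The star projected to the tangent space, with [v p] as origin, so that the values lie in a
    linear subspace. *)
Definition star_chart (R : realType) (N n : nat) (v : 'I_n -> 'rV[R]_N)
    (p : 'I_n) (P : 'M[R]_N) (l : 'rV[R]_n) : 'rV[R]_N :=
  (pl_map v l - v p) *m P.

Section Star.
Variables (R : realType) (N n : nat) (v : 'I_n -> 'rV[R]_N).
Variables (A : {set {set 'I_n}}) (p : 'I_n) (P : 'M[R]_N).
Hypothesis oP : orth_proj P.

Local Notation f := (star_chart v p P).
Local Notation star := (star_pts (R := R) A p).

Hypothesis femb : embedding_on star f.
Hypothesis fint : exists2 r : R, 0 < r & forall t, t *m P = t -> enorm t < r ->
  exists2 l, star l & f l = t.
Implicit Types (s : {set 'I_n}) (l : 'rV[R]_n) (q i : 'I_n) (t u : 'rV[R]_N).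

Lemma star_face l : star l <-> exists s, [/\ s \in A, p \in s & face_pts s l].
Proof.
split=> [[bl [s sA /andP[sp ls]]]|[s [sA sp [bl ls]]]]; first by exists s.
by split=> //; exists s => //; rewrite sp.
Qed.

Lemma star_compact : compact star.
Proof.
pose F (t : {set 'I_n}) := exists2 s, s \in A & (p \in s) && (t \subset s).
have down (s t : {set 'I_n}) : F t -> s \subset t -> F s.
  move=> [s' s'A /andP[ps' ts']] st; exists s' => //.
  by rewrite ps' (fintype.subset_trans st).
exact: (bary_compact down).
Qed.

Lemma star_inj l l' : star l -> star l' -> f l = f l' -> l = l'.
Proof. by case: femb => inj _ _ sl sl'; apply: inj; rewrite inE. Qed.

Lemma star_proj l : f l *m P = f l.
Proof. exact: proj_idem. Qed.

Lemma star_subf l l' : f l - f l' = (pl_map v l - pl_map v l') *m P.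
Proof. by rewrite /star_chart -mulmxBl opprB addrA subrK. Qed.

Lemma star_inv_cont l (e : R) : star l -> 0 < e -> exists2 d : R, 0 < d &
  forall l', star l' -> enorm (f l - f l') < d -> euc_dist l l' < e.
Proof. by case: femb => _ _ ic sl e0; exact: ic. Qed.

Lemma star_common l l' : star l -> star l' -> supp l \subset supp l' ->
  exists s, [/\ s \in A, p \in s, face_pts s l & face_pts s l'].
Proof.
move=> [bl _] /star_face[s [sA sp fl']] ll'; exists s; split=> //; split=> //.
by case: fl' => _; exact: fintype.subset_trans.
Qed.

(* The star is a cone with apex [p]: shrinking towards [p] moves [l] into the
   neighbourhood of [p] covered by assumption, and the shrunk picture can be
   expanded again as long as the [p]-coordinate stays positive. *)
Lemma star_open l : star l -> 0 < l 0 p -> exists2 rho : R, 0 < rho &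
  forall t, t *m P = t -> enorm (t - f l) < rho -> exists2 l', star l' & f l' = t.
Proof.
move=> sl lp; have [r r0 hr] := fint.
have f1 : 0 < enorm (f l) + 1 by rewrite ltr_wpDl // enorm_ge0.
pose lam := Num.min 1 (r / 2 / (enorm (f l) + 1)).
have lam0 : 0 < lam by rewrite lt_min ltr01 !divr_gt0.
have lam1 : lam <= 1 by rewrite ge_min lexx.
have lamf : lam * enorm (f l) <= r / 2.
  apply: (@le_trans _ _ (lam * (enorm (f l) + 1))).
    by rewrite ler_wpM2l ?(ltW lam0) // lerDl.
  by rewrite -ler_pdivlMr // ge_min lexx orbT.
have scale (a : R) x : pl_map v (unitv R p + a *: (x - unitv R p)) - v p =
    a *: (pl_map v x - v p).
  have plD (y z : 'rV[R]_n) : pl_map v (y + z) = pl_map v y + pl_map v z.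
    by rewrite /pl_map -big_split /=; apply: eq_bigr => i _; rewrite mxE scalerDl.
  have plZ (b : R) (y : 'rV[R]_n) : pl_map v (b *: y) = b *: pl_map v y.
    by rewrite /pl_map scaler_sumr; apply: eq_bigr => i _; rewrite mxE scalerA.
  by rewrite plD plZ plD -scaleN1r plZ vert_pl_map scaleN1r addrC addKr.
have fscale (a : R) x : f (unitv R p + a *: (x - unitv R p)) = a *: f x.
  by rewrite /star_chart scale -scalemxAl.
have coord (a : R) (x : 'rV[R]_n) i : (unitv R p + a *: (x - unitv R p)) 0 i =
    (1 - a) * (i == p)%:R + a * x 0 i.
  by rewrite !mxE eqxx /=; ring.
have baryS (a : R) (x : 'rV[R]_n) : \sum_i x 0 i = 1 ->
    \sum_i (unitv R p + a *: (x - unitv R p)) 0 i = 1.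
  move=> x1; under eq_bigr do rewrite coord.
  rewrite big_split /= -!mulr_sumr x1 (bigD1 p) //= eqxx big1 ?addr0; first by rewrite /= !mulr1 subrK.
  by move=> i /negbTE ->.
have suppS (a : R) (x : 'rV[R]_n) s : p \in s -> supp x \subset s ->
    supp (unitv R p + a *: (x - unitv R p)) \subset s.
  move=> sp /fintype.subsetP xs; apply/fintype.subsetP => i; rewrite inE coord.
  have [->//|ip] := eqVneq i p; rewrite mulr0 add0r mulf_eq0 negb_or => /andP[_ xi].
  by apply: xs; rewrite inE.
pose l0 := unitv R p + lam *: (l - unitv R p).
have [s [sA sp [[l_0 l_1] ls]]] := (star_face l).1 sl.
have sl0 : star l0.
  apply/star_face; exists s; split=> //; split; last exact: suppS.
  split; last exact: baryS.
  move=> i; rewrite coord addr_ge0 ?mulr_ge0 ?subr_ge0 ?ler0n ?(ltW lam0) //.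
(* The [p]-coordinate of [l0] is [1 - lam + lam * l 0 p]. An error below [lam * l 0 p] leaves more
   than [1 - lam], which is what expansion by [1 / lam] can afford. *)
have [d d0 hd] := star_inv_cont sl0 (mulr_gt0 lam0 lp).
exists (Num.min (r / 2) d / lam); first by rewrite divr_gt0 // lt_min d0 divr_gt0.
move=> t tP; rewrite ltr_pdivlMr // lt_min => /andP[t1 t2].
have h1 : enorm (lam *: t) < r.
  have -> : lam *: t = lam *: (t - f l) + lam *: f l by rewrite -scalerDr subrK.
  apply: le_lt_trans (ler_enormD _ _) _.
  by rewrite !enormZ gtr0_norm // mulrC [r]splitr ltr_leD.
have [|l1 sl1 fl1] := hr (lam *: t) _ h1; first by rewrite -scalemxAl tP.
have h2 : euc_dist l0 l1 < lam * l 0 p.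
  apply: hd => //; rewrite fl1 fscale -scalerBr enormZ gtr0_norm // enormBC mulrC.
  exact: t2.
have l1p : 1 - lam < l1 0 p.
  have := le_lt_trans (ler_coord_enorm (l0 - l1) p) h2.
  rewrite mxE [X in _ + X]mxE coord eqxx /= mulr1 => h3.
  have := le_lt_trans (ler_norm _) h3; lra.
have [s' [s'A s'p [[l1_0 l1_1] l1s]]] := (star_face l1).1 sl1.
exists (unitv R p + lam^-1 *: (l1 - unitv R p)).
  apply/star_face; exists s'; split=> //; split; last exact: suppS.
  split; last exact: baryS.
  move=> i; rewrite coord; have [->|ip] := eqVneq i p; last first.
    by rewrite mulr0 add0r mulr_ge0 // invr_ge0 ltW.
  rewrite /= mulr1 -(ler_pM2l lam0) mulr0.
  have -> : lam * (1 - lam^-1 + lam^-1 * l1 0 p) = lam - 1 + l1 0 p.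
    by field; rewrite gt_eqF.
  lra.
by rewrite fscale fl1 scalerA mulVf ?scale1r // gt_eqF.
Qed.

Lemma star_open_supp l : star l -> 0 < l 0 p -> exists2 rho : R, 0 < rho &
  forall t, t *m P = t -> enorm (t - f l) < rho -> exists2 l', star l' &
    f l' = t /\ supp l \subset supp l'.
Proof.
move=> sl lp; have [rho rho0 h] := star_open sl lp.
have [e e0 he] := supp_nbhs l; have [d d0 hd] := star_inv_cont sl e0.
exists (Num.min rho d); first by rewrite lt_min rho0.
move=> t tP; rewrite lt_min => /andP[t1 t2].
have [l' sl' fl'] := h t tP t1; exists l' => //; split=> //.
by apply: he; apply: hd => //; rewrite fl' enormBC.
Qed.

(** A small move along [t] stays over simplices containing [l]; rescaling the displacement realizes
    [t] as the projection of a simplex direction. Tangent spaces can thus be compared through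
    simplices. *)
Lemma star_direction l t : star l -> 0 < l 0 p -> t *m P = t ->
  exists s u, [/\ s \in A, p \in s, face_pts s l, dir_space v s u & u *m P = t].
Proof.
move=> sl lp tP; have [rho rho0 h] := star_open_supp sl lp.
have t1 : 0 < enorm t + 1 by rewrite ltr_wpDl // enorm_ge0.
pose e := rho / (enorm t + 1).
have e0 : 0 < e by rewrite divr_gt0.
have [||l' sl' [fl' ll']] := h (f l + e *: t).
- by rewrite mulmxDl star_proj -scalemxAl tP.
- rewrite addrC addKr enormZ gtr0_norm // /e mulrAC ltr_pdivrMr // ltr_pM2l //.
  by rewrite ltrDl.
have [s [sA sp fl fl2]] := star_common sl sl' ll'.
exists s, (e^-1 *: (pl_map v l' - pl_map v l)); split=> //.
  by apply: dir_spaceZ; exact: face_dir.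
rewrite -scalemxAl -star_subf fl' addrC addKr scalerA mulVf ?scale1r //.
by rewrite gt_eqF.
Qed.

(* A bound valid on each simplex through [l0] integrates along the preimage in
   the star of a straight segment of the tangent plane. *)
Lemma star_chop l0 : star l0 -> 0 < l0 0 p -> exists2 r : R, 0 < r &
  forall l1 l2, star l1 -> star l2 -> enorm (f l1 - f l0) < r ->
    enorm (f l2 - f l0) < r ->
  forall k (Q : 'M[R]_(N, k)) (kappa : R), 0 <= kappa ->
    (forall s u, s \in A -> p \in s -> face_pts s l0 -> dir_space v s u ->
       enorm (u *m Q) <= kappa * enorm (u *m P)) ->
    enorm ((pl_map v l2 - pl_map v l1) *m Q) <= kappa * enorm (f l2 - f l1).
Proof.
move=> sl0 l0p; have [r r0 hr] := star_open_supp sl0 l0p; exists r => //.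
move=> l1 l2 sl1 sl2 r1 r2 k Q kappa k0 hQ.
pose w (s : R) := f l1 + s *: (f l2 - f l1).
have wP (s : R) : w s *m P = w s by rewrite mulmxDl -scalemxAl mulmxBl !star_proj.
have wr (s : R) : 0 <= s <= 1 -> enorm (w s - f l0) < r.
  move=> /andP[s0 s1].
  have -> : w s - f l0 = (1 - s) *: (f l1 - f l0) + s *: (f l2 - f l0).
    by rewrite /w; apply/rowP => i; rewrite !mxE; ring.
  apply: le_lt_trans (ler_enormD _ _) _; rewrite !enormZ !ger0_norm ?subr_ge0 //.
  have [->|sn] := eqVneq s 0; first by rewrite subr0 mul1r mul0r addr0.
  have sp : 0 < s by rewrite lt_def sn.
  have h1 : (1 - s) * enorm (f l1 - f l0) <= (1 - s) * r.
    by rewrite ler_wpM2l ?subr_ge0 // ltW.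
  have h2 : s * enorm (f l2 - f l0) < s * r by rewrite ltr_pM2l.
  lra.
(* An arbitrary choice of lift: injectivity of the chart identifies its ends, and continuity of the
   inverse chart puts nearby lifts into a common simplex. *)
pose phi (s : R) := xget 0 [set l | star l /\ f l = w s].
have phiP (s : R) : 0 <= s <= 1 ->
    [/\ star (phi s), f (phi s) = w s & supp l0 \subset supp (phi s)].
  move=> /wr hs; have [l sl [fl ll]] := hr _ (wP s) hs.
  rewrite /phi; case: xgetP => [l' _ [sl' fl']|/(_ l)]; last by case.
  by rewrite (star_inj sl' sl) ?fl'.
have phi0 : phi 0 = l1.
  have [|s1 fs _] := phiP 0; first by rewrite lexx ler01.
  by apply: star_inj => //; rewrite fs /w scale0r addr0.
have phi1 : phi 1 = l2.
  have [|s1 fs _] := phiP 1; first by rewrite lexx ler01.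
  by apply: star_inj => //; rewrite fs /w scale1r addrC subrK.
rewrite mulmxBl -phi1 -[in pl_map v l1]phi0.
apply: (@local_lipschitz_segment R k (fun s : R => pl_map v (phi s) *m Q)).
  by rewrite mulr_ge0 // enorm_ge0.
rewrite phi1; move=> s hs; have [ss fs ls] := phiP s hs.
have [e e0 he] := supp_nbhs (phi s); have [d d0 hd] := star_inv_cont ss e0.
have D1 : 0 < enorm (f l2 - f l1) + 1 by rewrite ltr_wpDl // enorm_ge0.
exists (d / (enorm (f l2 - f l1) + 1)); first by rewrite divr_gt0.
move=> s' hs' sd; have [ss' fs' ls'] := phiP s' hs'.
have ff : f (phi s) - f (phi s') = (s - s') *: (f l2 - f l1).
  by rewrite fs fs' /w opprD addrACA subrr add0r -scalerBl.
have : supp (phi s) \subset supp (phi s').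
  apply: he; apply: hd => //; rewrite ff enormZ.
  move: sd; rewrite ltr_pdivlMr // => sd; apply: le_lt_trans sd.
  by rewrite ler_wpM2l // lerDl.
move=> /(star_common ss ss')[sg [sgA sgp f1 f2]].
rewrite -(mulmxBl _ _ Q); apply: le_trans (hQ sg _ sgA sgp _ _) _.
- by split; [case: sl0|case: f1 => _; exact: fintype.subset_trans].
- exact: face_dir.
by rewrite -star_subf ff enormZ mulrA mulrAC.
Qed.

(* Within the star the [p]-coordinate has slope at most [10 / (9 a)], so it
   cannot vanish near a point where it is large. *)
Lemma star_coord_ball l t (a : R) : star l -> 0 < a ->
  (forall s, s \in A -> (2 <= #|s|)%N -> p \in s -> a <= amin v s) ->
  (forall s u, s \in A -> p \in s -> dir_space v s u ->
     enorm u <= 10 / 9 * enorm (u *m P)) ->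
  t *m P = t -> 10 / 9 * enorm (t - f l) < a * l 0 p ->
  exists l', [/\ star l', 0 < l' 0 p & f l' = t].
Proof.
move=> sl a0 ha hP tP tl; set g := enorm (t - f l) in tl.
have g0 : 0 <= g by exact: enorm_ge0.
pose w (s : R) := f l + s *: (t - f l).
have wP (s : R) : w s *m P = w s.
  by rewrite mulmxDl -scalemxAl mulmxBl tP star_proj.
have wB (s s' : R) : w s - w s' = (s - s') *: (t - f l).
  by rewrite /w opprD addrACA subrr add0r -scalerBl.
(* The invariant bounds the loss of [p]-coordinate by the length travelled; the coordinate stays
   positive, so the star is open at the lift and the lift continues. *)
pose E (s : R) := exists l', [/\ star l', f l' = w s & a * (l 0 p - l' 0 p) <= 10 / 9 * (s * g)].
have pos (s : R) l' : s <= 1 -> a * (l 0 p - l' 0 p) <= 10 / 9 * (s * g) -> 0 < l' 0 p.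
  move=> s1 h; rewrite -(pmulr_rgt0 _ a0).
  have : s * g <= g by rewrite ler_piMl.
  lra.
suff : E 1.
  case=> l' [sl' fl' h]; exists l'; split=> //; first exact: pos h.
  by rewrite fl' /w scale1r addrC subrK.
apply: real_induction.
- exists l; split=> //; first by rewrite /w scale0r addr0.
  by rewrite subrr mul0r !mulr0.
- move=> s [l' [sl' fl' h]] /andP[s0 s1].
  have [rho rho0 hr] := star_open_supp sl' (pos s l' (ltW s1) h).
  have g1 : 0 < g + 1 by rewrite ltr_wpDl.
  exists (rho / (g + 1)); first by rewrite divr_gt0.
  move=> s' /andP[ss' s'd] s'1; rewrite -ltrBlDl ltr_pdivlMr // in s'd.
  have ds : 0 < s' - s by rewrite subr_gt0.
  have [||l2 sl2 [fl2 supp2]] := hr (w s').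
  + exact: wP.
  + rewrite fl' wB enormZ gtr0_norm //; apply: le_lt_trans s'd.
    by rewrite ler_wpM2l ?(ltW ds) // lerDl.
  exists l2; split=> //.
  have [sg [sgA sgp f1 f2]] := star_common sl' sl2 supp2.
  have step : a * (l' 0 p - l2 0 p) <= 10 / 9 * ((s' - s) * g).
    have [c1|c2] := leqP #|sg| 1.
      have sgE : sg = [set p]%SET.
        by apply/eqP; rewrite eq_sym eqEcard finset.sub1set sgp cards1.
      have := face_sum f1; have := face_sum f2; rewrite sgE !big_set1 => -> ->.
      by rewrite subrr mulr0 !mulr_ge0 // ltW.
    apply: (@le_trans _ _ (amin v sg * `|l' 0 p - l2 0 p|)).
      apply: (@le_trans _ _ (a * `|l' 0 p - l2 0 p|)).
        by rewrite ler_wpM2l ?(ltW a0) // ler_norm.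
      by rewrite ler_wpM2r // ha.
    apply: le_trans (face_coord_lipschitz v f1 f2 sgp) _.
    apply: le_trans (hP sg _ sgA sgp (face_dir v f1 f2)) _.
    by rewrite -star_subf fl' fl2 wB enormZ distrC gtr0_norm.
  have -> : l 0 p - l2 0 p = (l 0 p - l' 0 p) + (l' 0 p - l2 0 p) by rewrite addrA subrK.
  rewrite mulrDr; apply: le_trans (lerD h step) _.
  by rewrite -mulrDr -mulrDl addrC subrK.
- move=> s /andP[s0 s1] cl.
  have g1 : 0 < g + 1 by rewrite ltr_wpDl.
  have near (e : R) : 0 < e -> exists (s' : R) l', [/\ s' < s, star l', f l' = w s',
      a * (l 0 p - l' 0 p) <= 10 / 9 * (s * g) & enorm (w s - f l') < e].
    move=> e0; have [s' /andP[s'1 s'2] [s'0 [l' [sl' fl' h]]]] := cl _ (divr_gt0 e0 g1).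
    exists s', l'; split=> //.
      by apply: le_trans h _; rewrite ler_pM2l ?divr_gt0 // ler_wpM2r // ltW.
    rewrite fl' wB enormZ gtr0_norm ?subr_gt0 //.
    have : (s - s') * (g + 1) < e by rewrite -ltr_pdivlMr // ltrBlDr -ltrBlDl.
    by apply: le_lt_trans; rewrite ler_wpM2l ?subr_ge0 ?(ltW s'2) // lerDl.
  (* At a left limit a lift exists by compactness of the star, and continuity of the inverse chart
     carries the coordinate bound over to it. *)
  have [|||c sc hc] := @compact_argmin R n star (fun l => euc_dist (f l) (w s)).
  + by exists l.
  + exact: star_compact.
  + by apply: cont_on_rcont; case: femb.
  have fc : f c = w s.
    apply/eqP; rewrite -euc_dist_eq0 eq_le enorm_ge0 andbT leNgt; apply/negP => gap.
    have [s' [l' [_ sl' _ _ hl']]] := near _ gap.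
    by have := hc l' sl'; rewrite leNgt euc_distC hl'.
  exists c; split=> //; rewrite leNgt; apply/negP => gap.
  pose e := (a * (l 0 p - c 0 p) - 10 / 9 * (s * g)) / a.
  have e0 : 0 < e by rewrite divr_gt0 // subr_gt0.
  have [d d0 hd] := star_inv_cont sc e0.
  have [s' [l' [_ sl' _ h hl']]] := near _ d0.
  have := hd l' sl'; rewrite fc => /(_ hl') /(le_lt_trans (ler_coord_enorm (c - l') p)).
  rewrite !mxE distrC /e ltr_pdivlMr // => /(le_lt_trans _) h2.
  have := h2 ((l' 0 p - c 0 p) * a); rewrite ler_wpM2r ?(ltW a0) ?ler_norm // => /(_ isT).
  move: h; lra.
Qed.

End Star.

(** * The projection of the complex to the manifold *)

Definition pl_cproj (R : realType) (N n : nat) (M : set 'rV[R]_N)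
    (v : 'I_n -> 'rV[R]_N) (l : 'rV[R]_n) : 'rV[R]_N :=
  cproj M (pl_map v l).

Section Close.
Variables (R : realType) (N n : nat) (M : set 'rV[R]_N) (v : 'I_n -> 'rV[R]_N).
Variables (A : {set {set 'I_n}}) (t0 mu0 eps0 : R).
(** For [w] in [M], [P w] is the projector onto the tangent space at [w]; [rr p] is a positive real
    radius below the feature size at [v p]. *)
Variables (P : 'rV[R]_N -> 'M[R]_N) (rr : 'I_n -> R).
Hypothesis vinj : injective v.
Hypothesis vM : forall i, M (v i).
Hypotheses (t0_gt0 : 0 < t0) (t0_le1 : t0 <= 1) (mu0_gt0 : 0 < mu0) (mu0_le1 : mu0 <= 1).
Hypotheses (eps0_gt0 : 0 < eps0) (eps0_small : 18 * eps0 <= t0 ^+ 2).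
Hypothesis oP : forall w, M w -> orth_proj (P w).
Hypothesis fed : forall w (rho : R) nu y, M w -> 0 <= rho -> (rho%:E <= lfs M w)%E ->
  nu *m P w = 0 -> M y -> 2 * rho * dotp nu (y - w) <= enorm nu * enorm (y - w) ^+ 2.
Hypothesis perp : forall x w, closest M x w -> (x - w) *m P w = 0.
Hypothesis rr_gt0 : forall p, 0 < rr p.
Hypothesis rr_lfs : forall p, ((rr p)%:E <= lfs M (v p))%E.
Hypothesis edges : forall s, s \in A -> (2 <= #|s|)%N -> t0 <= thick v s /\
  forall p, p \in s -> mu0 * eps0 * rr p <= Ledge v s /\ Ledge v s <= eps0 * rr p.
Implicit Types (s : {set 'I_n}) (l : 'rV[R]_n) (p q i : 'I_n) (c w y z u nu : 'rV[R]_N).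

Lemma eps0_le18 : 18 * eps0 <= t0.
Proof.
by apply: le_trans eps0_small _; rewrite expr2 ler_piMl // ltW.
Qed.

Lemma eps0_le1 : 18 * eps0 <= 1.
Proof. exact: le_trans eps0_le18 t0_le1. Qed.

(** Federer's inequality tested on the normal part of [y - w] itself: [M] leaves its tangent flat
    only quadratically. *)
Lemma fed_coproj w (rho : R) y : M w -> 0 <= rho -> (rho%:E <= lfs M w)%E -> M y ->
  2 * rho * enorm ((y - w) - (y - w) *m P w) <= enorm (y - w) ^+ 2.
Proof.
move=> Mw r0 hl My; set nu := _ - _ *m _.
have nuP : nu *m P w = 0 by rewrite mulmxBl proj_idem ?subrr //; exact: oP.
have := fed Mw r0 hl nuP My.
have -> : dotp nu (y - w) = enorm nu ^+ 2.
  rewrite enorm_sqr; transitivity (dotp nu (nu + (y - w) *m P w)).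
    by rewrite /nu subrK.
  by rewrite dotpDr (coproj_orth (oP Mw)) ?addr0.
have [->|nu0] := eqVneq (enorm nu) 0; first by rewrite mulr0 sqr_ge0.
have p : 0 < enorm nu by rewrite lt_def nu0 enorm_ge0.
by rewrite expr2 mulrCA ler_pM2l.
Qed.

(** Expand [|z - y'|^2] around [y] and bound the cross term by Federer's inequality; after
    multiplication by [rho] the surplus [(rho - |z - y|) |y' - y|^2] remains, positive unless
    [y' = y]. *)
Lemma close_closest y z (rho : R) : M y -> (rho%:E <= lfs M y)%E ->
  (z - y) *m P y = 0 -> euc_dist z y < rho ->
  closest M z y /\ forall y', closest M z y' -> y' = y.
Proof.
move=> My hl zy zr.
have r0 : 0 < rho by apply: le_lt_trans zr; exact: enorm_ge0.
have key y' : M y' -> rho * euc_dist z y' ^+ 2 >=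
    rho * euc_dist z y ^+ 2 + (rho - euc_dist z y) * enorm (y' - y) ^+ 2.
  move=> My'; have := fed My (ltW r0) hl zy My'.
  rewrite /euc_dist; have -> : z - y' = (z - y) - (y' - y) by rewrite opprB addrA subrK.
  rewrite (enormB_sqr (z - y)); lra.
split.
  split=> // y' My'; rewrite -(@ler_pXn2r _ 2) ?nnegrE ?enorm_ge0 //.
  rewrite -(ler_pM2l r0); apply: le_trans (key _ My').
  by rewrite lerDl mulr_ge0 ?sqr_ge0 // subr_ge0 ltW.
move=> y' [My' h]; have := key _ My'.
have : rho * euc_dist z y' ^+ 2 <= rho * euc_dist z y ^+ 2.
  by rewrite ler_pM2l // lerXn2r ?nnegrE ?enorm_ge0 // h.
move=> /[swap] h1 /(le_trans h1); rewrite gerDl => h2.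
apply/eqP; rewrite -subr_eq0 -enorm_eq0 -sqrf_eq0 eq_le sqr_ge0 andbT.
by move: h2; rewrite pmulr_rle0 // subr_gt0.
Qed.

Lemma star_near s p l : s \in A -> p \in s -> face_pts s l ->
  euc_dist (pl_map v l) (v p) <= eps0 * rr p.
Proof.
move=> sA sp fl; apply: face_norm_le fl _ => i si.
have [s1|s2] := leqP #|s| 1.
  have /card_le1P/(_ p sp)/(_ i) := s1.
  rewrite si inE => /esym/eqP ->; rewrite subrr enorm0.
  by rewrite mulr_ge0 // ltW.
have [_ /(_ p sp)[_ h]] := edges sA s2.
by apply: le_trans h; exact: (Ledge_ge v si sp).
Qed.

Lemma simplex_close s p l c : s \in A -> (2 <= #|s|)%N -> p \in s -> face_pts s l ->
  closest M (pl_map v l) c ->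
  [/\ forall i, i \in s -> enorm (v i - c) <= 9 / 8 * Ledge v s,
      euc_dist (pl_map v l) c <= Ledge v s / 8 &
      euc_dist (pl_map v l) c * rr p <= 7 / 10 * Ledge v s ^+ 2].
Proof.
have aux1 (L e r a : R) : L <= e * r -> 18 * e <= 1 -> 0 < r -> 0 < L -> 0 <= a ->
    2 * (r - 2 * L) * a <= (2 * L) ^+ 2 -> a <= L / 8.
  move=> h1 h2 r0 L0 a0 h3.
  have h4 : 18 * L <= r by nra.
  have h5 : 32 * L <= 2 * (r - 2 * L) by lra.
  have : 32 * L * a <= (2 * L) ^+ 2.
    by apply: le_trans h3; rewrite ler_wpM2r.
  rewrite exprMn expr2 [X in _ <= _ * X]expr2 => h6.
  rewrite -(ler_pM2l L0); lra.
have aux2 (L e r a : R) : L <= e * r -> 18 * e <= 1 -> 0 < r -> 0 < L -> 0 <= a ->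
    2 * (r - 9 / 8 * L) * a <= (9 / 8 * L) ^+ 2 -> a * r <= 7 / 10 * L ^+ 2.
  move=> h1 h2 r0 L0 a0 h3.
  have h4 : 18 * L <= r by nra.
  have h5 : 15 / 8 * r <= 2 * (r - 9 / 8 * L) by lra.
  have : 15 / 8 * r * a <= (9 / 8 * L) ^+ 2.
    by apply: le_trans h3; rewrite ler_wpM2r.
  rewrite exprMn; have := sqr_ge0 L; lra.
move=> sA s2 sp fl hc; have [ht /(_ p sp)[_ hL]] := edges sA s2.
have L0 := Ledge_gt0 vinj s2.
set x := pl_map v l in hc *; set L := Ledge v s in hL L0 *.
have xv i : i \in s -> euc_dist x (v i) <= L.
  by move=> si; apply: face_norm_le fl _ => k sk; exact: Ledge_ge.
have xc i : i \in s -> euc_dist x c <= L.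
  by move=> si; apply: le_trans (xv i si); case: hc => _; apply.
have Mc : M c by case: hc.
have nc := perp hc.
(* [x - c] is normal at [c] and an average of the chords [v i - c]. *)
have bound b : 0 <= rr p - b -> (forall i, i \in s -> enorm (v i - c) <= b) ->
    2 * (rr p - b) * euc_dist x c <= b ^+ 2.
  move=> rb hb; have hl := lfs_ge_dist c (rr_lfs p).
  have hl' : ((rr p - b)%:E <= lfs M c)%E.
    by apply: le_trans hl; rewrite lee_fin lerD2l lerN2; exact: hb.
  have [->|n0] := eqVneq (euc_dist x c) 0; first by rewrite mulr0 sqr_ge0.
  have np : 0 < euc_dist x c by rewrite lt_def n0 enorm_ge0.
  rewrite -(ler_pM2l np).
  have -> : euc_dist x c * (2 * (rr p - b) * euc_dist x c) =
      2 * (rr p - b) * dotp (x - c) (\sum_(i in s) l 0 i *: (v i - c)).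
    by rewrite -(face_pl_map_sub v _ fl) -enorm_sqr /euc_dist -/x; ring.
  rewrite dotp_sumr mulr_sumr.
  apply: (@le_trans _ _ (\sum_(i in s) l 0 i * (euc_dist x c * b ^+ 2))); last first.
    by rewrite -mulr_suml (face_sum fl) mul1r.
  apply: ler_sum => i si; rewrite dotpZr mulrCA ler_wpM2l //.
    by case: fl => -[].
  apply: le_trans (fed Mc rb hl' nc (vM i)) _.
  by rewrite ler_wpM2l ?enorm_ge0 // lerXn2r ?nnegrE ?enorm_ge0 ?hb // (le_trans _ (hb p sp)) ?enorm_ge0.
have e18 := eps0_le1.
have rp := rr_gt0 p.
have L18 : 18 * L <= rr p by nra.
have vc i : i \in s -> enorm (v i - c) <= L + euc_dist x c.
  move=> si; rewrite (le_trans (ler_enorm_tri _ x _)) // lerD2r enormBC.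
  exact: xv.
have d8 : euc_dist x c <= L / 8.
  apply: (aux1 L eps0 (rr p)) => //; first exact: enorm_ge0.
  apply: bound => [|i si]; first by rewrite subr_ge0; nra.
  by apply: le_trans (vc i si) _; have := xc i si; lra.
have v98 i : i \in s -> enorm (v i - c) <= 9 / 8 * L.
  by move=> si; apply: le_trans (vc i si) _; lra.
split=> //; apply: (aux2 L eps0 (rr p)) => //; first exact: enorm_ge0.
by apply: bound => //; rewrite subr_ge0; nra.
Qed.

(** [y] may differ from [c] because later arguments fix one tangent space for a whole neighbourhood.
    The tolerance is at most [L / 8], so [|v i - y| <= 5 / 4 L]. By Federer the chords [v i - y]
    have normal part at most [7 / 8 eps0 L], edges at most twice that, and Whitney's bound divides
    by [t0 L]. *)
Lemma simplex_angle s p l c y u : s \in A -> p \in s -> face_pts s l ->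
  closest M (pl_map v l) c -> M y -> euc_dist c y <= mu0 * eps0 * rr p / 8 ->
  dir_space v s u ->
  t0 * enorm (u - u *m P y) <= 7 / 4 * eps0 * enorm u.
Proof.
have aux (L e r a : R) : L <= e * r -> 18 * e <= 1 -> 0 < r -> 0 < L -> 0 <= a ->
    2 * (r - 5 / 4 * L) * a <= (5 / 4 * L) ^+ 2 -> a <= 7 / 8 * e * L.
  move=> h1 h2 r0 L0 a0 h3.
  have h4 : 18 * L <= r by nra.
  have h5 : 67 / 36 * r <= 2 * (r - 5 / 4 * L) by lra.
  have h6 : 67 / 36 * r * a <= (5 / 4 * L) ^+ 2.
    by apply: le_trans h3; rewrite ler_wpM2r.
  have h7 : L ^+ 2 <= L * (e * r) by rewrite expr2 ler_pM2l.
  rewrite -(ler_pM2l r0); move: h6; rewrite exprMn.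
  have : 0 <= r * (e * L) by nra.
  lra.
move=> sA sp fl hc My cy du.
have [s1|s2] := leqP #|s| 1.
  have -> : u = 0.
    case: du => k /= k0 <-; apply: big1 => i si.
    have /card_le1P/(_ i si) h := s1.
    move: k0; rewrite (big_setD1 i) //= big1 ?addr0; first by move=> ->; rewrite scale0r.
    by move=> j; rewrite !inE (h j) inE => /andP[/negbTE ->].
  by rewrite mul0mx subrr enorm0 !mulr0.
have [ht hpL] := edges sA s2; have [hmu hL] := hpL p sp.
have [vc xc _] := simplex_close sA s2 sp fl hc.
have L0 := Ledge_gt0 vinj s2.
set L := Ledge v s in hL L0 hmu vc xc *.
have rp := rr_gt0 p; have e18 := eps0_le1.
have L18 : 18 * L <= rr p by nra.
have vy i : i \in s -> enorm (v i - y) <= 5 / 4 * L.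
  move=> si; rewrite (le_trans (ler_enorm_tri _ c _)) //.
  by have := vc i si; move: cy; rewrite /euc_dist; lra.
have hl : ((rr p - 5 / 4 * L)%:E <= lfs M y)%E.
  apply: le_trans (lfs_ge_dist y (rr_lfs p)); rewrite lee_fin lerD2l lerN2.
  exact: vy.
have r0 : 0 <= rr p - 5 / 4 * L by lra.
have one i : i \in s -> enorm ((v i - y) - (v i - y) *m P y) <= 7 / 8 * eps0 * L.
  move=> si; apply: (aux L eps0 (rr p)) => //; first exact: enorm_ge0.
  apply: le_trans (fed_coproj My r0 hl (vM i)) _.
  by rewrite lerXn2r ?nnegrE ?enorm_ge0 ?vy // mulr_ge0 // ltW.
have two i : i \in s -> enorm ((v i - v p) *m (1%:M - P y)) <= 7 / 4 * eps0 * L.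
  move=> si; have -> : v i - v p = (v i - y) - (v p - y) by rewrite opprB addrA subrK.
  rewrite mulmxBl !mulmxBr !mulmx1 (le_trans (ler_enormB _ _)) //.
  by have := lerD (one i si) (one p sp); lra.
have := whitney_angle vinj s2 t0_gt0 ht sp two du.
rewrite mulmxBr mulmx1 -/L => h.
by rewrite -(ler_pM2l L0); lra.
Qed.

(** With [18 eps0 <= t0] the ratio [7 / 4 eps0 / t0] is at most [7 / 72]. *)
Lemma simplex_angle10 s p l c y u : s \in A -> p \in s -> face_pts s l ->
  closest M (pl_map v l) c -> M y -> euc_dist c y <= mu0 * eps0 * rr p / 8 ->
  dir_space v s u -> enorm (u - u *m P y) <= enorm u / 10.
Proof.
move=> sA sp fl hc My cy du; have h2 := simplex_angle sA sp fl hc My cy du.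
have h1 := eps0_le18; have u0 := enorm_ge0 u.
rewrite -(ler_pM2l t0_gt0); apply: le_trans h2 _.
have : 18 * eps0 * enorm u <= t0 * enorm u by rewrite ler_wpM2r.
have : 0 <= t0 * enorm u by rewrite mulr_ge0 // ltW.
lra.
Qed.

Lemma vertex_closest p : closest M (v p) (v p).
Proof. by split=> // z _; rewrite euc_distxx enorm_ge0. Qed.

Lemma vertex_angle10 s p u : s \in A -> p \in s -> dir_space v s u ->
  enorm (u - u *m P (v p)) <= enorm u / 10.
Proof.
move=> sA sp; have fp := vert_face R sp.
apply: (simplex_angle10 sA sp fp) => //; first by rewrite vert_pl_map; exact: vertex_closest.
by rewrite euc_distxx !mulr_ge0 ?invr_ge0 ?(ltW mu0_gt0) ?(ltW eps0_gt0) ?(ltW (rr_gt0 p)).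
Qed.

Lemma vertex_proj_le s p u : s \in A -> p \in s -> dir_space v s u ->
  enorm u <= 10 / 9 * enorm (u *m P (v p)).
Proof.
move=> sA sp du; have := vertex_angle10 sA sp du.
have : enorm u <= enorm (u *m P (v p)) + enorm (u - u *m P (v p)).
  by rewrite (le_trans _ (ler_enormD _ _)) // addrC subrK.
lra.
Qed.


(** * The projected complex: openness, surjectivity, injectivity *)

Variable m : nat.
Hypothesis cM : compact M.
Hypothesis Acx : simplicial_complex A.
Hypothesis rkP : forall w, M w -> \rank (P w) = m.
Hypothesis tcont : forall w nu, M w -> nu *m P w = 0 -> forall e : R, 0 < e ->
  exists2 d : R, 0 < d & forall y, M y -> euc_dist w y < d -> enorm (nu *m P y) <= e.
Hypothesis eps0_sq : 324 * eps0 ^+ 2 <= mu0 * t0 ^+ 4.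

Local Notation f p := (star_chart v p (P (v p))).

Hypothesis femb : forall p, embedding_on (star_pts A p) (f p).
Hypothesis iinj : forall p l l', star_pts A p l -> star_pts A p l' ->
  pl_map v l = pl_map v l' -> l = l'.
Hypothesis fint : forall p, exists2 r : R, 0 < r &
  forall t, t *m P (v p) = t -> enorm t < r -> exists2 l, star_pts A p l & f p l = t.
Hypothesis sanity : forall p q, euc_dist (v q) (v p) < rr p / 15 ->
  (exists2 l, star_pts A p l & f p l = (v q - v p) *m P (v p)) -> star_vertex A p q.

Local Notation H := (pl_cproj M v).

Let oPv p : orth_proj (P (v p)) := oP (vM p).

Lemma vert_in p : [set p]%SET \in A.
Proof. by case: Acx. Qed.

Lemma realization_star p l : realization A l -> 0 < l 0 p -> star_pts A p l.
Proof.
move=> [bl sA] lp; split=> //; exists (supp l) => //.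
by rewrite inE gt_eqF //= fintype.subxx.
Qed.

Lemma star_realization p l : star_pts A p l -> realization A l.
Proof.
case=> bl [s sA /andP[_ ls]]; split=> //.
by case: Acx => _ _ down; apply: (down s) => //; exact: bary_supp_neq0.
Qed.

Lemma realization_vertex l : realization A l -> exists p, 0 < l 0 p.
Proof.
case=> bl _; have /card_gt0P[p] := bary_supp_neq0 bl.
by rewrite inE => /(bary_gt0 bl) lp; exists p.
Qed.

Lemma realization_star_nbhs p l : realization A l -> 0 < l 0 p ->
  exists2 d : R, 0 < d & forall l', realization A l' -> euc_dist l l' < d ->
    star_pts A p l'.
Proof.
move=> rl lp; have [d d0 hd] := supp_nbhs l; exists d => // l' rl' /hd ss.
have : p \in supp l' by apply: (fintype.subsetP ss); rewrite inE gt_eqF.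
by rewrite inE => /(bary_gt0 rl'.1); exact: realization_star.
Qed.

Lemma realization_compact : compact (realization (R := R) A).
Proof.
(* The empty support, which no barycentric vector has, is added to make the family closed under
   subsets. *)
have -> : realization (R := R) A = [set l | bary l /\ (supp l = finset.set0 \/ supp l \in A)].
  apply/seteqP; split=> l [bl hl]; split=> //; first by right.
  case: hl => // s0; have := bary_supp_neq0 bl.
  by rewrite s0 cards0.
apply: (bary_compact (F := fun s => s = finset.set0 \/ s \in A)) => s t ht st.
case: (eqVneq s finset.set0) => [->|s0]; first by left.
right; case: ht => [t0'|tA].
  by move: st s0; rewrite t0' finset.subset0 => ->.
by case: Acx => _ _ down; apply: (down t) => //; rewrite card_gt0.
Qed.

(** As [eps0 <= 1 / 18], the point is within [rr p / 18] of [v p] and [c] within [rr p / 9]; so the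
    feature size at [c] exceeds the distance to [c], and [close_closest] applies. *)
Lemma proj_unique p l c : star_pts A p l -> closest M (pl_map v l) c ->
  [/\ ((8 / 9 * rr p)%:E <= lfs M c)%E, euc_dist (pl_map v l) c <= rr p / 18,
      euc_dist (v p) c <= rr p / 9 &
      forall c', closest M (pl_map v l) c' -> c' = c].
Proof.
move=> /(star_face)[s [sA sp fl]] hc; have [Mc hmin] := hc.
have e18 := eps0_le1; have rp := rr_gt0 p.
have h1 : euc_dist (pl_map v l) (v p) <= rr p / 18.
  by apply: le_trans (star_near sA sp fl) _; nra.
have h2 : euc_dist (pl_map v l) c <= rr p / 18 by apply: le_trans (hmin _ (vM p)) h1.
have h3 : euc_dist (v p) c <= rr p / 9.
  apply: le_trans (ler_enorm_tri _ (pl_map v l) _) _.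
  rewrite -/(euc_dist _ _) -/(euc_dist _ _) euc_distC; lra.
have h4 : ((8 / 9 * rr p)%:E <= lfs M c)%E.
  by apply: le_trans (lfs_ge_dist c (rr_lfs p)); rewrite lee_fin; lra.
split=> //; have [|_ //] := close_closest Mc h4 (perp hc).
lra.
Qed.

Lemma H_closest l : realization A l -> closest M (pl_map v l) (H l).
Proof.
move=> /realization_vertex[p _]; apply: closest_cproj => //.
by exists (v p).
Qed.

Lemma H_in l : realization A l -> M (H l).
Proof. by move=> /H_closest[]. Qed.

Lemma H_uniq l c : realization A l -> closest M (pl_map v l) c -> H l = c.
Proof.
move=> rl hc; have [p lp] := realization_vertex rl.
have [_ _ _ uq] := proj_unique (realization_star rl lp) hc.
by apply: uq; exact: H_closest.
Qed.

Lemma H_cont : cont_on (realization A) H.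
Proof.
move=> l rl e e0.
have uq c : closest M (pl_map v l) c -> c = H l by move=> /(H_uniq rl) ->.
have [d d0 hd] := closest_continuity cM (H_closest rl) uq e0.
have [d' d'0 hd'] := @pl_map_cont R n N v (realization A) l rl d d0.
exists d' => // l' rl' ll'; apply: (hd (pl_map v l')); last exact: H_closest.
exact: hd'.
Qed.

(** [1 / 9] is [1 / 10] times [10 / 9]: the normal part of [u] relative to [u], then [u] relative to
    its projection at [v p]. *)
Lemma local_angle p l y s u : realization A l -> 0 < l 0 p -> M y ->
  euc_dist (H l) y <= mu0 * eps0 * rr p / 8 ->
  s \in A -> p \in s -> face_pts s l -> dir_space v s u ->
  enorm (u *m (1%:M - P y)) <= 9^-1 * enorm (u *m P (v p)).
Proof.
move=> rl lp My hy sA sp fl du.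
have := simplex_angle10 sA sp fl (H_closest rl) My hy du.
have := vertex_proj_le sA sp du; rewrite mulmxBr mulmx1; lra.
Qed.

Lemma local_angle_vertex p l s u : realization A l -> 0 < l 0 p ->
  s \in A -> p \in s -> face_pts s l -> dir_space v s u ->
  enorm (u *m (1%:M - P (v p))) <= 9^-1 * enorm (u *m P (v p)).
Proof.
move=> rl lp sA sp fl du; have := vertex_angle10 sA sp du.
have := vertex_proj_le sA sp du; rewrite mulmxBr mulmx1; lra.
Qed.

(** The two tangent spaces are compared through a simplex: [t] is the projection of a simplex
    direction [u], which is nearly tangent both at [v p] and at [y]. The constant is
    [2 * 7 / 4 * 10 / 9]. *)
Lemma tangent_variation p l y t : realization A l -> 0 < l 0 p -> M y ->
  euc_dist (H l) y <= mu0 * eps0 * rr p / 8 -> t *m P (v p) = t ->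
  t0 * enorm (t - t *m P y) <= 35 / 9 * eps0 * enorm t.
Proof.
move=> rl lp My hy tP.
have [s [u [sA sp fl du ut]]] := star_direction (oPv p) (femb p) (fint p)
  (realization_star rl lp) lp tP.
have h1 := simplex_angle sA sp fl (H_closest rl) My hy du.
have h2 : t0 * enorm (u - t) <= 7 / 4 * eps0 * enorm u.
  rewrite -ut; apply: (simplex_angle sA sp (vert_face R sp)) => //.
    by rewrite vert_pl_map; exact: vertex_closest.
  by rewrite euc_distxx !mulr_ge0 ?invr_ge0 ?(ltW mu0_gt0) ?(ltW eps0_gt0) ?(ltW (rr_gt0 p)).
have h3 := vertex_proj_le sA sp du; rewrite ut in h3.
have -> : t - t *m P y = (u - u *m P y) - ((u - t) - (u - t) *m P y).
  by rewrite mulmxBl; apply/rowP => i; rewrite !mxE; ring.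
have h4 : enorm (u - u *m P y - (u - t - (u - t) *m P y)) <=
    enorm (u - u *m P y) + enorm (u - t).
  by apply: le_trans (ler_enormB _ _) _; rewrite lerD2l; exact: (ler_enorm_coproj (oP My)).
apply: (@le_trans _ _ (t0 * (enorm (u - u *m P y) + enorm (u - t)))).
  by rewrite ler_wpM2l // ltW.
have : eps0 * enorm u <= eps0 * (10 / 9 * enorm t) by rewrite ler_wpM2l // ltW.
lra.
Qed.

Lemma tangent_variation29 p l y t : realization A l -> 0 < l 0 p -> M y ->
  euc_dist (H l) y <= mu0 * eps0 * rr p / 8 -> t *m P (v p) = t ->
  enorm (t - t *m P y) <= 2 / 9 * enorm t.
Proof.
move=> rl lp My hy tP; have h := tangent_variation rl lp My hy tP.
rewrite -(ler_pM2l t0_gt0); apply: le_trans h _.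
have t_ge0 := enorm_ge0 t.
have : 18 * eps0 * enorm t <= t0 * enorm t by rewrite ler_wpM2r // eps0_le18.
have : 0 <= t0 * enorm t by rewrite mulr_ge0 // ltW.
lra.
Qed.

Lemma star_chart_cont p l (e : R) : star_pts A p l -> 0 < e -> exists2 d : R, 0 < d &
  forall l', star_pts A p l' -> euc_dist l l' < d -> enorm (f p l' - f p l) < e.
Proof.
move=> sl e0; have [_ cf _] := femb p; have [d d0 hd] := cf l sl e e0.
by exists d => // l' sl' /(hd _ sl'); rewrite enormBC.
Qed.

Lemma near_gt0 p : 0 < mu0 * eps0 * rr p / 8.
Proof. by rewrite divr_gt0 // !mulr_gt0. Qed.

(* Two points of the complex with the same projection [y] differ by a vector
   normal at [y], but secants of the star are almost tangent at [y]. *)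
Lemma H_locally_injective l : realization A l -> exists2 d : R, 0 < d &
  forall l1 l2, realization A l1 -> realization A l2 -> euc_dist l l1 < d ->
    euc_dist l l2 < d -> H l1 = H l2 -> l1 = l2.
Proof.
move=> rl; have [p lp] := realization_vertex rl; have sl := realization_star rl lp.
have [r r0 hr] := star_chop (oPv p) (femb p) (fint p) sl lp.
have [d1 d10 hd1] := star_chart_cont sl r0.
have [d2 d20 hd2] := H_cont rl (near_gt0 p).
have [d3 d30 hd3] := realization_star_nbhs rl lp.
exists (Num.min d1 (Num.min d2 d3)); first by rewrite !lt_min d10 d20.
move=> l1 l2 rl1 rl2; rewrite !lt_min => /and3P[a1 a2 a3] /and3P[b1 b2 b3] eH.
have sl1 := hd3 _ rl1 a3; have sl2 := hd3 _ rl2 b3.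
set y := H l1 in eH; have My : M y by exact: H_in.
have n1 : (pl_map v l1 - y) *m P y = 0 by apply: perp; exact: H_closest.
have n2 : (pl_map v l2 - y) *m P y = 0 by rewrite eH; apply: perp; exact: H_closest.
have := hr l1 l2 sl1 sl2 (hd1 _ sl1 a1) (hd1 _ sl2 b1) N (1%:M - P y) 9^-1.
rewrite invr_ge0 ler0n => /(_ isT) h.
have {}h : enorm ((pl_map v l2 - pl_map v l1) *m (1%:M - P y)) <=
    9^-1 * enorm (f p l2 - f p l1).
  apply: h => s u sA sp fl du; apply: (local_angle rl lp My _ sA sp fl du).
  by apply: ltW; exact: hd2.
move: h; set u := pl_map v l2 - pl_map v l1.
have uP : u *m P y = 0.
  have -> : u = (pl_map v l2 - y) - (pl_map v l1 - y) by rewrite opprB addrA subrK.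
  by rewrite mulmxBl n1 n2 subrr.
(* As [u] is normal at [y], the secant bound says that [|u|] is at most a ninth of its own
   projection at [v p], which forces [u = 0]. *)
rewrite mulmxBr mulmx1 uP subr0 star_subf -/u => h.
have := ler_enorm_proj (oPv p) u => h'.
have : enorm u = 0 by have := enorm_ge0 u; lra.
move/eqP; rewrite enorm_eq0 subr_eq0 => /eqP e21.
by apply: (iinj sl1 sl2).
Qed.

(* To hit [y], minimize the tangential defect [|P_y (x - y)|] over a piece of the
   star: an interior minimizer has zero defect because the star can be moved in
   every direction of [T_p], and [P_y] maps [T_p] onto [T_y]. *)
Lemma H_open l (e : R) : realization A l -> 0 < e -> exists2 d : R, 0 < d &
  forall y, M y -> euc_dist (H l) y < d ->
    exists l', [/\ realization A l', euc_dist l l' < e & H l' = y].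
Proof.
have aux1 (a b g r : R) : 8 / 9 * r <= a -> a <= b + g -> g < r / 4 -> b <= g ->
  0 < r -> False by lra.
have aux2 (a b t w s : R) : a <= 9^-1 * (s * t) -> s * t <= s * (9 / 7 * w) ->
  0 < s * w -> (1 - s) * w + a < w by lra.
move=> rl e0; have [p lp] := realization_vertex rl; have sl := realization_star rl lp.
have [r1 r10 hr1] := star_chop (oPv p) (femb p) (fint p) sl lp.
have [r2 r20 hr2] := star_open (femb p) (fint p) sl lp.
have [r3 r30 hr3] := star_inv_cont (femb p) sl e0.
have [r [r0 rr1 rr2 rr3]] : exists r : R, [/\ 0 < r, r < r1, r < r2 & r < r3].
  exists (Num.min r1 (Num.min r2 r3) / 2).
  have m0 : 0 < Num.min r1 (Num.min r2 r3) by rewrite !lt_min r10 r20.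
  have : Num.min r1 (Num.min r2 r3) / 2 < Num.min r1 (Num.min r2 r3).
    by rewrite ltr_pdivrMr // ltr_pMr // ltr1n.
  by rewrite divr_gt0 // !lt_min => /and3P[].
set x := pl_map v l; set c := H l.
have hc : closest M x c by exact: H_closest.
have Mc : M c by case: hc.
have r80 : 0 < r / 8 by rewrite divr_gt0.
have [d1 d10 hd1] := tcont Mc (perp hc) r80.
exists (Num.min (mu0 * eps0 * rr p / 8) (Num.min d1 (r / 8))).
  by rewrite !lt_min near_gt0 d10.
move=> y My; rewrite !lt_min => /and3P[y1 y2 y3].
pose K := star_pts A p `&` [set l' | euc_dist (f p l') (f p l) <= r].
pose h l' := euc_dist (pl_map v l' *m P y) (y *m P y).
have hE l' : h l' = enorm ((pl_map v l' - y) *m P y) by rewrite mulmxBl.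
have Kl : K l by split=> //=; rewrite euc_distxx ltW.
have cK : compact K.
  apply: compact_sublevel; first exact: star_compact.
  by apply: cont_on_rcont; case: (femb p).
have ch : rcont_on K h.
  apply: (cont_on_rcont (f := fun l' => pl_map v l' *m P y)) => l' _ a a0.
  have [d d0 hd] := @pl_map_cont R n N v setT l' I a a0.
  exists d => // l2 _ ll2; rewrite /euc_dist -mulmxBl.
  apply: le_lt_trans (ler_enorm_proj (oP My) _) _; exact: hd.
have [z [sz /= zr] hz] := compact_argmin (ex_intro _ l Kl) cK ch.
have oPy := oP My.
(* One [r / 8] because [x - c], normal at [c], is almost normal at [y]; the other bounds [c - y]. *)
have hl4 : h l < r / 4.
  rewrite hE; have -> : pl_map v l - y = (x - c) + (c - y) by rewrite addrA subrK.
  rewrite mulmxDl; apply: le_lt_trans (ler_enormD _ _) _.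
  have e1 := hd1 y My y2.
  have e2 : enorm ((c - y) *m P y) < r / 8.
    by apply: le_lt_trans (ler_enorm_proj oPy _) y3.
  have -> : r / 4 = r / 8 + r / 8 by field.
  exact: ler_ltD.
have angle l1 l2 : K l1 -> K l2 ->
    enorm ((pl_map v l2 - pl_map v l1) *m (1%:M - P y)) <= 9^-1 * enorm (f p l2 - f p l1) /\
    enorm ((pl_map v l2 - pl_map v l1) *m (1%:M - P (v p))) <= 9^-1 * enorm (f p l2 - f p l1).
  move=> [s1 k1] [s2 k2].
  have n90 : 0 <= 9^-1 :> R by rewrite invr_ge0 ler0n.
  have q1 := le_lt_trans k1 rr1; have q2 := le_lt_trans k2 rr1.
  split; apply: (hr1 l1 l2 s1 s2 q1 q2) => // s u sA sp fl du.
    by apply: (local_angle rl lp My _ sA sp fl du); exact: ltW.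
  exact: (local_angle_vertex rl lp sA sp fl du).
(* On the rim the secant from [l] has length at least [r], hence a component of at least [8 / 9 r]
   tangent at [y]; two defects below [r / 4] allow less than [r / 2]. *)
have inside : euc_dist (f p z) (f p l) < r.
  rewrite lt_neqAle zr andbT; apply/negP => /eqP zE.
  have [az _] := angle l z Kl (conj sz zr).
  have b := hz l Kl; rewrite !hE in b.
  move: az; rewrite mulmxBr mulmx1 -/(euc_dist _ _) zE.
  set u := pl_map v z - pl_map v l => az.
  have ru : r <= enorm u.
    by rewrite -zE /euc_dist star_subf -/u; exact: (ler_enorm_proj (oPv p)).
  have uP : 8 / 9 * r <= enorm (u *m P y).
    have : enorm u <= enorm (u *m P y) + euc_dist u (u *m P y).
      by apply: le_trans (ler_enormD _ _); rewrite addrC subrK.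
    by move: az; rewrite /euc_dist; lra.
  apply: (aux1 _ _ _ _ uP _ hl4 _ r0); last exact: hz.
  rewrite !hE; have -> : u = (pl_map v z - y) - (pl_map v l - y).
    by rewrite opprB addrA subrK.
  by rewrite mulmxBl; exact: ler_enormB.
pose w := (pl_map v z - y) *m P y.
have hw : h z = enorm w by rewrite hE.
have w0 : w = 0.
  apply/eqP; apply: contraT => wn0.
  have wp : 0 < enorm w by rewrite enorm_gt0.
  (* The step [s *: t] cancels the fraction [s] of the defect [w]. Lifting it to the star costs at
     most [9^-1 * (9 / 7) * s |w|], so the defect would drop below its minimum. *)
  have [|||t tP tw] := @proj_onto R N (P (v p)) (P y) oPy _ (oPv p).2 _ (- w).
  - by rewrite !rkP.
  - move=> t tP ty; have := tangent_variation29 rl lp My (ltW y1) tP.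
    rewrite ty subr0 => h29; apply/eqP; rewrite -enorm_eq0.
    by rewrite eq_le enorm_ge0 andbT; lra.
  - by rewrite mulNmx proj_idem.
  have t97 : enorm t <= 9 / 7 * enorm w.
    have := tangent_variation29 rl lp My (ltW y1) tP; rewrite tw opprK => h29.
    have : enorm t <= enorm (t + w) + enorm w.
      by apply: le_trans (ler_enormB _ _); rewrite addrK.
    lra.
  have t1 : 0 < enorm t + 1 by rewrite ltr_wpDl // enorm_ge0.
  have gap : 0 < r - euc_dist (f p z) (f p l) by rewrite subr_gt0.
  have [s [s0 s1 st]] : exists s : R, [/\ 0 < s, s <= 1 &
      s * enorm t < r - euc_dist (f p z) (f p l)].
    exists (Num.min 1 ((r - euc_dist (f p z) (f p l)) / (enorm t + 1))).
    rewrite lt_min ltr01 divr_gt0 // ge_min lexx; split=> //.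
    have sg : Num.min 1 ((r - euc_dist (f p z) (f p l)) / (enorm t + 1)) *
      (enorm t + 1) <= r - euc_dist (f p z) (f p l).
      by rewrite -ler_pdivlMr // ge_min lexx orbT.
    apply: lt_le_trans sg; rewrite mulrDr mulr1 ltrDl.
    by rewrite lt_min ltr01 divr_gt0.
  have fr : euc_dist (f p z + s *: t) (f p l) < r.
    rewrite /euc_dist addrAC; apply: le_lt_trans (ler_enormD _ _) _.
    by rewrite enormZ gtr0_norm // -ltrBrDl.
  have [||l2 sl2 fl2] := hr2 (f p z + s *: t).
  - by rewrite mulmxDl star_proj // -scalemxAl tP.
  - exact: lt_trans fr rr2.
  have K2 : K l2 by split=> //=; rewrite fl2 ltW.
  have [_ az] := angle z l2 (conj sz zr) K2.
  have ff : f p l2 - f p z = s *: t by rewrite fl2 addrC addKr.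
  have fu : (pl_map v l2 - pl_map v z) *m P (v p) = s *: t by rewrite -ff star_subf.
  move: az; rewrite ff mulmxBr mulmx1 fu enormZ gtr0_norm //.
  set u := pl_map v l2 - pl_map v z => az.
  have := hz l2 K2; rewrite hw hE.
  have -> : (pl_map v l2 - y) *m P y = (1 - s) *: w + (u - s *: t) *m P y.
    have -> : pl_map v l2 - y = (pl_map v z - y) + u.
      by rewrite /u [RHS]addrC addrA subrK.
    rewrite mulmxDl -/w [in RHS]mulmxBl -scalemxAl tw scalerN opprK.
    by rewrite scalerBl scale1r [RHS]addrACA addNr addr0.
  rewrite leNgt => /negP; case.
  apply: le_lt_trans (ler_enormD _ _) _; rewrite enormZ ger0_norm ?subr_ge0 //.
  have h5 : enorm ((u - s *: t) *m P y) <= 9^-1 * (s * enorm t).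
    exact: le_trans (ler_enorm_proj oPy _) az.
  have h6 : s * enorm t <= s * (9 / 7 * enorm w) by rewrite ler_pM2l.
  have h7 : 0 < s * enorm w by rewrite mulr_gt0.
  by apply: aux2 h5 h6 h7.
exists z; split.
- exact: star_realization sz.
- by apply: hr3 => //; rewrite enormBC; exact: le_lt_trans zr rr3.
(* Zero defect means that [pl_map v z - y] is normal at [y]; its length is below the radius
   available there, so [y] is the closest point. *)
- apply: H_uniq; first exact: star_realization sz.
  have rp := rr_gt0 p; have e18 := eps0_le1.
  have [hlc xc vc _] := proj_unique sl hc.
  have hly := lfs_ge_dist y (rr_lfs p).
  have d0 : euc_dist c y <= rr p / 144.
    apply: le_trans (ltW y1) _; have : mu0 * (eps0 * rr p) <= rr p / 18.
      by apply: (@le_trans _ _ (eps0 * rr p)); [rewrite ler_piMl // mulr_ge0 // ltW|nra].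
    by rewrite mulrA; lra.
  have vy : euc_dist (v p) y <= 17 / 144 * rr p.
    apply: le_trans (ler_enorm_tri _ c _) _; rewrite -/(euc_dist _ _) -/(euc_dist _ _); lra.
  apply: (close_closest My hly w0 _).1.
  have [s [sA sp fz]] := (star_face A p z).1 sz.
  apply: le_lt_trans (ler_enorm_tri _ (v p) _) _.
  have := star_near sA sp fz; rewrite /euc_dist in vy * => h8.
  have : eps0 * rr p <= rr p / 18 by nra.
  lra.
Qed.

(* With [p] the vertex of largest barycentric coordinate, the tangential part of
   [x - v q] is of third order in [eps0], whereas the opposite faces of the star of
   [p] stay at first-order distance; so [v q] projects into the open star. *)
Lemma H_vertex l q : realization A l -> H l = v q -> l = unitv R q.
Proof.
have aux1 (w t e d L r : R) : 0 < t -> 0 < e -> 0 < r -> t * w <= 35 / 9 * e * d ->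
    d * r <= 7 / 10 * L ^+ 2 -> L <= e * r -> 0 <= L ->
    t * w <= 49 / 18 * (e ^+ 3 * r).
  move=> t_0 e_0 r_0 h1 h2 h3 L_0.
  have h4 : L ^+ 2 <= (e * r) ^+ 2 by rewrite lerXn2r ?nnegrE // mulr_ge0 // ltW.
  rewrite -(ler_pM2r r_0).
  have h5 : t * w * r <= 35 / 9 * e * d * r by rewrite ler_pM2r.
  have h6 : e * (d * r) <= e * (7 / 10 * (e * r) ^+ 2).
    by rewrite ler_pM2l //; lra.
  lra.
(* [t j <= 1] and [t <= 1] give [t (j + 1) <= 2]; with [lp >= 1 / (j + 1)] this yields
   [t^2 <= 2 lp], which turns the bound [mu t^4] into one by [lp]. *)
have aux2 (w t mu e r lp j : R) : 0 < t -> t <= 1 -> 0 < mu -> 0 < e -> 0 < r -> 1 <= j ->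
    t * w <= 49 / 18 * (e ^+ 3 * r) -> 324 * e ^+ 2 <= mu * t ^+ 4 -> t * j <= 1 ->
    1 <= lp * (j + 1) -> 10 / 9 * w < t * (mu * e * r) * lp.
  move=> t_0 t_1 mu_0 e_0 r_0 j_1 h1 h2 h3 h4.
  have lp0 : 0 < lp by nra.
  have er : 0 < e * r by rewrite mulr_gt0.
  have h5 : 324 * e ^+ 2 * (e * r) <= mu * t ^+ 4 * (e * r) by rewrite ler_pM2r.
  have t2 : t ^+ 2 <= 2 * lp.
    have : t * t <= t * (lp * (j + 1) * t).
      by rewrite ler_pM2l // ler_peMl // ltW.
    have : t * (j + 1) <= 2 by lra.
    move=> h6 h7; rewrite expr2; apply: le_trans h7 _.
    have : lp * t * (t * (j + 1)) <= lp * t * 2 by rewrite ler_pM2l // mulr_gt0.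
    have : lp * t <= lp by rewrite ler_piMr // ltW.
    lra.
  rewrite -(ltr_pM2l t_0).
  have h8 : mu * (e * r) * t ^+ 2 * t ^+ 2 <= mu * (e * r) * t ^+ 2 * (2 * lp).
    by rewrite ler_pM2l // !mulr_gt0 // exprn_gt0.
  have h9 : 0 < mu * (e * r) * t ^+ 2 * lp by rewrite !mulr_gt0 // exprn_gt0.
  have e1 : mu * t ^+ 4 * (e * r) = mu * (e * r) * t ^+ 2 * t ^+ 2 by ring.
  lra.
move=> rl Hq; have [bl sA] := rl; have [l0 l1] := bl.
have hc := H_closest rl; rewrite Hq in hc.
have [p0 _] := realization_vertex rl.
have [p _ pmax] := arg_maxP (fun i => l 0 i) (erefl true : xpredT p0).
pose s := supp l.
have s1 : \sum_(i in s) l 0 i = 1 by apply: face_sum; split=> //; exact: fintype.subxx.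
have lps : 1 <= l 0 p * #|s|%:R.
  rewrite -[leLHS]s1; apply: le_trans (ler_sum _ (fun i _ => pmax i isT)) _.
  by rewrite sumr_const mulr_natr.
have lp : 0 < l 0 p.
  rewrite lt_def l0 andbT; apply/negP => /eqP lp0.
  by move: lps; rewrite lp0 mul0r ler10.
have sp : p \in s by rewrite inE gt_eqF.
have sl := realization_star rl lp.
have fl : face_pts s l by split=> //; exact: fintype.subxx.
have rp := rr_gt0 p; have e18 := eps0_le1.
have pq : p = q.
  apply/eqP; apply: contraT => pq.
  have [c1|s2] := leqP #|s| 1.
    have sE : s = [set p]%SET.
      by apply/eqP; rewrite eq_sym eqEcard finset.sub1set sp cards1.
    have lp1 : l 0 p = 1 by rewrite -s1 sE big_set1.
    have xp : pl_map v l = v p by rewrite (face_pl_map v fl) sE big_set1 lp1 scale1r.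
    case: hc => _ /(_ _ (vM p)); rewrite xp euc_distxx => h.
    have : euc_dist (v p) (v q) == 0 by rewrite eq_le h enorm_ge0.
    by rewrite euc_dist_eq0 (inj_eq vinj) (negbTE pq).
  have [ht hpL] := edges sA s2; have [hmu hL] := hpL p sp.
  have [vc xc xr] := simplex_close sA s2 sp fl hc.
  have L_0 := Ledge_gt0 vinj s2.
  have near : euc_dist (v q) (v p) < rr p / 15.
    rewrite euc_distC; apply: le_lt_trans (vc p sp) _.
    have : eps0 * rr p <= rr p / 18 by nra.
    lra.
  pose t := (v q - v p) *m P (v p).
  have tP : t *m P (v p) = t by exact: proj_idem.
  pose w := t - f p l.
  have wE : w = (v q - pl_map v l) *m P (v p).
    by rewrite /w /t /star_chart -mulmxBl opprB addrA subrK.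
  have wP : w *m P (v p) = w by rewrite wE proj_idem.
  have Hqq : euc_dist (H l) (v q) <= mu0 * eps0 * rr p / 8.
    by rewrite Hq euc_distxx ltW // near_gt0.
  have tv := tangent_variation rl lp (vM q) Hqq wP.
  (* [x - v q] is normal at [v q], so only the part of [w] normal at [v q] pairs with it. The small
     angle between the tangent spaces at [v p] and [v q] supplies the third factor [eps0]. *)
  have w2 : enorm w ^+ 2 <= euc_dist (pl_map v l) (v q) * enorm (w - w *m P (v q)).
    have -> : enorm w ^+ 2 = dotp (v q - pl_map v l) (w - w *m P (v q)).
      rewrite dotpBr (coproj_orth (oPv q)) ?subr0; last first.
        by rewrite -opprB mulNmx (perp hc) oppr0.
      by rewrite enorm_sqr {1}wE (proj_adj (oPv p)) wP.
    by rewrite euc_distC; exact: ler_dotp.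
  have w3 : t0 * enorm w <= 35 / 9 * eps0 * euc_dist (pl_map v l) (v q).
    have [->|wn0] := eqVneq (enorm w) 0.
      by rewrite mulr0 !mulr_ge0 ?invr_ge0 ?enorm_ge0 ?(ltW eps0_gt0).
    have wp : 0 < enorm w by rewrite lt_def wn0 enorm_ge0.
    rewrite -(ler_pM2r wp) -(mulrA t0) -(expr2 (enorm w)).
    apply: (@le_trans _ _ (t0 * (euc_dist (pl_map v l) (v q) * enorm (w - w *m P (v q))))).
      by rewrite ler_wpM2l // ltW.
    rewrite mulrCA [leRHS]mulrAC [leRHS]mulrC.
    exact: (ler_wpM2l (enorm_ge0 _) tv).
  have w4 := aux1 _ _ _ _ _ _ t0_gt0 eps0_gt0 rp w3 xr hL (ltW L_0).
  have j1 : 1 <= (#|s|.-1)%:R :> R by rewrite ler1n; case: #|s| s2 => [|[]].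
  have jE : (#|s|.-1)%:R + 1 = #|s|%:R :> R by rewrite natr1 prednK // ltnW.
  rewrite -jE in lps.
  have w5 := aux2 _ _ _ _ _ _ _ t0_gt0 t0_le1 mu0_gt0 eps0_gt0 rp j1 w4 eps0_sq
    (thick_dim vinj s2 ht) lps.
  (* The projection of [v q] is covered by a point [l'] with positive [p]-coordinate. By (c), [q] is
     a vertex of the star, so injectivity makes [l'] the vertex [q], whose [p]-coordinate is 0. *)
  have [|||l' [sl' lp' fl']] := star_coord_ball (oPv p) (femb p) (fint p) sl _ _ _ tP w5.
  - by rewrite !mulr_gt0.
  - move=> s' s'A s'2 s'p; have [ht' /(_ p s'p)[hmu' _]] := edges s'A s'2.
    apply: le_trans (amin_ge vinj s'2 ht'); rewrite ler_pM2l //.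
    apply: le_trans hmu' _; rewrite ler_peMl ?(ltW (Ledge_gt0 vinj s'2)) //.
    by rewrite ler1n; case: #|s'| s'2 => [|[]].
  - by move=> s' u s'A s'p; exact: vertex_proj_le.
  have [s' s'A /andP[sp' sq']] : star_vertex A p q by apply: sanity => //; exists l'.
  have sq : star_pts A p (unitv R q).
    by apply/star_face; exists s'; split=> //; exact: vert_face.
  have : l' = unitv R q.
    by apply: (star_inj (femb p) sl' sq); rewrite fl' /star_chart vert_pl_map.
  by move=> l'E; move: lp'; rewrite l'E !mxE eqxx /= (negbTE pq) ltxx.
(* Now [x - v p] is both a simplex direction, hence nearly tangent at [v p], and normal there, so it
   vanishes. *)
rewrite -pq in hc *; have fp := vert_face R sp.
have sp' : star_pts A p (unitv R p) by apply/star_face; exists s.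
apply: (iinj sl sp'); rewrite vert_pl_map; apply/eqP; rewrite -subr_eq0 -enorm_eq0.
have := vertex_proj_le sA sp (face_dir v fl fp).
by rewrite vert_pl_map (perp hc) enorm0 mulr0 eq_le enorm_ge0 andbT.
Qed.

Hypothesis comp : forall y, M y -> exists i, connected_component M y (v i).

Lemma unitv_realization i : realization A (unitv R i).
Proof. by split; [exact: vert_bary|rewrite vert_supp vert_in]. Qed.

Lemma H_unitv i : H (unitv R i) = v i.
Proof.
apply: H_uniq; first exact: unitv_realization.
by rewrite vert_pl_map; exact: vertex_closest.
Qed.

Lemma H_surj y : M y -> exists2 l, realization A l & H l = y.
Proof.
move=> My; have [i [C [Cy CM cC] Ci]] := comp My.
have r_i := unitv_realization i.
apply: (@connected_clopen R N C [set y | exists2 l, realization A l & H l = y]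
  (v i) y cC _ _ Ci Cy); last by exists (unitv R i) => //; exact: H_unitv.
- move=> z Cz [l rl <-]; have [d d0 hd] := H_open rl ltr01.
  exists d => // z' /CM Mz' /(hd z' Mz')[l' [rl' _ hl']].
  by exists l'.
- move=> z Cz nz.
  have [|c rc hcm] := compact_argmin _ realization_compact (cont_on_rcont z H_cont).
    by exists (unitv R i).
  exists (euc_dist (H c) z).
    rewrite lt_def euc_dist_eq0 enorm_ge0 andbT; apply/eqP => e.
    by apply: nz; exists c.
  move=> z' Cz' zz' [l rl lz']; have := hcm l rl.
  by rewrite lz' leNgt euc_distC zz'.
Qed.

Lemma H_inj l1 l2 : realization A l1 -> realization A l2 -> H l1 = H l2 -> l1 = l2.
Proof.
move=> r1 r2 e12; apply: contrapT => n12.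
have [i [C [Cy CM cC] Ci]] := comp (H_in r1).
pose D := [set y | exists a b, [/\ realization A a, realization A b, a <> b, H a = y & H b = y]].
have : D (v i).
  apply: (@connected_clopen R N C D (H l1) (v i) cC _ _ Cy Ci); last by exists l1, l2.
  (* Half the distance between the two preimages keeps them distinct when a nearby value is lifted
     from both. *)
  - move=> z Cz [a [b [ra rb ab az bz]]].
    have e0 : 0 < euc_dist a b / 2.
      rewrite divr_gt0 // lt_def euc_dist_eq0 enorm_ge0 andbT; exact/eqP.
    have [d1 d10 hd1] := H_open ra e0; have [d2 d20 hd2] := H_open rb e0.
    exists (Num.min d1 d2); first by rewrite lt_min d10.
    move=> z' /CM Mz'; rewrite lt_min => /andP[z1 z2].
    have [|a' [ra' aa' az']] := hd1 z' Mz'; first by rewrite az.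
    have [|b' [rb' bb' bz']] := hd2 z' Mz'; first by rewrite bz.
    exists a', b'; split=> // ab'.
    have : euc_dist a b <= euc_dist a a' + euc_dist b a'.
      by rewrite (euc_distC b a') ler_enorm_tri.
    by apply/negP; rewrite -ltNge [euc_dist a b]splitr ltrD // ab'.
  (* At a value with one preimage, compactness forces the preimages of nearby values into a
     neighbourhood on which [H] is injective. *)
  - move=> z Cz nz; have [l rl lz] := H_surj (CM _ Cz).
    have [d d0 hd] := H_locally_injective rl.
    have [|d' d'0 hd'] := @compact_far_gap R n N _ H l z d realization_compact H_cont.
      move=> z' rz' dz' hz'; apply: nz; exists l, z'; split=> // lz'.
      by move: dz'; rewrite lz' euc_distxx leNgt d0.
    exists d' => // z' Cz' zz' [a [b [ra rb ab az bz]]]; apply: ab.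
    apply: hd => //; last by rewrite az bz.
      by apply: hd' => //; rewrite az.
    by apply: hd' => //; rewrite bz.
case=> a [b [ra rb ab /(H_vertex ra) av /(H_vertex rb) bv]].
by apply: ab; rewrite av bv.
Qed.

Lemma H_embedding : embedding_on (realization A) H.
Proof. exact: compact_embedding realization_compact H_cont H_inj. Qed.

Lemma pl_map_embedding : embedding_on (realization A) (pl_map v).
Proof.
apply: compact_embedding realization_compact (@pl_map_cont _ _ _ _ _) _.
by move=> l l' rl rl' e; apply: H_inj => //; rewrite /H e.
Qed.

Lemma cproj_homeo : homeo_onto (pl_map v @` realization A) M (cproj M).
Proof.
split; last first.
  apply/seteqP; split=> [_ [_ [l rl <-] <-]|y /H_surj[l rl <-]]; first exact: H_in.
  by exists (pl_map v l) => //; exists l.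
split.
- move=> x x'; rewrite !inE => -[l rl <-] [l' rl' <-] e.
  by rewrite (H_inj rl rl' e).
- move=> _ [l rl <-] e e0.
  have uq c : closest M (pl_map v l) c -> c = H l by move=> /(H_uniq rl) ->.
  have [d d0 hd] := closest_continuity cM (H_closest rl) uq e0.
  by exists d => // _ [l' rl' <-] ll'; apply: hd ll' _; exact: H_closest.
- move=> _ [l rl <-] e e0.
  have [d d0 hd] := @pl_map_cont R n N v (realization A) l rl e e0.
  have [_ _ ic] := H_embedding; have [d' d'0 hd'] := ic l rl d d0.
  by exists d' => // _ [l' rl' <-] /(hd' l' rl'); exact: hd.
Qed.

(** Avoiding the closure takes a whole ball: the medial axis is at least [8 / 9 rr p] away from
    [H l], which is within [rr p / 18] of the point, so radius [rr p / 2] is free of it. *)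
Lemma realization_UM x : (pl_map v @` realization A) x -> UM M x.
Proof.
case=> l rl <-; have [p lp] := realization_vertex rl.
have [hl xc _ _] := proj_unique (realization_star rl lp) (H_closest rl).
have rp := rr_gt0 p.
move=> cl; have [|z [mz /=]] := cl [set z | euc_dist (pl_map v l) z < rr p / 2].
  by apply/nbhs_enormP; exists (rr p / 2) => //; rewrite divr_gt0.
have /lfs_geP/(_ z mz) h := hl.
apply/negP; rewrite -leNgt.
have : euc_dist (H l) z <= euc_dist (H l) (pl_map v l) + euc_dist (pl_map v l) z.
  exact: ler_enorm_tri.
rewrite (euc_distC (H l) (pl_map v l)); lra.
Qed.

(** [simplex_close] is relative to the radius at a vertex; the feature size at the projection is at
    least [8 / 9 rr p], and [7 / 10 <= 7 / 3 * 8 / 9]. *)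
Lemma realization_close s l : s \in A -> face_pts s l ->
  ((euc_dist (H l) (pl_map v l))%:E <= (7 / 3 * eps0 ^+ 2)%:E * lfs M (H l))%E.
Proof.
have aux (a r L e : R) : 0 < r -> a * r <= 7 / 10 * L ^+ 2 -> L <= e * r -> 0 < L ->
    0 < e -> a <= 7 / 3 * e ^+ 2 * (8 / 9 * r).
  move=> r0 h1 h2 L0 e0.
  have h3 : L ^+ 2 <= (e * r) ^+ 2 by rewrite lerXn2r ?nnegrE ?mulr_ge0 // ltW.
  rewrite -(ler_pM2r r0); apply: le_trans h1 _.
  have : 0 <= (e * r) ^+ 2 by exact: sqr_ge0.
  lra.
move=> sA fl.
have rl : realization A l.
  case: fl => bl ls; split=> //; case: Acx => _ _ down.
  by apply: (down s) => //; exact: bary_supp_neq0.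
have [p lp] := realization_vertex rl.
have sp : p \in s by case: fl => _ ls; apply: (fintype.subsetP ls); rewrite inE gt_eqF.
have [hl _ _ _] := proj_unique (realization_star rl lp) (H_closest rl).
have e2 : 0 <= 7 / 3 * eps0 ^+ 2 by rewrite mulr_ge0 // sqr_ge0.
apply: (@le_trans _ _ ((7 / 3 * eps0 ^+ 2)%:E * (8 / 9 * rr p)%:E)%E); last first.
  by apply: lee_wpmul2l; rewrite ?lee_fin.
rewrite -EFinM lee_fin euc_distC.
have [c1|s2] := leqP #|s| 1.
  have sE : s = [set p]%SET.
    by apply/eqP; rewrite eq_sym eqEcard finset.sub1set sp cards1.
  have lp1 : l 0 p = 1 by have := face_sum fl; rewrite sE big_set1.
  have xp : pl_map v l = v p by rewrite (face_pl_map v fl) sE big_set1 lp1 scale1r.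
  apply: (@le_trans _ _ 0); last by rewrite !mulr_ge0 ?sqr_ge0 // ltW.
  have [_ /(_ _ (vM p)) h] := H_closest rl; apply: le_trans h _.
  by rewrite xp euc_distxx.
have [_ /(_ p sp)[_ hL]] := edges sA s2.
have [_ _ xr] := simplex_close sA s2 sp fl (H_closest rl).
exact: aux xr hL (Ledge_gt0 vinj s2) eps0_gt0.
Qed.

Lemma realization_angle s l u : s \in A -> face_pts s l -> dir_space v s u ->
  enorm (u - u *m P (H l)) <= 13 * eps0 / (4 * t0) * enorm u.
Proof.
move=> sA fl du.
have rl : realization A l.
  case: fl => bl ls; split=> //; case: Acx => _ _ down.
  by apply: (down s) => //; exact: bary_supp_neq0.
have [p lp] := realization_vertex rl.
have sp : p \in s by case: fl => _ ls; apply: (fintype.subsetP ls); rewrite inE gt_eqF.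
have hh : euc_dist (H l) (H l) <= mu0 * eps0 * rr p / 8.
  by rewrite euc_distxx ltW // near_gt0.
have h := simplex_angle sA sp fl (H_closest rl) (H_in rl) hh du.
rewrite -(ler_pM2l t0_gt0); apply: le_trans h _.
have -> : t0 * (13 * eps0 / (4 * t0) * enorm u) = 13 / 4 * (eps0 * enorm u).
  by field; rewrite gt_eqF.
have : 0 <= eps0 * enorm u by rewrite mulr_ge0 ?enorm_ge0 // ltW.
lra.
Qed.

End Close.

(** * Angles between subspaces; feature size at isolated points *)

Section Angles.
Variable R : realType.

(** All angles are compared with [asin b], in the range where [sin] is monotone. Since [b < 1], the
    projection of a nonzero [u] is nonzero and the right-angle default of [vangle] does not
    arise. *)
Lemma sin_sangle_le N (K : set 'rV[R]_N) (P : 'M[R]_N) (b : R) :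
  orth_proj P -> 0 <= b < 1 ->
  (forall u, K u -> enorm (u - u *m P) <= b * enorm u) ->
  sin (sangle K [set w | w *m P = w]) <= b.
Proof.
move=> oP /andP[b0 b1] h.
have bI : -1 <= b <= 1 by rewrite (le_trans _ b0) ?lerN10 // ltW.
have sb : sin (asin b) = b by apply: asinK; rewrite in_itv.
have ab0 : 0 <= asin b.
  rewrite leNgt; apply/negP => lt; move: b0; rewrite leNgt => /negP; apply.
  rewrite -sb -(sin0 R) ltr_sin // in_itv /= ?asin_geNpi2 ?asin_lepi2 //.
  by rewrite oppr_le0 andbb divr_ge0 // pi_ge0.
have bound theta : [set vangle u (cproj [set w | w *m P = w] u) | u in K `\ 0] theta ->
    0 <= theta <= asin b.
  case=> u [Ku /eqP u0] <-; rewrite (cproj_linear oP).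
  have up : 0 < enorm u by rewrite enorm_gt0.
  have Pu2 : (1 - b ^+ 2) * enorm u ^+ 2 <= enorm (u *m P) ^+ 2.
    have := proj_pyth oP u.
    have : enorm (u - u *m P) ^+ 2 <= (b * enorm u) ^+ 2.
      by rewrite lerXn2r ?nnegrE ?mulr_ge0 ?enorm_ge0 ?h.
    rewrite exprMn; lra.
  have bb : b ^+ 2 < 1 by rewrite expr_lt1.
  have Pp : 0 < enorm (u *m P).
    rewrite lt_def enorm_ge0 andbT -sqrf_eq0 gt_eqF //; apply: lt_le_trans Pu2.
    by rewrite mulr_gt0 ?subr_gt0 ?exprn_gt0.
  rewrite /vangle (negbTE u0) -enorm_eq0 gt_eqF //=.
  have -> : dotp u (u *m P) / (enorm u * enorm (u *m P)) = enorm (u *m P) / enorm u.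
    have -> : dotp u (u *m P) = enorm (u *m P) ^+ 2.
      by rewrite enorm_sqr (proj_adj oP) (proj_idem oP).
    by field; rewrite !gt_eqF.
  set q := _ / _.
  have q0 : 0 < q by rewrite divr_gt0.
  have q1 : q <= 1 by rewrite ler_pdivrMr // mul1r ler_enorm_proj.
  have qb : 1 - q ^+ 2 <= b ^+ 2.
    rewrite /q expr_div_n lerBlDr -lerBlDl ler_pdivlMr ?exprn_gt0 //.
  have qI : -1 <= q <= 1 by rewrite q1 (le_trans _ (ltW q0)) ?lerN10.
  rewrite acos_ge0 //= leNgt; apply/negP => lt.
  have qpi2 : acos q <= pi / 2.
    rewrite leNgt; apply/negP => lt2; move: q0; rewrite ltNge => /negP; apply.
    have {1}<- : cos (acos q) = q by apply: acosK; rewrite in_itv.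
    rewrite -(cos_pihalf R) ltW // ltr_cos // in_itv /=.
      by rewrite divr_ge0 ?pi_ge0 //= ler_pdivrMr // ler_peMr ?pi_ge0 // ler1n.
    by rewrite acos_ge0 // acos_lepi.
  have : sin (asin b) < sin (acos q).
    rewrite ltr_sin // in_itv /= ?asin_geNpi2 ?asin_lepi2 // qpi2 andbT.
    by rewrite (le_trans _ (acos_ge0 qI)) // oppr_le0 divr_ge0 ?pi_ge0.
  rewrite sb sin_acos // ltNge => /negP; apply.
  by rewrite -[leRHS](ger0_norm b0) -sqrtr_sqr ler_wsqrtr.
rewrite /sangle; set S := [set vangle _ _ | _ in _].
(* The direction space of a 0-simplex is zero; the supremum of the empty set of angles is then 0. *)
have [[th hth]|S0] := pselect (S !=set0); last first.
  have -> : S = set0 by apply/seteqP; split=> // z hz; apply: S0; exists z.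
  by rewrite sup0 sin0.
have hS : has_sup S by split; [exists th|exists (asin b) => z /bound/andP[]].
have s1 : sup S <= asin b by apply: ge_sup; [exists th|move=> z /bound/andP[]].
have s0 : 0 <= sup S.
  have /andP[th0 _] := bound th hth; apply: le_trans th0 _.
  by apply: ub_le_sup => //; case: hS.
rewrite leNgt; apply/negP; rewrite -{1}sb ltr_sin ?in_itv /= ?asin_geNpi2 ?asin_lepi2 //.
  by apply/negP; rewrite -leNgt.
rewrite (le_trans s1) ?asin_lepi2 // andbT (le_trans _ s0) //.
by rewrite oppr_le0 divr_ge0 ?pi_ge0.
Qed.

Lemma distS_closest N (M : set 'rV[R]_N) x y : closest M x y ->
  distS M x = euc_dist x y.
Proof.
case=> My h; apply/eqP; rewrite eq_le; apply/andP; split.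
  by apply: ge_inf; [exists 0 => _ [z _ <-]; exact: enorm_ge0|exists y].
by apply: lb_le_inf; [exists (euc_dist x y); exists y|move=> _ [z Mz <-]; exact: h].
Qed.

Lemma lfs_ge0 N (M : set 'rV[R]_N) y : (0%:E <= lfs M y)%E.
Proof. by apply/lfs_geP => z _; exact: enorm_ge0. Qed.

(** A medial point nearer than [tau] to [w] would have [w] as its only closest point. Supplies the
    radius at vertices without edges. *)
Lemma isolated_lfs N (M : set 'rV[R]_N) w (tau : R) : M w ->
  (forall y, M y -> y = w \/ 2 * tau <= euc_dist w y) -> (tau%:E <= lfs M w)%E.
Proof.
move=> Mw h; apply/lfs_geP => z [y [y' [ne hy hy']]].
rewrite leNgt; apply/negP => lt.
have main x : closest M z x -> x = w.
  move=> [Mx /(_ _ Mw) hx]; case: (h x Mx) => // far; exfalso.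
  have : euc_dist w x <= euc_dist w z + euc_dist z x by exact: ler_enorm_tri.
  move: hx; rewrite (euc_distC z w); lra.
by apply: ne; rewrite (main y hy) (main y' hy').
Qed.

End Angles.

(** * Hypothesis (a) in linear coordinates *)

Section StarVertex.
Variables (R : realType) (N n : nat) (v : 'I_n -> 'rV[R]_N).
Variables (A : {set {set 'I_n}}) (p : 'I_n) (P : 'M[R]_N).
Hypothesis oP : orth_proj P.
Let flat := [set v p + w | w in [set w | w *m P = w]].
Hypothesis emb : embedding_on (star_pts A p) (pl_map v).
Hypothesis femb : embedding_on (pl_map v @` star_pts A p) (cproj flat).
Hypothesis fint : rel_interior_pt flat (cproj flat @` (pl_map v @` star_pts A p)) (v p).

Lemma star_chart_cproj l : star_chart v p P l = cproj flat (pl_map v l) - v p.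
Proof. by rewrite cproj_flat // addrC addKr. Qed.

Lemma star_chart_embedding : embedding_on (star_pts A p) (star_chart v p P).
Proof.
have [inj cf ic] := emb; have [inj' cf' ic'] := femb.
have dE l l' : euc_dist (star_chart v p P l) (star_chart v p P l') =
    euc_dist (cproj flat (pl_map v l)) (cproj flat (pl_map v l')).
  by rewrite /euc_dist !star_chart_cproj opprB addrA subrK.
split.
- move=> l l'; rewrite !inE => sl sl' /eqP e; apply: inj; rewrite ?inE //.
  apply: inj'; rewrite ?inE; [by exists l|by exists l'|].
  by apply/eqP; rewrite -euc_dist_eq0 -dE euc_dist_eq0.
- move=> l sl e e0; have [|d d0 hd] := cf' (pl_map v l) _ e e0; first by exists l.
  have [d' d'0 hd'] := cf l sl d d0; exists d' => // l' sl' ll'.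
  by rewrite dE; apply: hd; [exists l'|exact: hd'].
- move=> l sl e e0; have [d d0 hd] := ic l sl e e0.
  have [|d' d'0 hd'] := ic' (pl_map v l) _ d d0; first by exists l.
  exists d' => // l' sl'; rewrite dE => ll'; apply: hd => //.
  by apply: hd' => //; exists l'.
Qed.

Lemma star_chart_interior : exists2 r : R, 0 < r &
  forall t, t *m P = t -> enorm t < r ->
  exists2 l, star_pts A p l & star_chart v p P l = t.
Proof.
have [r r0 h] := fint; exists r => // t tP tr.
have [|_ [l sl <-] hl] := h (v p + t) (ex_intro2 _ _ t tP erefl).
  by rewrite /euc_dist addrC addKr.
by exists l => //; rewrite star_chart_cproj hl addrC addKr.
Qed.

(** The star is then a single point, and a point is interior to a flat only in dimension 0. *)
Lemma isolated_tangent : (forall s, s \in A -> p \in s -> (#|s| <= 1)%N) ->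
  forall t : 'rV_N, t *m P = t -> t = 0.
Proof.
move=> hs t tP; have [r r0 h] := star_chart_interior.
apply/eqP; apply: contraT => t0; have tp : 0 < enorm t by rewrite enorm_gt0.
pose a := r / 2 / enorm t; have a0 : 0 < a by rewrite !divr_gt0.
have [||l [bl [s sA /andP[sp ls]]] hl] := h (a *: t).
- by rewrite -scalemxAl tP.
- rewrite enormZ gtr0_norm // /a divfK ?gt_eqF //.
  by rewrite ltr_pdivrMr // ltr_pMr // ltr1n.
have sE : s = [set p]%SET.
  by apply/eqP; rewrite eq_sym eqEcard finset.sub1set sp cards1 hs.
have fl : face_pts s l by [].
have lp1 : l 0 p = 1 by have := face_sum fl; rewrite sE big_set1.
move: hl; rewrite /star_chart (face_pl_map v fl) sE big_set1 lp1 scale1r subrr mul0mx.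
by move/esym/eqP; rewrite scaler_eq0 gt_eqF //= (negbTE t0).
Qed.

End StarVertex.

Theorem mainTheorem15 (R : realType) (N m n : nat) (M : set 'rV[R]_N)
  (v : 'I_n -> 'rV[R]_N) (A : {set {set 'I_n}}) (t0 mu0 eps0 : R) :
  (* M compact C^2 submanifold of dimension m *)
  C2_submanifold m M -> compact M ->
  (* P = {v i} is a finite subset of M, identified bijectively with 'I_n,
     meeting every connected component of M *)
  injective v -> (forall i, M (v i)) ->
  (forall x, M x -> exists i, connected_component M x (v i)) ->
  (* A is a simplicial complex with vertex set 'I_n; iota embeds every star *)
  simplicial_complex A ->
  (forall p, embedding_on (star_pts A p) (pl_map v)) ->
  (* (a) *)
  (forall p : 'I_n,
     embedding_on (pl_map v @` star_pts A p) (cproj (tangent_flat M (v p))) /\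
     rel_interior_pt (tangent_flat M (v p))
       (cproj (tangent_flat M (v p)) @` (pl_map v @` star_pts A p)) (v p)) ->
  (* (b) *)
  0 < t0 <= 1 -> 0 < mu0 <= 1 -> 0 < eps0 ->
  eps0 <= Num.sqrt mu0 * t0 ^+ 2 / 18 ->
  (forall s, s \in A -> (2 <= #|s|)%N ->
     t0 <= thick v s /\
     forall p, p \in s ->
       ((mu0 * eps0)%:E * lfs M (v p) <= (Ledge v s)%:E)%E /\
       ((Ledge v s)%:E <= eps0%:E * lfs M (v p))%E) ->
  (* (c) *)
  (forall p q : 'I_n,
     ((euc_dist (v q) (v p))%:E < lfs M (v p) * (15^-1)%:E)%E ->
     (img (cproj (tangent_flat M (v p))) (pl_map v @` star_pts A p)
        (cproj (tangent_flat M (v p)) (v q))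
      <-> star_vertex A p q)) ->
  (* conclusions *)
  [/\ (* (1) *) embedding_on (realization A) (pl_map v),
      (* (2) *) (forall x, (pl_map v @` realization A) x -> UM M x) /\
                homeo_onto (pl_map v @` realization A) M (cproj M) &
      (* (3) *) forall s, s \in A -> forall l, face_pts s l ->
        let x := pl_map v l in let xc := cproj M x in
        [/\ distS M x = euc_dist xc x,
            ((euc_dist xc x)%:E <= (7 / 3 * eps0 ^+ 2)%:E * lfs M xc)%E &
            sin (sangle (dir_space v s) (tangent_vectors M xc)) <= 13 * eps0 / (4 * t0)]].
Proof.
move=> mM cM vinj vM comp Acx emb ha /andP[t0_gt0 t0_le1] /andP[mu0_gt0 mu0_le1].
move=> eps0_gt0 eps0_small hb hc.
pose good w (P : 'M[R]_N) := [/\ orth_proj P, \rank P = m,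
    tangent_vectors M w = [set u | u *m P = u] &
   [/\ exists2 tau : R, 0 < tau & forall n y, M y -> n *m P = 0 ->
       2 * tau * dotp n (y - w) <= enorm n * enorm (y - w) ^+ 2,
      forall x, closest M x w -> (x - w) *m P = 0 &
      forall n, n *m P = 0 -> forall e : R, 0 < e -> exists2 d : R, 0 < d &
        forall y, M y -> euc_dist w y < d -> forall t, tangent_vectors M y t ->
        `|dotp n t| <= e * enorm t]].
(* Points outside [M] get a dummy matrix, so that choice yields a function on the whole space. *)
have exP w : exists Q, M w -> good w Q.
  have [Mw|nMw] := pselect (M w); last by exists 0.
  by have [Q hQ] := manifold_tangent mM Mw; exists Q.
have [P hP] := boolp.choice exP.
have oP w : M w -> orth_proj (P w) by case/hP.
have rkP w : M w -> \rank (P w) = m by case/hP.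
have TP w : M w -> tangent_vectors M w = [set u | u *m P w = u] by case/hP.
have fed w (rho : R) nu y : M w -> 0 <= rho -> (rho%:E <= lfs M w)%E ->
    nu *m P w = 0 -> M y -> 2 * rho * dotp nu (y - w) <= enorm nu * enorm (y - w) ^+ 2.
  move=> Mw rho0 hl nuP My; have [_ _ _ [[tau tau0 htau] _ _]] := hP w Mw.
  by apply: (federer_normal cM Mw tau0 hl rho0) => // y' My'; exact: htau.
have perp x w : closest M x w -> (x - w) *m P w = 0.
  by move=> hx; have [Mw _] := hx; have [_ _ _ [_ hp _]] := hP w Mw; exact: hp.
have tcont w nu : M w -> nu *m P w = 0 -> forall e : R, 0 < e ->
    exists2 d : R, 0 < d & forall y, M y -> euc_dist w y < d -> enorm (nu *m P y) <= e.
  move=> Mw nuP e e0; have [_ _ _ [_ _ hcont]] := hP w Mw.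
  have [d d0 hd] := hcont nu nuP e e0; exists d => // y My wy.
  (* Testing with the tangent vector [nu *m P y] bounds its squared length by [e] times its
     length. *)
  have := hd y My wy (nu *m P y).
  rewrite TP //= (proj_idem (oP y My)) => /(_ erefl).
  rewrite -[X in dotp nu X](proj_idem (oP y My)) -(proj_adj (oP y My)).
  rewrite -enorm_sqr ger0_norm ?sqr_ge0 //.
  have [->|n0] := eqVneq (enorm (nu *m P y)) 0; first by rewrite (ltW e0).
  by rewrite expr2 ler_pM2r // lt_def n0 enorm_ge0.
have flatE p : tangent_flat M (v p) =
    [set v p + w | w in [set w | w *m P (v p) = w]].
  by rewrite /tangent_flat TP.
have femb p : embedding_on (star_pts A p) (star_chart v p (P (v p))).
  apply: star_chart_embedding (oP _ (vM p)) (emb p) _.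
  by rewrite -flatE; case: (ha p).
have fint p : exists2 r : R, 0 < r & forall t, t *m P (v p) = t -> enorm t < r ->
    exists2 l, star_pts A p l & star_chart v p (P (v p)) l = t.
  by apply: star_chart_interior (oP _ (vM p)) _; rewrite -flatE; case: (ha p).
have iinj p l l' : star_pts A p l -> star_pts A p l' ->
    pl_map v l = pl_map v l' -> l = l'.
  by case: (emb p) => inj _ _ sl sl'; apply: inj; rewrite inE.
have t0sq : 0 < t0 ^+ 2 by rewrite exprn_gt0.
have small : 18 * eps0 <= Num.sqrt mu0 * t0 ^+ 2.
  by rewrite mulrC -ler_pdivlMr.
have small18 : 18 * eps0 <= t0 ^+ 2.
  apply: le_trans small _.
  by rewrite ler_piMl ?(ltW t0sq) // -sqrtr1 ler_wsqrtr.
have small_sq : 324 * eps0 ^+ 2 <= mu0 * t0 ^+ 4.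
  have e0 : 0 <= 18 * eps0 by rewrite mulr_ge0 // ltW.
  have : (18 * eps0) ^+ 2 <= (Num.sqrt mu0 * t0 ^+ 2) ^+ 2.
    by apply: lerXn2r => //; rewrite nnegrE // (le_trans e0).
  have -> : (18 * eps0) ^+ 2 = 324 * eps0 ^+ 2 by ring.
  have -> : (Num.sqrt mu0 * t0 ^+ 2) ^+ 2 = Num.sqrt mu0 ^+ 2 * t0 ^+ 4 by ring.
  by rewrite sqr_sqrtr // ltW.
have exr p : exists r : R, [/\ 0 < r, (r%:E <= lfs M (v p))%E &
    forall s, s \in A -> (2 <= #|s|)%N -> p \in s ->
      mu0 * eps0 * r <= Ledge v s /\ Ledge v s <= eps0 * r].
  have [[s [sA s2 sp]]|none] := pselect (exists s, [/\ s \in A, (2 <= #|s|)%N & p \in s]).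
    have L0 := Ledge_gt0 vinj s2.
    have me0 : 0 < mu0 * eps0 by rewrite mulr_gt0.
    have [_ /(_ p sp)[h1 h2]] := hb s sA s2.
    have := lfs_ge0 M (v p).
    (* The lower length bound excludes an infinite feature size, the upper one excludes 0. *)
    case lE : (lfs M (v p)) h1 h2 => [r||] h1 h2 r_ge0 //; last first.
      by move: h1; rewrite gt0_muley ?lte_fin.
    exists r; split=> //.
      rewrite lt_neqAle -lee_fin r_ge0 andbT; apply/negP => /eqP r0.
      by move: h2; rewrite -r0 -EFinM mulr0 lee_fin leNgt L0.
    move=> s' s'A s'2 s'p; have [_ /(_ p s'p)] := hb s' s'A s'2.
    by rewrite lE -!EFinM !lee_fin.
  have iso : forall t : 'rV_N, t *m P (v p) = t -> t = 0.
    apply: (isolated_tangent (oP _ (vM p)) (A := A) (v := v) (p := p)).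
      by rewrite -flatE; case: (ha p).
    move=> s sA sp; rewrite leqNgt; apply/negP => s2.
    by apply: none; exists s.
  have [_ _ _ [[tau tau0 htau] _ _]] := hP _ (vM p).
  exists tau; split=> //; last first.
    by move=> s sA s2 sp; exfalso; apply: none; exists s.
  apply: isolated_lfs => // y My.
  (* With zero tangent space every vector is normal, so the chart bound keeps the rest of [M] at
     distance at least [2 tau]. *)
  have yP : (y - v p) *m P (v p) = 0 by apply: iso; rewrite (proj_idem (oP _ (vM p))).
  have := htau _ y My yP; rewrite -enorm_sqr euc_distC /euc_dist.
  have [/eqP|y0] := eqVneq (enorm (y - v p)) 0.
    by rewrite enorm_eq0 subr_eq0 => /eqP; left.
  have yp : 0 < enorm (y - v p) by rewrite lt_def y0 enorm_ge0.
  rewrite ler_pM2r ?exprn_gt0 //.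
  by right.
have [rr hrr] := boolp.choice exr.
have rr_gt0 p : 0 < rr p by case: (hrr p).
have rr_lfs p : ((rr p)%:E <= lfs M (v p))%E by case: (hrr p).
have edges s : s \in A -> (2 <= #|s|)%N -> t0 <= thick v s /\
    forall p, p \in s -> mu0 * eps0 * rr p <= Ledge v s /\ Ledge v s <= eps0 * rr p.
  move=> sA s2; split; first by case: (hb s sA s2).
  by move=> p sp; case: (hrr p) => _ _; apply.
have sanity p q : euc_dist (v q) (v p) < rr p / 15 ->
    (exists2 l, star_pts A p l & star_chart v p (P (v p)) l = (v q - v p) *m P (v p)) ->
    star_vertex A p q.
  move=> near [l sl hl]; apply: (hc p q _).1.
    apply: (@lt_le_trans _ _ (rr p * 15^-1)%:E); first by rewrite lte_fin.
    by rewrite EFinM; apply: lee_wpmul2r => //; rewrite lee_fin invr_ge0.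
  exists (pl_map v l); first by exists l.
  by rewrite flatE !(cproj_flat (oP _ (vM p))) -hl.
have b1 : 0 <= 13 * eps0 / (4 * t0) < 1.
  have t40 : 0 < 4 * t0 by rewrite mulr_gt0.
  have e130 : 0 <= 13 * eps0 by rewrite mulr_ge0 // ltW.
  apply/andP; split; first by rewrite divr_ge0 // ltW.
  rewrite ltr_pdivrMr // mul1r.
  have : t0 ^+ 2 <= t0 by rewrite expr2 ler_piMl // ltW.
  lra.
split.
- exact: (pl_map_embedding vinj vM t0_gt0 t0_le1 mu0_gt0 mu0_le1 eps0_gt0 small18
    oP fed perp rr_gt0 rr_lfs edges cM Acx rkP tcont small_sq femb iinj fint sanity comp).
- split; last exact: (cproj_homeo vinj vM t0_gt0 t0_le1 mu0_gt0 mu0_le1 eps0_gt0 small18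
    oP fed perp rr_gt0 rr_lfs edges cM Acx rkP tcont small_sq femb iinj fint sanity comp).
  move=> x; exact: (realization_UM vM t0_gt0 t0_le1 eps0_gt0 small18
    fed perp rr_gt0 rr_lfs edges cM).
move=> s sA l fl x xc.
have rl : realization A l.
  case: fl => bl ls; split=> //; case: Acx => _ _ down.
  by apply: (down s) => //; exact: bary_supp_neq0.
have hx : closest M x xc.
  have [p _] := realization_vertex rl.
  by apply: closest_cproj => //; exists (v p).
split.
- by rewrite (distS_closest hx) euc_distC.
- rewrite /xc /x; exact: (realization_close vinj vM t0_gt0 t0_le1
    eps0_gt0 small18 fed perp rr_gt0 rr_lfs edges cM Acx sA fl).
- have [Mxc _] := hx; rewrite (TP _ Mxc); apply: sin_sangle_le => //; first exact: oP.
  by move=> u du; rewrite /xc /x; exact: (realization_angle vinj vM t0_gt0 t0_le1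
    mu0_gt0 eps0_gt0 small18 oP fed perp rr_gt0 rr_lfs edges cM Acx sA fl du).
Qed.
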